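(* Let $c(x,y)=|x-y|^2$ on $\mathbb{R}^d\times\mathbb{R}^d$. Let $\mu,\nu\in\mathcal{P}_2(\mathbb{R}^d)$, and assume that $\mu$ and $\nu$ satisfy the Logarithmic Sobolev inequality with constants $K_\mu>0$ and $K_\nu>0$ respectively. Let $\{\Lambda_n\}$ be a positive increasing sequence with $\lim_{n\to\infty}\Lambda_n=+\infty$. The problem $$\inf_{\gamma\in\mathcal{P}(\mathbb{R}^d\times\mathbb{R}^d)}\mathcal{E}_{\Lambda_n,\mathrm{KL}}(\gamma|\mu,\nu)$$ admits a unique optimal solution, denoted $\gamma_n$, and the Optimal Transport problem $$\inf\left\{\iint c(x,y)\,d\gamma(x,y):\ \gamma\in\mathcal{P}(\mathbb{R}^d\times\mathbb{R}^d),\ \pi_{1\#}\gamma=\mu,\ \pi_{2\#}\gamma=\nu\right\}$$ also admits a unique solution, denoted $\gamma_{OT}$. Then $\lim_{n\to\infty}\gamma_n=\gamma_{OT}$ in $\mathcal{P}_2(\mathbb{R}^d\times\mathbb{R}^d)$, where $\mathcal{P}_2(\mathbb{R}^d\times\mathbb{R}^d)$ is equipped with the topology of weak convergence.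
   Context: $\mathcal{P}(X)$ is the set of probability measures on $X$. For a Euclidean space $X=\mathbb{R}^m$, $\mathcal{P}_2(X)$ is the set of $\gamma\in\mathcal{P}(X)$ that are absolutely continuous with respect to the Lebesgue measure on $\mathbb{R}^m$ and satisfy $\int_X|x|^2\,d\gamma<+\infty$; this is applied with $m=d$ and, for $\mathbb{R}^d\times\mathbb{R}^d$, with $m=2d$. $\pi_1,\pi_2$ are the projections of $\mathbb{R}^d\times\mathbb{R}^d$ onto the first and second factors and $\#$ denotes push-forward. For finite positive measures $\alpha,\beta$ on $\mathbb{R}^d$, $D_{\mathrm{KL}}(\alpha\|\beta)=\int F(\frac{d\alpha}{d\beta})\,d\beta$ with $F(s)=s\log s-s+1$ (and $F(0)=1$) if $\alpha\ll\beta$, and $+\infty$ otherwise. For $\Lambda>0$, $$\mathcal{E}_{\Lambda,\mathrm{KL}}(\gamma|\mu,\nu)=\iint c(x,y)\,d\gamma(x,y)+\Lambda D_{\mathrm{KL}}(\pi_{1\#}\gamma\|\mu)+\Lambda D_{\mathrm{KL}}(\pi_{2\#}\gamma\|\nu).$$ A probability measure $\mu$ on $\mathbb{R}^d$ satisfies the Logarithmic Sobolev inequality with constant $K>0$ if for every probability measure $\tilde\mu\ll\mu$, $D_{\mathrm{KL}}(\tilde\mu\|\mu)\le\frac{1}{2K}I(\tilde\mu|\mu)$, where $I(\tilde\mu|\mu)=\int|\nabla\log(\frac{d\tilde\mu}{d\mu})|^2d\tilde\mu$ is the Fisher information.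
   Formalization: Membership of γ_n and γ_OT in P_2(R^d×R^d) is stated as finite second moment only, without absolute continuity on R^{2d}: γ_OT is carried by a graph (e.g. the diagonal when μ=ν is Gaussian), so it is singular for d≥1. *)

(* Defs.v *)
From HB Require Import structures.
From mathcomp Require Import all_boot all_order all_algebra.
From mathcomp Require Import all_classical all_reals all_analysis.
From mathcomp Require Import giry.
Set Implicit Arguments.
Unset Strict Implicit.
Unset Printing Implicit Defensive.
Import Order.TTheory GRing.Theory Num.Theory.
Import numFieldNormedType.Exports.
Local Open Scope classical_set_scope.
Local Open Scope ring_scope.

(* Built on MathComp-Analysis.  The space R^n is the type 'rV[R]_n.  Its      *)
(* library topology is the usual one, but its library norm `|x| is the sup    *)
(* norm: Euclidean quantities are written with [sqnorm] below.                *)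

(* The sigma-algebra of R^n is the one generated by the coordinates, i.e. the *)
(* n-fold product of the Borel sets of R, which is the Borel sigma-algebra.   *)
Definition rV_display : measure_display.
Proof. exact: default_measure_display. Qed.

Section rV_measurable.
Variables (R : realType) (n : nat).

Let coord (i : 'I_n) (x : 'rV[R]_n) : measurableTypeR R := x ord0 i.

Let rV_set0 : g_sigma_preimage coord set0.
Proof. exact: sigma_algebra0. Qed.

Let rV_setC A : g_sigma_preimage coord A -> g_sigma_preimage coord (~` A).
Proof. exact: sigma_algebraC. Qed.

Let rV_bigcup (F : (set 'rV[R]_n)^nat) :
  (forall i, g_sigma_preimage coord (F i)) ->
  g_sigma_preimage coord (\bigcup_i (F i)).
Proof. exact: sigma_algebra_bigcup. Qed.

HB.instance Definition _ := @isMeasurable.Build rV_display 'rV[R]_n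
  (g_sigma_preimage coord) rV_set0 rV_setC rV_bigcup.

End rV_measurable.

Section measurable_rV.
Variable R : realType.

Lemma measurable_rV_coord n (i : 'I_n) :
  measurable_fun [set: 'rV[R]_n] (fun x => x ord0 i : measurableTypeR R).
Proof.
move=> _ Y mY; rewrite setTI; apply: sub_sigma_algebra => /=.
rewrite -bigcup_seq/=; exists i => /=; first by rewrite mem_index_enum.
by exists Y => //; rewrite setTI.
Qed.

Lemma measurable_fun_rV d (T : measurableType d) n (f : T -> 'rV[R]_n) :
  (forall i, measurable_fun setT (fun t => f t ord0 i : measurableTypeR R)) ->
  measurable_fun setT f.
Proof.
move=> mf _ A mA; rewrite setTI.
pose G := [set B : set 'rV[R]_n | measurable (f @^-1` B)].
suff: (@measurable _ 'rV[R]_n) `<=` G by exact.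
apply: smallest_sub.
  split=> [|B GB|F GF]; rewrite /G /=.
  - by rewrite preimage_set0; exact: measurable0.
  - by rewrite setTD -preimage_setC; exact: measurableC.
  - by rewrite preimage_bigcup; exact: bigcupT_measurable.
move=> B; rewrite -bigcup_seq => -[i _] [Y mY <-]; rewrite /G /= setTI.
by have := mf i measurableT _ mY; rewrite setTI.
Qed.

Definition rV_cons n (p : measurableTypeR R * 'rV[R]_n) : 'rV[R]_n.+1 :=
  \row_i oapp (fun j => p.2 ord0 j) (p.1 : R) (unlift ord0 i).

Lemma measurable_rV_cons n : measurable_fun setT (@rV_cons n).
Proof.
apply: measurable_fun_rV => i.
under eq_fun do rewrite mxE.
case: unliftP => [j _|_] /=; last exact: measurable_fst.
by apply: (measurableT_comp (measurable_rV_coord j)); exact: measurable_snd.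
Qed.

End measurable_rV.

Section lebesgue_rV.
Variable R : realType.

Section step.
Variables (n : nat) (m : {sigma_finite_measure set 'rV[R]_n -> \bar R}).

Definition lebesgue_rV_step : set 'rV[R]_n.+1 -> \bar R :=
  pushforward (lebesgue_measure \x m)%E (@rV_cons R n).

Let step0 : lebesgue_rV_step set0 = 0%E.
Proof. by rewrite /lebesgue_rV_step /pushforward preimage_set0 measure0. Qed.

Let step_ge0 A : (0 <= lebesgue_rV_step A)%E.
Proof. by rewrite /lebesgue_rV_step /pushforward measure_ge0. Qed.

Let step_sigma_additive : semi_sigma_additive lebesgue_rV_step.
Proof.
have mc := @measurable_rV_cons R n.
move=> F mF tF mUF; rewrite /lebesgue_rV_step /pushforward preimage_bigcup.
apply: measure_semi_sigma_additive.
- by move=> i; rewrite -[X in measurable X]setTI; exact: mc.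
- apply/trivIsetP => /= i j _ _ ij; rewrite -preimage_setI.
  by move/trivIsetP : tF => /(_ _ _ _ _ ij) ->//; rewrite preimage_set0.
- by rewrite -preimage_bigcup -[X in measurable X]setTI; exact: mc.
Qed.

HB.instance Definition _ := isMeasure.Build _ _ _ lebesgue_rV_step
  step0 step_ge0 step_sigma_additive.

Let step_sigma_finite : sigma_finite setT lebesgue_rV_step.
Proof.
have /sigma_finiteP[F [FT ndF Foo]] := sigma_finiteT (@lebesgue_measure R).
have /sigma_finiteP[G [GT ndG Goo]] := sigma_finiteT m.
have FGT : \bigcup_k (F k `*` G k) = setT.
  rewrite -setXTT FT GT predeqE => -[x y]; split.
    by move=> [i _ []/= ? ?]; split; exists i.
  move=> [/= [i _ Fix] [k _ Gky]]; exists (maxn i k) => //; split.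
    by move: x Fix; exact/subsetPset/ndF/leq_maxl.
  by move: y Gky; exact/subsetPset/ndG/leq_maxr.
pose g (x : 'rV[R]_n.+1) : measurableTypeR R * 'rV[R]_n :=
  (x ord0 ord0, \row_j x ord0 (lift ord0 j)).
have mg : measurable_fun setT g.
  apply/measurable_fun_pairP; split; first exact: measurable_rV_coord.
  apply: measurable_fun_rV => i; rewrite /comp /g /=.
  by under eq_fun do rewrite mxE; exact: measurable_rV_coord.
have consK : cancel (@rV_cons R n) g.
  move=> [t v]; rewrite /g /rV_cons /=; congr pair.
    by rewrite mxE unlift_none.
  by apply/rowP => j; rewrite !mxE liftK.
exists (fun k => g @^-1` (F k `*` G k)).
  by rewrite -preimage_bigcup FGT preimage_setT.
move=> k; have [mF Fk] := Foo k; have [mG Gk] := Goo k; split.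
  by rewrite -[X in measurable X]setTI; apply: mg => //; exact: measurableX.
rewrite /lebesgue_rV_step /pushforward -comp_preimage.
rewrite (_ : g \o _ = id); last by apply/funext => x /=; rewrite consK.
by rewrite preimage_id product_measure1E// lte_mul_pinfty// ge0_fin_numE.
Qed.

HB.instance Definition _ := Measure_isSigmaFinite.Build _ _ _ lebesgue_rV_step
  step_sigma_finite.

End step.

Fixpoint lebesgue_rV (n : nat) : {sigma_finite_measure set 'rV[R]_n -> \bar R} :=
  match n with
  | 0 => dirac (0 : 'rV[R]_0)
  | n'.+1 => lebesgue_rV_step (lebesgue_rV n')
  end.

Lemma lebesgue_rV_box n (A : 'I_n -> set (measurableTypeR R)) :
  (forall i, measurable (A i)) ->
  lebesgue_rV n [set x | forall i, A i (x ord0 i)] =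
  (\prod_(i < n) lebesgue_measure (A i))%E.
Proof.
elim: n A => [|n IH] A mA /=.
  rewrite big_ord0 diracE mem_set//=; by case.
rewrite /lebesgue_rV_step /pushforward big_ord_recl -IH//.
rewrite -product_measure1E//.
  congr (_ _); apply/seteqP; split => -[t v] /=.
    move=> h; split; first by have := h ord0; rewrite mxE unlift_none.
    by move=> j; have := h (lift ord0 j); rewrite mxE liftK.
  by move=> [h0 h] i; rewrite mxE; case: unliftP => [j ->|->].
rewrite (_ : (fun x => _) = \bigcap_(i in [set: 'I_n])
    ((fun x : 'rV[R]_n => x ord0 i : measurableTypeR R) @^-1` A (lift ord0 i))).
  apply: fin_bigcap_measurable => // i _.
  by rewrite -[X in measurable X]setTI; exact: measurable_rV_coord.
by apply/seteqP; split => x /= h i; [move=> _; exact: h | exact: h].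
Qed.

End lebesgue_rV.

HB.instance Definition _ d1 d2 (T1 : measurableType d1) (T2 : measurableType d2)
  := isMeasurableFun.Build _ _ _ _ (@fst T1 T2) measurable_fst.
HB.instance Definition _ d1 d2 (T1 : measurableType d1) (T2 : measurableType d2)
  := isMeasurableFun.Build _ _ _ _ (@snd T1 T2) measurable_snd.

Section Euclidean.
Variables (R : realType) (d : nat).
Implicit Types (x y : 'rV[R]_d) (mu : probability 'rV[R]_d R).

Definition sqnorm x : R := \sum_(i < d) x ord0 i ^+ 2.

Definition P2 mu : Prop :=
  mu `<< lebesgue_rV R d /\ (\int[mu]_x (sqnorm x)%:E < +oo)%E.

Definition grad (g : 'rV[R]_d -> R) x : 'rV[R]_d :=
  \row_(i < d) 'D_(delta_mx ord0 i) g x.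

Definition locally_lipschitz (f : 'rV[R]_d -> R) : Prop :=
  forall x, exists2 U, nbhs x U & [lipschitz f y | y in U].

End Euclidean.

Section KL_divergence.
Variable R : realType.

(* [ln 0 = 0] in the library, so that [KL_fun 0 = 1] *)
Definition KL_fun (s : R) : R := s * ln s - s + 1.

Local Open Scope charge_scope.

Definition KL d (T : measurableType d)
    (alpha beta : {finite_measure set T -> \bar R}) : \bar R :=
  if `[< alpha `<< beta >] then
    (\int[beta]_x
       (KL_fun (fine (('d (charge_of_finite_measure alpha) '/d beta) x)))%:E)%E
  else +oo%E.

End KL_divergence.

Section log_Sobolev.
Variables (R : realType) (d : nat).
Local Open Scope charge_scope.

(* The Fisher information is finite only if d nu / d mu has a locally         *)
(* Lipschitz version f; the infimum over the versions f is +oo when there is  *)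
(* none.  When mu is absolutely continuous with respect to the Lebesgue       *)
(* measure, f is differentiable nu-a.e. (Rademacher) and the integral does    *)
(* not depend on the version.                                                 *)
Definition fisher (nu mu : probability 'rV[R]_d R) : \bar R :=
  ereal_inf [set (\int[nu]_x (sqnorm (grad (fun y => ln (f y)) x))%:E)%E | f in
    [set f | locally_lipschitz f /\
      ae_eq mu setT ('d (charge_of_finite_measure nu) '/d mu) (EFin \o f)]].

Definition log_sobolev (K : R) (mu : probability 'rV[R]_d R) : Prop :=
  forall nu : probability 'rV[R]_d R, nu `<< mu ->
    (KL nu mu <= ((2 * K)^-1)%:E * fisher nu mu)%E.

End log_Sobolev.

Section transport.
Variables (R : realType) (d : nat).
Implicit Types (mu nu : probability 'rV[R]_d R)
  (gamma : probability ('rV[R]_d * 'rV[R]_d)%type R).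

Definition marginal1 gamma : probability 'rV[R]_d R := distribution gamma fst.
Definition marginal2 gamma : probability 'rV[R]_d R := distribution gamma snd.

Definition cost gamma : \bar R := (\int[gamma]_z (sqnorm (z.1 - z.2))%:E)%E.

Definition energy (Lambda : R) mu nu gamma : \bar R :=
  (cost gamma + Lambda%:E * KL (marginal1 gamma) mu
              + Lambda%:E * KL (marginal2 gamma) nu)%E.

(* A measure of the library is a function on all sets, only its values on     *)
(* measurable sets being meaningful: measures are compared with [measure_eq]. *)
Definition couplings mu nu : set (probability ('rV[R]_d * 'rV[R]_d)%type R) :=
  [set gamma | measure_eq (marginal1 gamma) mu /\ measure_eq (marginal2 gamma) nu].

Definition is_solution
    (C : set (probability ('rV[R]_d * 'rV[R]_d)%type R))
    (J : probability ('rV[R]_d * 'rV[R]_d)%type R -> \bar R) gamma : Prop :=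
  C gamma /\ forall gamma', C gamma' -> (J gamma <= J gamma')%E.

Definition is_unique_solution C J gamma : Prop :=
  is_solution C J gamma /\
  forall gamma', is_solution C J gamma' -> measure_eq gamma' gamma.

(* Optimal plans are concentrated on graphs, hence singular with respect to   *)
(* the Lebesgue measure of R^d x R^d: for plans, membership in P_2 can only   *)
(* mean that the second moment is finite.                                     *)
Definition finite_second_moment gamma : Prop :=
  (\int[gamma]_z (sqnorm z.1 + sqnorm z.2)%:E < +oo)%E.

Definition weakly_converges
    (gamma_ : nat -> probability ('rV[R]_d * 'rV[R]_d)%type R) gamma : Prop :=
  forall f : 'rV[R]_d * 'rV[R]_d -> R, continuous f -> bounded_fun f ->
    (\int[gamma_ n]_z (f z)%:E)%E @[n --> \oo] --> (\int[gamma]_z (f z)%:E)%E.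

End transport.

(* Main.v *)
(* Given two independent draws (x, y) and (x', y') of a plan gamma, replace y by
   y' whenever <x - x', y - y'> < 0.  This keeps the marginals and strictly
   lowers the cost unless gamma is monotone: <x - x', y - y'> >= 0 almost surely.
   Hence optimal plans of both problems are monotone, and so is the average of
   two optimal plans with the same marginals (for the relaxed problem, strict
   convexity of the entropy fixes the marginals).  If the first marginal is
   absolutely continuous, a monotone plan lets x decide almost surely whether
   y_i >= q: the set of undecided x meets every line parallel to the i-th axis
   in at most one point, so it is null by Fubini.  Two plans whose average is
   monotone therefore agree on all rectangles as soon as their first marginals
   do.

   Existence and convergence come from compactness: a bound on the entropies
   makes the marginals uniformly absolutely continuous, so that the limits of
   gamma_n(A x B) along an ultrafilter define a plan, and cost and entropy are
   lower semicontinuous for these limits.  The entropies of the relaxed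
   minimizers are O(1/Lambda_n), so every such limit is an optimal coupling.

   A relaxed minimizer has no mass where both marginal densities exceed a large
   M, since discarding this part would lower the energy; where the density at x
   is at most M, x has finite second moment by that of mu, and
   |y|^2 <= 2 (|x|^2 + |x - y|^2). *)
Require Import Defs.
From HB Require Import structures.
From mathcomp Require Import all_boot all_order all_algebra.
From mathcomp Require Import all_classical all_reals all_analysis.
From mathcomp Require Import giry measurable_realfun lra ring.
Set Implicit Arguments.
Unset Strict Implicit.
Unset Printing Implicit Defensive.
Import Order.TTheory GRing.Theory Num.Theory.
Import numFieldNormedType.Exports.
Local Open Scope classical_set_scope.
Local Open Scope ring_scope.

(** * Measures determined by rectangles *)

(** The limit of the relaxed minimizers is singular, so the plans admit no uniform domination, and
    limits of their values on general measurable sets of the product need not be countably additive.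
    Entropy bounds control the marginals only. This singles out rectangles: limits are taken there,
    and the limit plan is rebuilt by Carathéodory extension. For the marginals this is setwise
    convergence, which is enough for entropies, whose densities are merely measurable; for the plans
    it still reaches continuous integrands, through grids of rectangles.

    An ultrafilter provides these limits for uncountably many sets at once and replaces the
    extraction of subsequences.

    Uniqueness uses neither potentials nor supports nor cyclical monotonicity. Two independent draws
    suffice, and monotonicity becomes the nullity of a measurable set for the product of the plan
    with itself. In the average of two plans the draws may come from different plans, which is what
    compares them. *)

Section rectangle_semiring.
Context d1 d2 (T1 : measurableType d1) (T2 : measurableType d2).

(* An alias is needed because [T1 * T2] already carries the product sigma-algebra. *)
Definition rectangles_type := (T1 * T2)%type.

Definition rectangles : set (set rectangles_type) :=
  [set A `*` B | A in measurable & B in measurable].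

Definition rectangles_display : measure_display.
Proof. exact: default_measure_display. Qed.

HB.instance Definition _ := Pointed.copy rectangles_type (T1 * T2)%type.

Let rectangles0 : rectangles set0.
Proof. by exists set0 => //; exists set0 => //; rewrite setX0. Qed.

Let rectanglesI : setI_closed rectangles.
Proof.
move=> _ _ [A mA [B mB <-]] [C mC [D mD <-]].
exists (A `&` C); first exact: measurableI.
by exists (B `&` D); [exact: measurableI|rewrite setXI].
Qed.

Let rectanglesD : semi_setD_closed rectangles.
Proof.
move=> _ _ [A mA [B mB <-]] [C mC [D mD <-]].
exists [set (A `\` C) `*` B; (A `&` C) `*` (B `\` D)]; split.
- exact: finite_set2.
- move=> _ [->|->].
    by exists (A `\` C); [exact: measurableD|exists B].
  exists (A `&` C); first exact: measurableI.
  by exists (B `\` D) => //; exact: measurableD.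
- rewrite bigcup_setU1 bigcup_set1; apply/seteqP; split => -[x y] /=.
    move=> [ [Ax By] nCD]; have [Cx|Cx] := pselect (C x); last by left.
    by right; split => //; split => // Dy; apply: nCD.
  by move=> [ [[Ax nCx] By]|[ [Ax Cx] [By nDy]]]; split => // -[].
- move=> X Y [->|->] [->|->] //= [ [x y] /=].
    by move=> [ [[_ nCx] _] [ [_ Cx] _]].
  by move=> [ [[_ Cx] _] [ [_ nCx] _]].
Qed.

HB.instance Definition _ := isSemiRingOfSets.Build rectangles_display
  rectangles_type rectangles0 rectanglesI rectanglesD.

End rectangle_semiring.

Section rectangle_extension.
Context d1 d2 (T1 : measurableType d1) (T2 : measurableType d2) (R : realType).
Variable m : set (T1 * T2) -> \bar R.
Hypothesis m_ge0 : forall A, (0 <= m A)%E.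
Hypothesis m0 : m set0 = 0%E.
Hypothesis m_add : forall A B, measurable A -> measurable B -> A `&` B = set0 ->
  m (A `|` B) = (m A + m B)%E.
Hypothesis m_sub : forall A B (F : nat -> set T1) (G : nat -> set T2),
  measurable A -> measurable B ->
  (forall n, measurable (F n)) -> (forall n, measurable (G n)) ->
  A `*` B `<=` \bigcup_n (F n `*` G n) ->
  (m (A `*` B) <= \sum_(n <oo) m (F n `*` G n))%E.
Hypothesis mT : m setT = 1%E.

Let T := rectangles_type T1 T2.

Let rectangle_measurable (A : set T) :
  measurable A -> @measurable _ (T1 * T2)%type A.
Proof. by move=> [B mB [C mC <-]]; exact: measurableX. Qed.

(** A copy of [m] on the alias, to which the content and measure structures over the semiring of
    rectangles are attached. *)
Definition rectangle_content : set T -> \bar R := m.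

Let rectangle_content_semi_additive : measure_function.semi_additive rectangle_content.
Proof.
move=> F n mF tF _; elim: n => [|n IH]; first by rewrite !big_ord0.
rewrite !big_ord_recr /= -IH; apply: m_add.
- by apply: bigsetU_measurable => i _; exact: rectangle_measurable.
- exact: rectangle_measurable.
- rewrite big_distrl /= big1// => i _.
  by move/trivIsetP : tF => /(_ i n Logic.I Logic.I) -> //; rewrite ltn_eqF.
Qed.

HB.instance Definition _ := isContent.Build _ T R rectangle_content
  m_ge0 rectangle_content_semi_additive.

Let rectangle_content_sigma_sub : measurable_subset_sigma_subadditive rectangle_content.
Proof.
move=> A F mF [B mB [C mC <-]].
have /choice[G HG] : forall n, exists D : set T1 * set T2,
    [/\ measurable D.1, measurable D.2 & F n = D.1 `*` D.2].
  by move=> n; have [D mD [E mE <-]] := mF n; exists (D, E).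
rewrite (_ : F = fun n => (G n).1 `*` (G n).2); last first.
  by apply/funext => n; have [_ _] := HG n.
by move=> sub; apply: m_sub => // n; have [] := HG n.
Qed.

HB.instance Definition _ := Content_SigmaSubAdditive_isMeasure.Build
  _ R T rectangle_content rectangle_content_sigma_sub.

Definition rectangle_measure : set (T1 * T2) -> \bar R :=
  measure_extension rectangle_content.

Let sigma_rectangles (A : set (T1 * T2)) :
  measurable A -> @measurable _ (g_sigma_algebraType (@measurable _ T)) A.
Proof. by rewrite measurable_prod_measurableType. Qed.

Let rectangle_measure0 : rectangle_measure set0 = 0%E.
Proof. exact: measure0. Qed.

Let rectangle_measure_ge0 A : (0 <= rectangle_measure A)%E.
Proof. exact: measure_ge0. Qed.

Let rectangle_measure_sigma : semi_sigma_additive rectangle_measure.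
Proof.
move=> F mF tF mUF.
apply: (@measure_semi_sigma_additive _ _ _ (measure_extension rectangle_content)).
- by move=> i; exact: sigma_rectangles.
- exact: tF.
- exact: sigma_rectangles.
Qed.

HB.instance Definition _ := isMeasure.Build _ _ _ rectangle_measure
  rectangle_measure0 rectangle_measure_ge0 rectangle_measure_sigma.

Lemma rectangle_measureE A B : measurable A -> measurable B ->
  rectangle_measure (A `*` B) = m (A `*` B).
Proof.
move=> mA mB; rewrite /rectangle_measure /measure_extension.
by rewrite measurable_mu_extE//; exists A => //; exists B.
Qed.

Let rectangle_measure_setT : rectangle_measure setT = 1%E.
Proof. by rewrite -setXTT rectangle_measureE// setXTT. Qed.

HB.instance Definition _ := Measure_isProbability.Build _ _ _ rectangle_measure
  rectangle_measure_setT.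

(** Carathéodory extension: [m_sub] upgrades finite additivity to a measure on the semiring of
    rectangles. Nothing is claimed on other measurable sets, where [m] need not be countably
    additive. *)
Lemma rectangle_probability : exists P : probability (T1 * T2)%type R,
  forall A B, measurable A -> measurable B -> P (A `*` B) = m (A `*` B).
Proof. by exists rectangle_measure; exact: rectangle_measureE. Qed.

End rectangle_extension.

Section probability_real.
Context d (T : measurableType d) (R : realType).
Implicit Types P : probability T R.

(** Real values allow limits and linear arithmetic in [R]; [prE] goes back to the measure on
    measurable sets. *)
Definition pr P (A : set T) : R := fine (P A).

Lemma prE P A : measurable A -> P A = (pr P A)%:E.
Proof.
move=> mA; rewrite fineK// ge0_fin_numE ?measure_ge0//.
by rewrite (le_lt_trans (probability_le1 P mA))// ltry.
Qed.

Lemma pr_ge0 P A : 0 <= pr P A.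
Proof. by rewrite fine_ge0// measure_ge0. Qed.

Lemma pr_le1 P A : measurable A -> pr P A <= 1.
Proof. by move=> mA; rewrite -lee_fin -prE// probability_le1. Qed.

Lemma pr0 P : pr P set0 = 0.
Proof. by rewrite /pr measure0. Qed.

Lemma prT P : pr P setT = 1.
Proof. by rewrite /pr probability_setT. Qed.

Lemma prU P A B : measurable A -> measurable B -> A `&` B = set0 ->
  pr P (A `|` B) = pr P A + pr P B.
Proof.
move=> mA mB AB; apply: EFin_inj; rewrite EFinD -!prE//; last exact: measurableU.
by rewrite measureU.
Qed.

Lemma le_pr P A B : measurable A -> measurable B -> A `<=` B -> pr P A <= pr P B.
Proof. by move=> mA mB AB; rewrite -lee_fin -!prE// le_measure ?inE. Qed.

Lemma prID P A B : measurable A -> measurable B ->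
  pr P A = pr P (A `&` B) + pr P (A `\` B).
Proof.
move=> mA mB; rewrite -prU; [|exact: measurableI|exact: measurableD|].
  by rewrite setUIDK.
by rewrite setDE setIACA setICr setI0.
Qed.

Lemma prC P A : measurable A -> pr P (~` A) = 1 - pr P A.
Proof.
move=> mA; rewrite -(prT P) (prID P measurableT mA) setTI setTD; lra.
Qed.

Lemma prU_le P A B : measurable A -> measurable B ->
  pr P (A `|` B) <= pr P A + pr P B.
Proof.
move=> mA mB; rewrite (prID P (measurableU _ _ mA mB) mA) lerD//.
  by apply: le_pr; [apply: measurableI => //; exact: measurableU|by []|exact: subIsetr].
by apply: le_pr; [apply: measurableD => //; exact: measurableU|by []|move=> x [ []]].
Qed.

Lemma pr_bigcap_cvg0 P (F : nat -> set T) :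
  (forall k, measurable (F k)) -> nonincreasing_seq F -> \bigcap_k F k = set0 ->
  pr P (F k) @[k --> \oo] --> 0.
Proof.
move=> mF niF F0.
have := @nonincreasing_cvg_mu _ _ _ P F _ mF _ niF.
rewrite F0 measure0 => cv.
rewrite (_ : 0 = fine 0%E) //; apply: fine_cvg.
by apply: cv => //; rewrite (le_lt_trans (probability_le1 P (mF 0%N)))// ltry.
Qed.

Lemma pr_bigcap_small P (F : nat -> set T) (e : R) : 0 < e ->
  (forall k, measurable (F k)) -> nonincreasing_seq F -> \bigcap_k F k = set0 ->
  exists k, pr P (F k) < e.
Proof.
move=> e0 mF niF F0; have cv := pr_bigcap_cvg0 P mF niF F0.
exact: filter_ex (cvgr_lt _ cv _ e0).
Qed.

End probability_real.

(** Closed rays generate the Borel sets of the line, hence half-spaces generate the sigma-algebra.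
    This induction serves twice: for regularity and for [monotone_split]. *)
Lemma measurable_rV_ind (R : realType) (n : nat) (G : set (set 'rV[R]_n)) :
  G set0 -> (forall A, G A -> G (~` A)) ->
  (forall F : nat -> set 'rV[R]_n, (forall k, G (F k)) -> G (\bigcup_k F k)) ->
  (forall i y, G [set x | y <= x ord0 i]) ->
  forall A, measurable A -> G A.
Proof.
move=> G0 GC GU Gi; apply: smallest_sub => /=.
  by split => // A GA; rewrite setTD; exact: GC.
move=> A; rewrite -bigcup_seq => -[i _] [Y mY <-]; rewrite setTI.
pose coord := fun x : 'rV[R]_n => x ord0 i : measurableTypeR R.
pose H := [set Y : set (measurableTypeR R) | G (coord @^-1` Y)].
suff : @measurable _ (measurableTypeR R) `<=` H by apply.
have -> : @measurable _ (measurableTypeR R) = (@RGenCInfty.G R).-sigma.-measurable.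
  exact: RGenCInfty.measurableE.
apply: smallest_sub; first split.
- by rewrite /H /= preimage_set0.
- by move=> B GB; rewrite /H /= setTD preimage_setC; exact: GC.
- by move=> F GF; rewrite /H /= preimage_bigcup; exact: GU.
move=> _ [y ->]; rewrite /H /=.
rewrite (_ : _ @^-1` _ = [set x : 'rV[R]_n | y <= x ord0 i]); first exact: Gi.
by apply/seteqP; split => x /=; rewrite in_itv/= andbT.
Qed.

(** * Approximation of measurable sets of R^n by compact and open sets *)

Section regularity.
Context (R : realType) (n : nat).
Variable P : probability 'rV[R]_n R.

(** Measurability of [C] and [O] is part of the requirement because the sigma-algebra is given by
    the coordinates and not by the open sets. *)
Definition regular_set (A : set 'rV[R]_n) := forall e : R, 0 < e ->
  exists C O : set 'rV[R]_n, [/\ closed C /\ measurable C, open O /\ measurable O,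
    C `<=` A, A `<=` O & pr P (O `\` C) <= e].

Lemma regular_setC A : regular_set A -> regular_set (~` A).
Proof.
move=> rA e e0; have [C [ O [ [cC mC] [oO mO] CA AO OC]]] := rA e e0.
exists (~` O), (~` C); split.
- by split; [exact: open_closedC|exact: measurableC].
- by split; [exact: closed_openC|exact: measurableC].
- exact: subsetC.
- exact: subsetC.
- by rewrite setDE setCK setIC -setDE.
Qed.

(** Continuity from above along the sets [O k] minus [C], which decrease to the empty set. Used for
    half-spaces, with slightly larger open half-spaces as [O k]. *)
Lemma regular_set_closed (C : set 'rV[R]_n) (O : nat -> set 'rV[R]_n) :
  closed C -> measurable C -> (forall k, open (O k)) ->
  (forall k, measurable (O k)) -> nonincreasing_seq O ->
  (forall k, C `<=` O k) ->
  \bigcap_k O k `<=` C -> regular_set C.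
Proof.
move=> cC mC oO mO niO CO OC e e0.
have [|||k Pk] := @pr_bigcap_small _ _ _ P (fun k => O k `\` C) _ e0.
- by move=> k; exact: measurableD.
- move=> i j ij; apply/subsetPset => x [Ox Cx]; split => //.
  by move: x Ox {Cx}; exact/subsetPset/niO.
- rewrite -subset0 => x Ox; have [_ ]:= Ox 0%N Logic.I; apply; apply: OC => k _.
  by have [] := Ox k Logic.I.
- by exists C, (O k); split => //; exact: ltW.
Qed.

Lemma regular_set_bigcup (F : nat -> set 'rV[R]_n) :
  (forall k, regular_set (F k)) -> regular_set (\bigcup_k F k).
Proof.
move=> rF e e0; have e20 : 0 < e / 2 by rewrite divr_gt0.
have ek0 k : 0 < (e / 2) / (2 ^ k.+1)%:R by rewrite divr_gt0// ltr0n expn_gt0.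
have /choice[C /choice[ O CO]] := fun k => rF k _ (ek0 k).
have mO : measurable (\bigcup_k O k).
  by apply: bigcupT_measurable => k; have [_ []] := CO k.
have mC : measurable (\bigcup_k C k).
  by apply: bigcupT_measurable => k; have [ []] := CO k.
(* The union of all [C k] need not be closed; a finite part of it is closed and loses at most e / 2.
   The other e / 2 is spread over the sets [O k] minus [C k]. *)
pose D k := \big[setU/set0]_(i < k) C i.
have mD k : measurable (D k).
  by apply: bigsetU_measurable => i _; have [ []] := CO i.
have DC k : D k `<=` \bigcup_k C k.
  by rewrite /D -bigcup_mkord; move=> x [i _ Cx]; exists i.
have [|||k Pk] := @pr_bigcap_small _ _ _ P (fun k => (\bigcup_k C k) `\` D k) _ e20.
- by move=> k; exact: measurableD.
- move=> i j ij; apply/subsetPset => x [Cx nD]; split => // Dx; apply: nD.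
  by move: x Dx {Cx}; exact: subset_bigsetU.
- rewrite -subset0 => x Dx; have [ [i _ Cix] _] := Dx 0%N Logic.I.
  have [_ ] := Dx i.+1 Logic.I; apply; rewrite /D -bigcup_mkord.
  by exists i => //=.
exists (D k), (\bigcup_k O k); split.
- by split => //; apply: closed_bigsetU => i _; have [ []] := CO i.
- by split => //; apply: bigcup_open => i _; have [_ []] := CO i.
- by move=> x /DC[i _ Cx]; exists i => //; have [_ _ CF _ _] := CO i; exact: CF.
- by move=> x [i _ Fx]; exists i => //; have [_ _ _ FO _] := CO i; exact: FO.
apply: (@le_trans _ _ (pr P (\bigcup_k (O k `\` C k)) + pr P (\bigcup_k C k `\` D k))).
  have m1 : measurable (\bigcup_k (O k `\` C k)).
    by apply: bigcupT_measurable => i; have [ [_ ?] [_ ?] _ _ _] := CO i; exact: measurableD.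
  apply: le_trans (prU_le P _ _); [|exact: m1|exact: measurableD].
  apply: le_pr; [exact: measurableD|by apply: measurableU=> //; exact: measurableD|].
  move=> x [ [i _ Ox] nD]; have [Cx|nCx] := pselect ((\bigcup_k C k) x).
    by right.
  by left; exists i => //; split => // Cix; apply: nCx; exists i.
rewrite [e in _ <= e]splitr lerD//; last exact: ltW.
have m1 i : measurable (O i `\` C i).
  by have [ [_ ?] [_ ?] _ _ _] := CO i; exact: measurableD.
rewrite -lee_fin -prE; last exact: bigcupT_measurable.
apply: (@le_trans _ _ (\sum_(i <oo) P (O i `\` C i))%E).
  by apply: measure_sigma_subadditive => //; exact: bigcupT_measurable.
apply: le_trans (epsilon_trick0 xpredT (ltW e20)).
apply: lee_nneseries => i _; first by [].
by rewrite prE// lee_fin; have [] := CO i.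
Qed.

Lemma regular_set0 : regular_set set0.
Proof.
move=> e e0; exists set0, set0; split => //; rewrite ?setD0 ?pr0 ?ltW//.
- by split; [exact: closed0|].
- by split; [exact: open0|].
Qed.

Lemma measurable_regular_set A : measurable A -> regular_set A.
Proof.
apply: (measurable_rV_ind (G := regular_set)); [exact: regular_set0|exact: regular_setC|
  exact: regular_set_bigcup|].
move=> i y.
pose coord := fun x : 'rV[R]_n => x ord0 i : measurableTypeR R.
have mcoord : measurable_fun setT coord by exact: measurable_rV_coord.
have ccoord : continuous (fun x : 'rV[R]_n => x ord0 i) by exact: coord_continuous.
rewrite [X in regular_set X](_ : _ = coord @^-1` `[y, +oo[); last first.
  by apply/seteqP; split => x /=; rewrite in_itv/= andbT.
apply: (@regular_set_closed _ (fun k => coord @^-1` `]y - k.+1%:R^-1, +oo[)).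
- apply: (@closed_comp _ R (fun x : 'rV[R]_n => x ord0 i)).
    by move=> x _; exact: ccoord.
  exact: rray_closed.
- by rewrite -[X in measurable X]setTI; exact: mcoord.
- move=> k; apply: (@open_comp _ R (fun x : 'rV[R]_n => x ord0 i)).
    by move=> x _; exact: ccoord.
  exact: rray_open.
- by move=> k; rewrite -[X in measurable X]setTI; exact: mcoord.
- move=> j k jk; apply/subsetPset => x; rewrite /= !in_itv/= !andbT.
  by apply: le_lt_trans; rewrite lerD2l lerN2 lef_pV2 ?posrE// ler_nat.
- move=> k x /=; rewrite !in_itv/= !andbT; apply: lt_le_trans.
  by rewrite ltrBlDr ltrDl invr_gt0.
- move=> x /= H; rewrite in_itv/= andbT leNgt; apply/negP => xy.
  have [k] := ltr_add_invr xy.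
  move=> xk; have := H k Logic.I; rewrite /= in_itv/= andbT ltNge => /negP; apply.
  by rewrite lerBrDr ltW.
Qed.

Lemma rV_box_compact (M : R) :
  compact [set v : 'rV[R]_n | forall i, v ord0 i \in `[- M, M]].
Proof.
apply: (@rV_compact _  _ (fun=> `[- M, M]%classic)).
by move=> _; exact: segment_compact.
Qed.

Lemma measurable_rV_box (M : R) :
  measurable [set v : 'rV[R]_n | forall i, v ord0 i \in `[- M, M]].
Proof.
rewrite (_ : [set v | _] = \bigcap_(i in [set: 'I_n])
    ((fun x : 'rV[R]_n => x ord0 i : measurableTypeR R) @^-1` `[-M, M])).
  apply: fin_bigcap_measurable => // i _.
  by rewrite -[X in measurable X]setTI; exact: measurable_rV_coord.
by apply/seteqP; split => x /= h i; [move=> _; exact: h | exact: h].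
Qed.

Lemma rV_box_bigcup (v : 'rV[R]_n) : exists k, forall i, v ord0 i \in `[- k%:R, k%:R].
Proof.
pose M := \sum_(i < n) `|v ord0 i|.
exists (Num.truncn M).+1 => i; rewrite in_itv/= -ler_norml.
apply: (@le_trans _ _ M); last first.
  by rewrite ltW// truncnS_gt.
by rewrite /M (bigD1 i)//= lerDl sumr_ge0.
Qed.

Lemma regular_outer (A : set 'rV[R]_n) (e : R) : measurable A -> 0 < e ->
  exists O : set 'rV[R]_n, [/\ open O, measurable O, A `<=` O & pr P (O `\` A) <= e].
Proof.
move=> mA e0; have [C [ O [ [cC mC] [oO mO] CA AO POC]]] := measurable_regular_set mA e0.
exists O; split => //; apply: le_trans POC; apply: le_pr; [exact: measurableD..|].
by move=> x [Ox nA]; split => // /CA.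
Qed.

(** The closed set given by regularity is made compact by cutting it with a box whose complement has
    probability below e / 2. *)
Lemma regular_inner (A : set 'rV[R]_n) (e : R) : measurable A -> 0 < e ->
  exists K : set 'rV[R]_n, [/\ compact K, measurable K, K `<=` A & pr P (A `\` K) <= e].
Proof.
move=> mA e0; have e20 : 0 < e / 2 by rewrite divr_gt0.
have [C [ O [ [cC mC] [oO mO] CA AO POC]]] := measurable_regular_set mA e20.
pose B k : set 'rV[R]_n := [set v | forall i, v ord0 i \in `[- k%:R, k%:R]].
have mB k : measurable (B k) by exact: measurable_rV_box.
have [|||k Pk] := @pr_bigcap_small _ _ _ P (fun k => ~` B k) _ e20.
- by move=> k; exact: measurableC.
- move=> i j ij; apply/subsetPset; apply: subsetC => x Bx l; have := Bx l.
  rewrite !in_itv/= => /andP[x1 x2]; rewrite (le_trans _ x1) ?(le_trans x2) ?ler_nat//.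
  by rewrite lerN2 ler_nat.
- rewrite -subset0 => x Bx; have [k Bk] := rV_box_bigcup x.
  exact: (Bx k Logic.I).
exists (C `&` B k); split.
- apply: (@subclosed_compact _ _ (B k)); [|exact: rV_box_compact|exact: subIsetr].
  apply: closedI => //; apply: compact_closed; first exact: norm_hausdorff.
  exact: rV_box_compact.
- exact: measurableI.
- by move=> x [/CA].
rewrite (splitr e); apply: (@le_trans _ _ (pr P (O `\` C `|` ~` B k))).
  apply: le_pr; [by apply: measurableD => //; exact: measurableI|
    by apply: measurableU; [exact: measurableD|exact: measurableC]|].
  move=> x [Ax nCB]; have [Cx|nCx] := pselect (C x).
    by right => Bx; exact: nCB.
  by left; split => //; exact: AO.
apply: le_trans (prU_le _ _ _) _; [exact: measurableD|exact: measurableC|].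
by rewrite lerD// ltW.
Qed.

End regularity.

(* Provides the join of the pointed and topological structures of a product. *)
HB.saturate prod.

(** * Limits of plans along ultrafilters *)

Lemma cvg_bigsum (R : realType) (T I : Type) (F : set_system T) {FF : Filter F}
    (r : seq I) (f : I -> T -> R) (l : I -> R) :
  (forall i, f i x @[x --> F] --> l i) ->
  \sum_(i <- r) f i x @[x --> F] --> \sum_(i <- r) l i.
Proof.
move=> fl; elim: r => [|i r IH].
  by rewrite big_nil; under eq_fun do rewrite big_nil; exact: cvg_cst.
by rewrite big_cons; under eq_fun do rewrite big_cons; exact: cvgD.
Qed.

Section ultrafilter_limits.
Context (R : realType) (U : set_system nat) {UU : UltraFilter U}.

Lemma ultra_fmap (T : Type) (f : nat -> T) : UltraFilter (f @ U).
Proof.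
split=> [|G GF UG]; first exact: fmap_proper_filter.
apply/seteqP; split => // A GA.
have [//|UnA] := in_ultra_setVsetC (f @^-1` A) UU.
have : G (A `&` ~` A) by apply: filterI => //; exact: UG.
by rewrite setICr => /filter_ex[].
Qed.

(** This is why ultrafilters are used: the probabilities of every measurable set converge along the
    same [U], which no single subsequence would give directly. *)
Lemma ultra_bounded_cvg (u : nat -> R) a b : (\forall n \near U, a <= u n <= b) ->
  exists l : R, u n @[n --> U] --> l.
Proof.
move=> uab; have := @segment_compact R a b; rewrite compact_ultra.
move=> /(_ (u @ U) (ultra_fmap u)) []; last by move=> l [_ ul]; exists l.
by apply: filterS uab => n; rewrite /= in_itv/=.
Qed.

End ultrafilter_limits.

Section limit_plan.
Context (R : realType) (n : nat).
Local Notation X := 'rV[R]_n.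
Context (U : set_system nat) {UU : UltraFilter U}.
Variables (mu nu : probability X R) (g : nat -> probability (X * X)%type R).

Definition uniformly_dominated (a : nat -> set X -> R) (P : probability X R) :=
  forall e : R, 0 < e -> exists2 delta : R, 0 < delta &
    forall A, measurable A -> pr P A <= delta -> forall k, a k A <= e.

Hypothesis dom1 : uniformly_dominated (fun k A => pr (g k) (A `*` setT)) mu.
Hypothesis dom2 : uniformly_dominated (fun k A => pr (g k) (setT `*` A)) nu.

Let m (A : set (X * X)) : R := lim (pr (g k) A @[k --> U]).

Let m_cvg A : measurable A -> pr (g k) A @[k --> U] --> m A.
Proof.
move=> mA; have [|l ul] := @ultra_bounded_cvg R U UU (fun k => pr (g k) A) 0 1.
  by apply: nearW => k; rewrite pr_ge0 pr_le1.
by rewrite /m; apply/cvg_ex; exists l.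
Qed.

Let mE A l : pr (g k) A @[k --> U] --> l -> m A = l.
Proof. by move=> H; apply/cvg_lim. Qed.

Let m_ge0 A : measurable A -> 0 <= m A.
Proof.
move=> mA; apply: (cvgr_to_ge (m_cvg mA)).
by apply: nearW => k; exact: pr_ge0.
Qed.

Lemma pr_bigsetU_le d (T : measurableType d) (P : probability T R)
    (F : nat -> set T) N : (forall i, measurable (F i)) ->
  pr P (\big[setU/set0]_(i < N) F i) <= \sum_(i < N) pr P (F i).
Proof.
move=> mF; elim: N => [|N IH]; first by rewrite !big_ord0 pr0.
rewrite !big_ord_recr/=; apply: le_trans (prU_le _ _ _) _ => //.
  exact: bigsetU_measurable.
by rewrite lerD2r.
Qed.

Let m_sub (A B : set X) (F G : nat -> set X) :
  measurable A -> measurable B ->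
  (forall k, measurable (F k)) -> (forall k, measurable (G k)) ->
  A `*` B `<=` \bigcup_k (F k `*` G k) ->
  ((m (A `*` B))%:E <= \sum_(k <oo) (m (F k `*` G k))%:E)%E.
Proof.
move=> mA mB mF mG AB.
have mFG k : measurable (F k `*` G k) by exact: measurableX.
(* Uniform domination lets the sides be approximated by compact sets from inside
   and open sets from outside with errors independent of the plan, so that
   finitely many rectangles suffice to cover. *)
apply/lee_addgt0Pr => e e0.
(* Four errors of e / 4: one for each side of A x B, and one for each side of the covering
   rectangles, the latter shared among the indices k with weights 2^-(k+1). *)
have e4 : 0 < e / 4 by rewrite divr_gt0.
have e4k k : 0 < (e / 4) / (2 ^ k.+1)%:R by rewrite divr_gt0// ltr0n expn_gt0.
have [d1 d10 D1] := dom1 e4; have [d2 d20 D2] := dom2 e4.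
have [K [cK mK KA PK]] := regular_inner mu mA d10.
have [L [cL mL LB PL]] := regular_inner nu mB d20.
have /choice[V HV] : forall k, exists V : set X, [/\ open V, measurable V, F k `<=` V &
    forall j, pr (g j) ((V `\` F k) `*` setT) <= (e / 4) / (2 ^ k.+1)%:R].
  move=> k; have [d d0 D] := dom1 (e4k k).
  have [V [oV mV FV PV]] := regular_outer mu (mF k) d0.
  by exists V; split => //; apply: D => //; exact: measurableD.
have /choice[W HW] : forall k, exists W : set X, [/\ open W, measurable W, G k `<=` W &
    forall j, pr (g j) (setT `*` (W `\` G k)) <= (e / 4) / (2 ^ k.+1)%:R].
  move=> k; have [d d0 D] := dom2 (e4k k).
  have [W [oW mW GW PW]] := regular_outer nu (mG k) d0.
  by exists W; split => //; apply: D => //; exact: measurableD.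
have mVW k : measurable (V k `*` W k).
  by apply: measurableX; [have [] := HV k|have [] := HW k].
have [N KLN] : exists N, K `*` L `<=` \big[setU/set0]_(i < N) (V i `*` W i).
  have := compact_setX cK cL; rewrite (@compact_cover (prod X X : ptopologicalType)).
  move=> /(_ nat setT (fun k => V k `*` W k)) [].
  - move=> k _; rewrite openE => z [Vz Wz]; exists (V k, W k) => //.
    by split; apply: open_nbhs_nbhs; split=> //; [have [] := HV k|have [] := HW k].
  - move=> z [/KA Az /LB Bz]; have [k _ [Fz Gz]] := AB z (conj Az Bz).
    by exists k => //; split; [have [_ _ + _] := HV k|have [_ _ + _] := HW k]; exact.
  - move=> D _ KLD; exists (\max_(i <- finmap.enum_fset D) i).+1 => z /KLD[i iD ziVW].
    rewrite -(bigcup_mkord _ (fun i => V i `*` W i)); exists i => //=; rewrite ltnS.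
    exact: (@leq_bigmax_seq _ (finmap.enum_fset D) xpredT id).
have key : m (A `*` B) <= \sum_(i < N) (m (F i `*` G i) + (e / 2) / (2 ^ i.+1)%:R) + e / 2.
  have mAB : measurable (A `*` B) by exact: measurableX.
  have cvR : \sum_(i < N) (pr (g k) (F i `*` G i) + (e / 2) / (2 ^ i.+1)%:R) + e / 2
      @[k --> U] --> \sum_(i < N) (m (F i `*` G i) + (e / 2) / (2 ^ i.+1)%:R) + e / 2.
    apply: cvgD; last exact: cvg_cst.
    apply: cvg_bigsum => i.
    apply: cvgD; last exact: cvg_cst.
    exact: m_cvg.
  apply: (ler_cvg_to (m_cvg mAB) cvR); apply: nearW => k.
  apply: (@le_trans _ _ (pr (g k) ((\big[setU/set0]_(i < N) (V i `*` W i)) `|`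
     (((A `\` K) `*` setT) `|` (setT `*` (B `\` L)))))).
    apply: le_pr => //.
      apply: measurableU; first exact: bigsetU_measurable.
      by apply: measurableU; apply: measurableX => //; exact: measurableD.
    move=> z [Az Bz]; have [Kz|nKz] := pselect (K z.1); last by right; left.
    have [Lz|nLz] := pselect (L z.2); last by right; right.
    by left; exact: KLN.
  apply: le_trans (prU_le _ _ _) _; first exact: bigsetU_measurable.
    by apply: measurableU; apply: measurableX => //; exact: measurableD.
  apply: lerD.
    apply: (@le_trans _ _ (\sum_(i < N) pr (g k) (V i `*` W i))).
      exact: (pr_bigsetU_le (g k) (F := fun i => V i `*` W i)).
    apply: ler_sum => i _.
    have [oV mV FV PV] := HV i; have [oW mW GW PW] := HW i.
    have mD1 : measurable ((V i `\` F i) `*` [set: X]).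
      by apply: measurableX => //; exact: measurableD.
    have mD2 : measurable ([set: X] `*` (W i `\` G i)).
      by apply: measurableX => //; exact: measurableD.
    apply: (@le_trans _ _ (pr (g k) ((F i `*` G i) `|` (((V i `\` F i) `*` setT) `|`
        (setT `*` (W i `\` G i)))))).
      apply: le_pr => //; first by apply: measurableU => //; exact: measurableU.
      move=> z [Vz Wz]; have [Fz|nFz] := pselect (F i z.1); last by right; left.
      have [Gz|nGz] := pselect (G i z.2); last by right; right.
      by left.
    apply: le_trans (prU_le _ _ _) _ => //; first exact: measurableU.
    rewrite lerD2l; apply: le_trans (prU_le _ _ _) _ => //.
    have := PV k; have := PW k; set t := _ / _; set s := e / 2 / _.
    have -> : s = t + t by rewrite /s /t -mulrDl; congr (_ / _); lra.
    by move=> *; exact: lerD.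
  have mD1 : measurable ((A `\` K) `*` [set: X]).
    by apply: measurableX => //; exact: measurableD.
  have mD2 : measurable ([set: X] `*` (B `\` L)).
    by apply: measurableX => //; exact: measurableD.
  apply: le_trans (prU_le _ _ _) _ => //.
  have := D1 _ (measurableD mA mK) PK k; have := D2 _ (measurableD mB mL) PL k.
  lra.
rewrite big_split /= in key.
have s1 : \sum_(i < N) (e / 2) / (2 ^ i.+1)%:R <= e / 2.
  rewrite -lee_fin -sumEFin; apply: le_trans (epsilon_trick0 xpredT _); last first.
    by rewrite divr_ge0// ltW.
  rewrite -(big_mkord xpredT (fun i => ((e / 2) / (2 ^ i.+1)%:R)%:E)).
  by apply: nneseries_lim_ge => i _ _; rewrite lee_fin divr_ge0 ?ler0n// divr_ge0// ltW.
have s2 : ((\sum_(i < N) m (F i `*` G i))%:E <= \sum_(k <oo) (m (F k `*` G k))%:E)%E.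
  rewrite -sumEFin -(big_mkord xpredT (fun i => (m (F i `*` G i))%:E)).
  by apply: nneseries_lim_ge => i _ _; rewrite lee_fin m_ge0.
apply: (@le_trans _ _ ((\sum_(i < N) m (F i `*` G i))%:E + e%:E)%E).
  by rewrite -EFinD lee_fin; lra.
by rewrite leeD2r.
Qed.

Lemma limit_plan : exists gamma : probability (X * X)%type R,
  forall A B, measurable A -> measurable B ->
    pr (g k) (A `*` B) @[k --> U] --> pr gamma (A `*` B).
Proof.
(* Nonnegativity is required on every set, whereas [m] is known to be a limit of probabilities on
   measurable sets only; hence the absolute value. *)
have [|||||P HP] := @rectangle_probability _ _ X X R (fun A => `|m A|%:E).
- by move=> A; rewrite lee_fin.
- by rewrite (@mE _ 0) ?normr0//; under eq_fun do rewrite pr0; exact: cvg_cst.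
- move=> A B mA mB AB; rewrite -EFinD; congr EFin.
  rewrite !ger0_norm ?m_ge0//; last exact: measurableU.
  apply: mE; under eq_fun do rewrite prU//.
  by apply: cvgD; exact: m_cvg.
- move=> A B F G mA mB mF mG AB; rewrite ger0_norm ?m_ge0//; last exact: measurableX.
  under eq_eseriesr => k _ do (rewrite ger0_norm; last by apply: m_ge0; exact: measurableX).
  exact: m_sub.
- by rewrite (@mE _ 1) ?normr1//; under eq_fun do rewrite prT; exact: cvg_cst.
exists P => A B mA mB; rewrite /pr HP//= ger0_norm ?m_ge0//; last exact: measurableX.
by apply: m_cvg; exact: measurableX.
Qed.

End limit_plan.

Section integral_tools.
Context d (T : measurableType d) (R : realType).
Implicit Types (m : {measure set T -> \bar R}).

Lemma fatou_le m (g : nat -> T -> R) (f : T -> R) (L : \bar R) :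
  (forall n, measurable_fun setT (g n)) -> (forall n x, 0 <= g n x) ->
  (forall x, g n x @[n --> \oo] --> f x) ->
  (forall n, (\int[m]_x (g n x)%:E <= L)%E) -> (\int[m]_x (f x)%:E <= L)%E.
Proof.
move=> mg g0 gf gL.
have -> : (\int[m]_x (f x)%:E = \int[m]_x limn_einf (fun n => (g n x)%:E))%E.
  apply: eq_integral => x _.
  have cv : (g n x)%:E @[n --> \oo] --> (f x)%:E by apply: cvg_EFin; [exact: nearW|exact: gf].
  by have [-> _] := cvg_limn_einf_sup cv.
apply: le_trans (fatou m measurableT _ _) _.
- by move=> n; exact/measurable_EFinP.
- by move=> n x _; rewrite lee_fin.
rewrite limn_einf_lim; apply: lime_le; first exact: is_cvg_einfs.
apply: nearW => n; apply: le_trans (gL n); apply: ereal_inf_lbound.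
by exists n => //=.
Qed.

(** Functions factoring through a finite type act as simple functions: their integrals are finite
    combinations of probabilities, so they pass to limits along [U]. *)
Lemma integral_finite_range m (I : finType) (q : T -> I) (h : I -> R) :
  (forall i, measurable (q @^-1` [set i])) -> (forall i, 0 <= h i) ->
  (\int[m]_x (h (q x))%:E = \sum_(i in I) (h i)%:E * m (q @^-1` [set i]))%E.
Proof.
move=> mq h0.
under eq_integral => x _.
  rewrite (_ : h (q x) = \sum_(i in I) h i * \1_(q @^-1` [set i]) x); last first.
    rewrite (bigD1 (q x))//= indicE mem_set// mulr1 big1 ?addr0// => i iq.
    by rewrite indicE memNset ?mulr0//= => /eqP; rewrite eq_sym (negbTE iq).
  rewrite -sumEFin; over.
rewrite ge0_integral_sum//=.
- apply: eq_bigr => i _; under eq_integral do rewrite EFinM.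
  rewrite ge0_integralZl_EFin//.
    by rewrite integral_indic// setIT.
  by apply/measurable_EFinP; exact: measurable_indic.
- by move=> i; apply/measurable_EFinP; apply: measurable_funM => //.
- by move=> i x _; rewrite lee_fin mulr_ge0// indicE.
Qed.

Lemma measurable_finite_range (I : finType) (q : T -> I) (h : I -> R) :
  (forall i, measurable (q @^-1` [set i])) -> measurable_fun setT (h \o q).
Proof.
move=> mq _ Y mY; rewrite setTI.
rewrite (_ : _ @^-1` Y = \bigcup_(i in [set i | Y (h i)]) (q @^-1` [set i])).
  by apply: fin_bigcup_measurable => // i _; exact: mq.
by apply/seteqP; split => [x Yx|x [i Yi /= ->]]; [exists (q x)|].
Qed.

End integral_tools.

(** * Step functions on grids and lower semicontinuity of integrals *)

Section cells.
Context (R : realType) (n : nat).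
Local Notation X := 'rV[R]_n.

(* Cells of side 1/(k+1) of the box [-k, k]^n, onto which points outside are
   clamped: the number of cells is finite. *)
Definition cell_size (k : nat) := (k.*2 * k.+1)%N.+1.

(** The position of the clamped [s] in units of the cell side. The top value 2k(k+1) is attained,
    hence the extra cell in [cell_size]. *)
Definition cell_height (k : nat) (s : R) : R :=
  Num.max 0 (Num.min (s + k%:R) k.*2%:R) * k.+1%:R.

Definition cell (k : nat) (x : X) : {ffun 'I_n -> 'I_(cell_size k)} :=
  [ffun i => inord (Num.truncn (cell_height k (x ord0 i)))].

Lemma cell_height_ge0 k s : 0 <= cell_height k s.
Proof. by rewrite mulr_ge0// le_max lexx. Qed.

Lemma cell_height_trunc k s : (Num.truncn (cell_height k s) < cell_size k)%N.
Proof.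
rewrite /cell_size ltnS -(@Num.Theory.natrK R (k.*2 * k.+1)%N); apply: le_truncn.
rewrite natrM ler_wpM2r// ge_max ler0n/=.
by rewrite ge_min lexx orbT.
Qed.

Lemma measurable_cell k t : measurable (cell k @^-1` [set t]).
Proof.
rewrite (_ : _ @^-1` _ = \bigcap_(i in [set: 'I_n])
    ((fun x : X => cell_height k (x ord0 i)) @^-1` `[(t i)%:R, (t i).+1%:R[)).
  apply: fin_bigcap_measurable => // i _; rewrite -[X in measurable X]setTI.
  have mh : measurable_fun setT (fun x : X => cell_height k (x ord0 i)).
    apply: measurable_funM => //; apply: measurable_maxr => //.
    apply: measurable_minr => //; apply: measurable_funD => //.
    exact: measurable_rV_coord.
  by apply: mh.
apply/seteqP; split => x /=.
  move=> <- i _ /=; rewrite in_itv/= ffunE inordK ?cell_height_trunc//.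
  by rewrite truncn_itv// cell_height_ge0.
move=> H; apply/ffunP => i; apply: val_inj; rewrite ffunE /= inordK ?cell_height_trunc//.
by apply: truncn_def; have := H i Logic.I; rewrite /= in_itv.
Qed.

(** The margin 1 is at least the side of a cell, so a point [s'] in the same cell as [s] cannot be a
    clamped one. *)
Lemma cell_height_close k (s s' : R) : `|s| + 1 < k%:R ->
  Num.truncn (cell_height k s') = Num.truncn (cell_height k s) ->
  `|s - s'| < k.+1%:R^-1.
Proof.
move=> sk tt'.
have := truncn_itv (cell_height_ge0 k s); have := truncn_itv (cell_height_ge0 k s').
rewrite tt' -natr1; set t : R := _%:R => /andP[a1 a2] /andP[b1 b2].
have k1 : 0 < k.+1%:R :> R by [].
have ki : 0 < k.+1%:R^-1 :> R by rewrite invr_gt0.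
have ki1 : k.+1%:R^-1 <= 1 :> R by rewrite invf_le1// ler1n.
have hs : cell_height k s = (s + k%:R) * k.+1%:R.
  have /andP[s1 s2] : - (k%:R - 1) < s < k%:R - 1 by rewrite -ltr_norml; lra.
  rewrite /cell_height; congr (_ * _).
  by rewrite min_l ?max_r//; [lra|rewrite -addnn natrD; lra].
have : `|cell_height k s - cell_height k s'| < 1 by rewrite ltr_norml; apply/andP; split; lra.
rewrite hs /cell_height -mulrBl normrM (gtr0_norm k1).
rewrite -(@ltr_pM2r _ (k.+1%:R^-1)) ?invr_gt0// mulfK ?gt_eqF// mul1r.
have /andP[s1 s2] : - (k%:R - 1) < s < k%:R - 1 by rewrite -ltr_norml; lra.
have k2 : k.*2%:R = k%:R + k%:R :> R by rewrite -addnn natrD.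
rewrite k2 !ltr_norml.
have k0 : 0 <= k%:R :> R by [].
move: ki ki1 k0 s1 s2; move: (k%:R) (k.+1%:R^-1) => K Ki ki ki1 k0 s1 s2.
move=> /andP[c1 c2].
move: c1 c2; case: (leP (s' + K) (K + K)) => h1;
  [case: (leP 0 (s' + K)) => h2|case: (leP 0 (K + K)) => h2];
  by move=> c1 c2; apply/andP; split; lra.
Qed.

Lemma cell_close k (x x' : X) : (forall i, `|x ord0 i| + 1 < k%:R) ->
  cell k x' = cell k x -> forall i, `|x ord0 i - x' ord0 i| < k.+1%:R^-1.
Proof.
move=> xk xx' i; have {xx'} := congr1 (fun q : {ffun _ -> _} => q i) xx'.
rewrite !ffunE => /(congr1 val) /=; rewrite !inordK ?cell_height_trunc//.
exact: cell_height_close.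
Qed.

(** The lower step functions of [f], constant on rectangles of cells. *)
Definition cell_inf (f : X * X -> R) k (t : {ffun 'I_n -> 'I_(cell_size k)} *
    {ffun 'I_n -> 'I_(cell_size k)}) : R :=
  inf [set f z | z in [set z : X * X | (cell k z.1, cell k z.2) = t]].
Arguments cell_inf : clear implicits.

Let qcell k (z : X * X) := (cell k z.1, cell k z.2).

Let qcell_preimage k t :
  qcell k @^-1` [set t] = (cell k @^-1` [set t.1]) `*` (cell k @^-1` [set t.2]).
Proof.
apply/seteqP; split => z /=; first by move=> <-.
by move=> [z1 z2]; rewrite /qcell z1 z2 -surjective_pairing.
Qed.

Lemma measurable_qcell k t : measurable (qcell k @^-1` [set t]).
Proof. by rewrite qcell_preimage; apply: measurableX; exact: measurable_cell. Qed.

Lemma cell_inf_ge0 f k t : (forall z, 0 <= f z) -> 0 <= cell_inf f k t.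
Proof.
move=> f0; rewrite /cell_inf.
have [->|/set0P ne] :=
  eqVneq [set f z | z in [set z : X * X | (cell k z.1, cell k z.2) = t]] set0.
  by rewrite inf0.
by apply: lb_le_inf => // _ [z _ <-].
Qed.

Lemma cell_inf_le f k z : (forall z, 0 <= f z) -> cell_inf f k (qcell k z) <= f z.
Proof.
move=> f0; apply: ge_inf; last by exists z.
by exists 0 => _ [w _ <-].
Qed.

Lemma cell_inf_cvg (f : X * X -> R) z : continuous f -> (forall z, 0 <= f z) ->
  cell_inf f k (qcell k z) @[k --> \oo] --> f z.
Proof.
move=> cf f0; apply/cvgrPdist_le => e e0.
have /cvgrPdist_lt/(_ e e0) := cf z.
move=> [[V1 V2] /= [zV1 zV2] Vf].
have /nbhs_ballP[e1 /= e10 E1] := zV1; have /nbhs_ballP[e2 /= e20 E2] := zV2.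
pose M := \sum_(i < n) (`|z.1 ord0 i| + `|z.2 ord0 i|).
near=> k.
have Mk : M + 1 < k%:R by near: k; exact: nbhs_infty_gtr.
have k1 : k.+1%:R^-1 < e1 by near: k; exact: near_infty_natSinv_lt (PosNum e10).
have k2 : k.+1%:R^-1 < e2 by near: k; exact: near_infty_natSinv_lt (PosNum e20).
have Mi i : `|z.1 ord0 i| + `|z.2 ord0 i| <= M.
  by rewrite /M (bigD1 i)//= lerDl sumr_ge0// => j _; rewrite addr_ge0.
have z1k i : `|z.1 ord0 i| + 1 < k%:R.
  by have := Mi i; have := normr_ge0 (z.2 ord0 i); lra.
have z2k i : `|z.2 ord0 i| + 1 < k%:R.
  by have := Mi i; have := normr_ge0 (z.1 ord0 i); lra.
rewrite ger0_norm; last by rewrite subr_ge0; exact: cell_inf_le.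
rewrite lerBlDl -lerBlDr; apply: lb_le_inf; first by exists (f z), z.
move=> _ [w /= [w1 w2] <-].
have : `|f z - f w| < e.
  apply: Vf; split => /=.
    by apply: E1; split => // i j; rewrite ord1; exact: lt_trans (cell_close z1k w1 j) k1.
  by apply: E2; split => // i j; rewrite ord1; exact: lt_trans (cell_close z2k w2 j) k2.
by rewrite ltr_norml => /andP[? ?]; lra.
Unshelve. all: by end_near. Qed.

Lemma measurable_cell_inf f k : measurable_fun setT (fun z => cell_inf f k (qcell k z)).
Proof.
apply: (measurable_finite_range (q := qcell k) (cell_inf f k)).
exact: measurable_qcell.
Qed.

(** The sigma-algebra comes from the coordinates, so measurability is obtained from the pointwise
    limit of the step functions [cell_inf]. *)
Lemma continuous_nonneg_measurable (f : X * X -> R) :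
  continuous f -> (forall z, 0 <= f z) -> measurable_fun setT f.
Proof.
move=> cf f0; apply: (measurable_fun_cvg (h := fun k z => cell_inf f k (qcell k z))).
  by move=> k; exact: measurable_cell_inf.
by move=> z _; exact: cell_inf_cvg.
Qed.

(** Each lower step function lies below [f] and its integral involves finitely many rectangles, so
    the bound passes to the limit plan; Fatou's lemma then refines the grid. *)
Lemma lsc_integral (U : set_system nat) {UF : ProperFilter U}
    (g : nat -> probability (X * X)%type R) (gamma : probability (X * X)%type R)
    (f : X * X -> R) (L : R) :
  (forall A B, measurable A -> measurable B ->
    pr (g k) (A `*` B) @[k --> U] --> pr gamma (A `*` B)) ->
  continuous f -> (forall z, 0 <= f z) ->
  (\forall k \near U, (\int[g k]_z (f z)%:E <= L%:E)%E) ->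
  (\int[gamma]_z (f z)%:E <= L%:E)%E.
Proof.
move=> gG cf f0 gL.
have mf := continuous_nonneg_measurable cf f0.
apply: (fatou_le (g := fun k z => cell_inf f k (qcell k z))).
- by move=> k; exact: measurable_cell_inf.
- by move=> k z; exact: cell_inf_ge0.
- by move=> z; exact: cell_inf_cvg.
move=> k.
have E (P : probability (X * X)%type R) : (\int[P]_z (cell_inf f k (qcell k z))%:E =
    (\sum_(t : {ffun 'I_n -> 'I_(cell_size k)} * {ffun 'I_n -> 'I_(cell_size k)})
     cell_inf f k t * pr P (qcell k @^-1` [set t]))%:E)%E.
  rewrite (@integral_finite_range _ _ _ _ _ (qcell k) (cell_inf f k)).
  - rewrite -sumEFin; apply: eq_bigr => t _; rewrite EFinM -prE//.
    exact: measurable_qcell.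
  - exact: measurable_qcell.
  - by move=> t; exact: cell_inf_ge0.
rewrite E lee_fin.
have cv : \sum_(t : {ffun 'I_n -> 'I_(cell_size k)} * {ffun 'I_n -> 'I_(cell_size k)})
      cell_inf f k t * pr (g j) (qcell k @^-1` [set t]) @[j --> U] -->
    \sum_(t : {ffun 'I_n -> 'I_(cell_size k)} * {ffun 'I_n -> 'I_(cell_size k)})
      cell_inf f k t * pr gamma (qcell k @^-1` [set t]).
  apply: cvg_bigsum => t; apply: cvgM; first exact: cvg_cst.
  by rewrite qcell_preimage; apply: gG; exact: measurable_cell.
apply: (cvgr_to_le cv); apply: filterS gL => j gL; rewrite -lee_fin -E; apply: le_trans gL.
apply: ge0_le_integral => //.
- by move=> z _; rewrite lee_fin cell_inf_ge0.
- by apply/measurable_EFinP; exact: measurable_cell_inf.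
- exact/measurable_EFinP.
- by move=> z _; rewrite lee_fin cell_inf_le.
Qed.

End cells.

(** * Relative entropy *)

Section real_integrals.
Context d (T : measurableType d) (R : realType).
Variable m : {measure set T -> \bar R}.
Implicit Types f g : T -> R.

Lemma integral_le f g : measurable_fun setT f -> measurable_fun setT g ->
  (forall x, 0 <= f x) -> (forall x, f x <= g x) ->
  (\int[m]_x (f x)%:E <= \int[m]_x (g x)%:E)%E.
Proof.
move=> mf mg f0 fg; apply: ge0_le_integral => //.
- by move=> x _; rewrite lee_fin.
- exact/measurable_EFinP.
- exact/measurable_EFinP.
- by move=> x _; rewrite lee_fin.
Qed.

Lemma integral_add f g : measurable_fun setT f -> measurable_fun setT g ->
  (forall x, 0 <= f x) -> (forall x, 0 <= g x) ->
  (\int[m]_x (f x + g x)%:E = \int[m]_x (f x)%:E + \int[m]_x (g x)%:E)%E.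
Proof.
move=> mf mg f0 g0; under eq_integral do rewrite EFinD.
apply: ge0_integralD => //.
- by move=> x _; rewrite lee_fin.
- exact/measurable_EFinP.
- by move=> x _; rewrite lee_fin.
- exact/measurable_EFinP.
Qed.

Lemma integral_scale (c : R) f : measurable_fun setT f -> (forall x, 0 <= f x) ->
  0 <= c -> (\int[m]_x (c * f x)%:E = c%:E * \int[m]_x (f x)%:E)%E.
Proof.
move=> mf f0 c0; under eq_integral do rewrite EFinM.
apply: ge0_integralZl_EFin => //.
- by move=> x _; rewrite lee_fin.
- exact/measurable_EFinP.
Qed.

Lemma integral_nonneg f : (forall x, 0 <= f x) -> (0 <= \int[m]_x (f x)%:E)%E.
Proof. by move=> f0; apply: integral_ge0 => x _; rewrite lee_fin. Qed.

Lemma integral_eq0_ae f : measurable_fun setT f -> (forall x, 0 <= f x) ->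
  (\int[m]_x (f x)%:E = 0)%E -> \forall x \ae m, f x = 0.
Proof.
move=> mf f0 If; have : (\int[m]_x `|(f x)%:E| = 0)%E.
  by rewrite -[RHS]If; apply: eq_integral => x _; rewrite gee0_abs// lee_fin.
move/ae_eq_integral_abs => -/(_ measurableT) H.
have {H} : ae_eq m setT (EFin \o f) (cst 0%E) by apply: H; exact/measurable_EFinP.
by apply: filterS => x /(_ Logic.I) /= [].
Qed.

Lemma ae_integral_eq f g : measurable_fun setT f -> measurable_fun setT g ->
  (forall x, 0 <= f x) -> (forall x, 0 <= g x) ->
  (\forall x \ae m, f x = g x) ->
  (\int[m]_x (f x)%:E = \int[m]_x (g x)%:E)%E.
Proof.
move=> mf mg f0 g0 fg; apply: ge0_ae_eq_integral => //.
- exact/measurable_EFinP.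
- exact/measurable_EFinP.
- by move=> x _; rewrite lee_fin.
- by move=> x _; rewrite lee_fin.
by apply: filterS fg => x -> _.
Qed.

End real_integrals.

Lemma integral_prob_cst d (T : measurableType d) (R : realType)
  (P : probability T R) (c : R) : (\int[P]_x c%:E = c%:E)%E.
Proof. by rewrite integral_cst//= probability_setT mule1. Qed.

Lemma measurable_le_const d (T : measurableType d) (R : realType) (f : T -> R) M :
  measurable_fun setT f -> measurable [set x | f x <= M].
Proof.
move=> mf; rewrite (_ : [set x | _] = f @^-1` `]-oo, M]).
  by rewrite -[X in measurable X]setTI; exact: mf.
by apply/seteqP; split => x /=; rewrite in_itv.
Qed.

Section density.
Context d (T : measurableType d) (R : realType).
Implicit Types (P m : probability T R) (f g : T -> R).

(** A real version of the Radon-Nikodym derivative, nonnegative everywhere; by [KL_density] any such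
    version computes the entropy. *)
Definition density P m f := [/\ measurable_fun setT f, forall x, 0 <= f x &
  forall A, measurable A -> P A = (\int[m]_(x in A) (f x)%:E)%E].

Lemma density_dominates P m f : density P m f -> P `<< m.
Proof.
move=> [mf f0 Pf]; apply/null_content_dominatesP => A mA A0.
rewrite Pf//; apply: null_set_integral => //.
- by apply/measurable_EFinP; exact: measurable_funTS.
Qed.

Lemma density_exists P m : P `<< m -> exists f, density P m f.
Proof.
move=> Pm; exists (fine \o Radon_Nikodym_SigmaFinite.f P m); split.
- apply: measurableT_comp => //.
  exact: measurable_int (Radon_Nikodym_SigmaFinite.f_integrable Pm).
- by move=> x /=; rewrite fine_ge0// Radon_Nikodym_SigmaFinite.f_ge0.
- move=> A mA; rewrite (Radon_Nikodym_SigmaFinite.f_integral Pm)//.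
  by apply: eq_integral => x _; rewrite /= fineK// Radon_Nikodym_SigmaFinite.f_fin_num.
Qed.

Lemma density_integrable P m f : density P m f -> m.-integrable setT (EFin \o f).
Proof.
move=> [mf f0 Pf]; apply/integrableP; split; first exact/measurable_EFinP.
under eq_integral => x _ do rewrite /= ger0_norm//.
by rewrite -Pf// probability_setT ltry.
Qed.

Lemma density_ae P m f (g : T -> \bar R) : density P m f -> measurable_fun setT g ->
  (forall A, measurable A -> P A = (\int[m]_(x in A) g x)%E) ->
  \forall x \ae m, (f x)%:E = g x.
Proof.
move=> fd mg Pg; have [mf f0 Pf] := fd.
have : ae_eq m setT (EFin \o f) g.
  apply: integral_ae_eq => //; first exact: density_integrable fd.
  by move=> A _ mA; rewrite -Pg// -Pf.
by apply: filterS => x; exact.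
Qed.

Lemma density_change P m f g : density P m f -> measurable_fun setT g ->
  (forall x, 0 <= g x) ->
  (\int[P]_x (g x)%:E = \int[m]_x (g x * f x)%:E)%E.
Proof.
move=> fd mg g0; have Pm := density_dominates fd; have [mf f0 Pf] := fd.
have -> : (\int[P]_x (g x)%:E =
    \int[m]_x ((g x)%:E * Radon_Nikodym_SigmaFinite.f P m x))%E.
  apply/esym/(Radon_Nikodym_SigmaFinite.change_of_variables Pm (f := EFin \o g)) => //.
  exact/measurable_EFinP.
have mr := measurable_int _ (Radon_Nikodym_SigmaFinite.f_integrable Pm).
apply: ge0_ae_eq_integral => //.
- by apply: emeasurable_funM => //; exact/measurable_EFinP.
- by apply/measurable_EFinP; exact: measurable_funM.
- by move=> x _; rewrite mule_ge0 ?lee_fin// Radon_Nikodym_SigmaFinite.f_ge0.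
- by move=> x _; rewrite lee_fin mulr_ge0.
have := density_ae fd mr (fun A mA => Radon_Nikodym_SigmaFinite.f_integral Pm mA).
by apply: filterS => x fx _; rewrite EFinM fx.
Qed.

Lemma density_setT P m f : density P m f -> (\int[m]_x (f x)%:E = 1)%E.
Proof. by move=> [_ _ Pf]; rewrite -Pf// probability_setT. Qed.

Lemma density_unique P m f g : density P m f -> density P m g ->
  \forall x \ae m, f x = g x.
Proof.
move=> fd [mg g0 Pg].
have := density_ae fd (_ : measurable_fun setT (EFin \o g)) Pg.
move=> /(_ _)/wrap[]; first exact/measurable_EFinP.
by apply: filterS => x [].
Qed.

End density.

Section KL_function.
Variable R : realType.
Implicit Types s t : R.

Lemma ln_le_sub1 s : 0 < s -> ln s <= s - 1.
Proof.
by move=> s0; have := expR_ge1Dx (ln s); rewrite lnK ?posrE//; lra.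
Qed.

Lemma ln_lt_sub1 s : 0 < s -> s != 1 -> ln s < s - 1.
Proof.
move=> s0 s1; have : ln s != 0 by rewrite ln_eq0.
by move=> /expR_gt1Dx; rewrite lnK ?posrE//; lra.
Qed.

(** For s > 0 this is ln (t / s) <= t / s - 1 multiplied by s. The entropy estimates below come from
    this tangent line at a well chosen t; the equality case carries strict convexity. *)
Lemma KL_fun_tangent s t : 0 <= s -> 0 < t ->
  KL_fun t + ln t * (s - t) <= KL_fun s ?= iff (s == t).
Proof.
rewrite /KL_fun le_eqVlt => /predU1P[<-|s0] t0.
  rewrite /Order.leif (lt_eqF t0) mul0r; split; first lra.
  by apply/eqP; lra.
have ts : ln (t / s) = ln t - ln s by rewrite ln_div.
have sn : s != 0 by rewrite gt_eqF.
have ts0 : 0 < t / s by rewrite divr_gt0.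
apply/leifP; case: eqVneq => [->|st]; first by apply/eqP; ring.
have : ln (t / s) < t / s - 1.
  apply: ln_lt_sub1 => //; apply: contra st => /eqP st1.
  by rewrite eq_sym -[t](divfK sn) st1 mul1r.
rewrite ts -(ltr_pM2l s0) [s * (t / s - 1)]mulrBr [s * (t / s)]mulrC divfK//.
by move: (ln t) (ln s) => u v; lra.
Qed.

Lemma KL_fun_ge0 s : 0 <= KL_fun s.
Proof.
have [s0|s0] := leP s 0; first by rewrite /KL_fun (ln0 s0); lra.
have := KL_fun_tangent (ltW s0) ltr01; rewrite /KL_fun ln1 => -[+ _]; lra.
Qed.

Lemma KL_fun_eq0 s : 0 <= s -> KL_fun s = 0 -> s = 1.
Proof.
move=> s0 Ks; have [_] := KL_fun_tangent s0 ltr01.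
by rewrite Ks /KL_fun ln1 mulr0 mul0r !add0r addNr addr0 eqxx => /esym/eqP.
Qed.

Lemma KL_fun1 : KL_fun (1 : R) = 0.
Proof. by rewrite /KL_fun ln1; lra. Qed.

(** Add the tangent inequalities at the midpoint for s and for t: the linear terms cancel. *)
Lemma KL_fun_midpoint s t : 0 <= s -> 0 <= t ->
  KL_fun ((s + t) / 2) <= (KL_fun s + KL_fun t) / 2 ?= iff (s == t).
Proof.
move=> s0 t0; have [st|st] := eqVneq (s + t) 0.
  have -> : s = 0 by lra. have -> : t = 0 by lra.
  by rewrite eqxx; split; [|apply/eqP]; rewrite addr0 mul0r; lra.
have m0 : 0 < (s + t) / 2 by rewrite divr_gt0// lt_neqAle eq_sym st addr_ge0.
have [l1 e1] := KL_fun_tangent s0 m0; have [l2 e2] := KL_fun_tangent t0 m0.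
move: l1 e1 l2 e2; set m := (s + t) / 2; set a := ln m => l1 e1 l2 e2.
apply/leifP; case: eqVneq => [st'|st'].
  have -> : m = t by rewrite /m st'; lra.
  by rewrite st'; apply/eqP; lra.
have sm : s != m by apply: contra st' => /eqP; rewrite /m => ?; apply/eqP; lra.
have : KL_fun m + a * (s - m) < KL_fun s by rewrite lt_neqAle e1 sm l1.
have : a * (s - m) + a * (t - m) = 0 by rewrite -mulrDr /m; lra.
lra.
Qed.

Lemma measurable_KL_fun : measurable_fun setT (@KL_fun R).
Proof.
apply: measurable_funD => //; apply: measurable_funB => //.
by apply: measurable_funM => //; exact: measurable_ln.
Qed.

End KL_function.

Section KL_properties.
Context d (T : measurableType d) (R : realType).
Implicit Types (P Q m : probability T R) (f g : T -> R).

Let mKL f : measurable_fun setT f -> measurable_fun setT (fun x => KL_fun (f x)).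
Proof. by move=> mf; apply: measurableT_comp => //; exact: measurable_KL_fun. Qed.

Lemma KL_density P m f : density P m f ->
  KL P m = (\int[m]_x (KL_fun (f x))%:E)%E.
Proof.
move=> fd; have Pm := density_dominates fd; have [mf f0 Pf] := fd.
rewrite /KL asboolT//.
have intRN := @Radon_Nikodym_integrable _ _ _ (charge_of_finite_measure P) m Pm.
have mRN := measurable_int _ intRN.
apply: ae_integral_eq.
- apply: measurableT_comp; first exact: measurable_KL_fun.
  exact: measurableT_comp.
- exact: mKL.
- by move=> x; exact: KL_fun_ge0.
- by move=> x; exact: KL_fun_ge0.
have := density_ae fd mRN (fun A mA =>
  @Radon_Nikodym_integral _ _ _ (charge_of_finite_measure P) m A Pm mA).
by apply: filterS => x <-.
Qed.

Lemma KL_ge0 P m : (0 <= KL P m)%E.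
Proof.
rewrite /KL; case: ifPn => // _; apply: integral_nonneg => x; exact: KL_fun_ge0.
Qed.

Lemma KL_fin_density P m : (KL P m < +oo)%E -> exists f, density P m f.
Proof.
by rewrite /KL; case: asboolP => [Pm _|_]; [exact: density_exists|rewrite ltxx].
Qed.

Lemma KL_fin_dominates P m : (KL P m < +oo)%E -> P `<< m.
Proof. by move=> /KL_fin_density[f /density_dominates]. Qed.

Lemma measure_eq_dominates P Q (m : {measure set T -> \bar R}) :
  measure_eq P Q -> P `<< m -> Q `<< m.
Proof.
move=> PQ /null_content_dominatesP Pm; apply/null_content_dominatesP => A mA A0.
by apply: etrans (esym (PQ A mA)) _; exact: Pm.
Qed.

Lemma measure_eq_density P Q m f : measure_eq P Q -> density P m f -> density Q m f.
Proof.
by move=> PQ [mf f0 Pf]; split => // A mA; exact: etrans (esym (PQ A mA)) (Pf A mA).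
Qed.

Lemma KL_measure_eq P Q m : measure_eq P Q -> KL P m = KL Q m.
Proof.
move=> PQ; have [Pm|nPm] := pselect (P `<< m).
  have [f fd] := density_exists Pm.
  by rewrite (KL_density fd) (KL_density (measure_eq_density PQ fd)).
rewrite /KL !asboolF// => Qm; apply: nPm; apply: measure_eq_dominates Qm.
by move=> A mA; rewrite PQ.
Qed.

Lemma density1 m : density m m (cst 1).
Proof.
split => // A mA; rewrite -[LHS]mul1e; apply/esym.
exact: (integral_cst m mA 1%E).
Qed.

Lemma KL_self m : KL m m = 0%E.
Proof.
by rewrite (KL_density (density1 m)) /= KL_fun1 integral0.
Qed.

Lemma KL_eq0 P m : KL P m = 0%E -> measure_eq P m.
Proof.
move=> K0; have [|f fd] := @KL_fin_density P m; first by rewrite K0 ltry.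
have [mf f0 Pf] := fd; move: K0; rewrite (KL_density fd) => /integral_eq0_ae.
move=> /(_ (mKL mf) (fun x => KL_fun_ge0 (f x))) f1 A mA.
apply: etrans (Pf A mA) _; apply: etrans (etrans (integral_cst m mA 1%E) (mul1e _)).
apply: ge0_ae_eq_integral => //.
- by apply/measurable_EFinP; exact: measurable_funTS.
- by move=> x _; rewrite lee_fin.
- by apply: filterS f1 => x fx _; rewrite (KL_fun_eq0 (f0 x) fx).
Qed.

(** The tangent at exp r reads r s <= KL_fun s + exp r - 1 (Young's inequality for the entropy); it
    is applied to the density on A. *)
Lemma KL_dominated P m (C r : R) A : (KL P m <= C%:E)%E -> 0 <= r -> measurable A ->
  r * pr P A <= C + expR r * pr m A.
Proof.
move=> KC r0 mA; have [|f fd] := @KL_fin_density P m.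
  by rewrite (le_lt_trans KC)// ltry.
have [mf f0 Pf] := fd; rewrite -lee_fin EFinD !EFinM -!prE//.
apply: (@le_trans _ _ (\int[m]_x (KL_fun (f x) + expR r * \1_A x)%:E)%E).
  have -> : P A = (\int[P]_x (\1_A x)%:E)%E by rewrite integral_indic// setIT.
  rewrite -integral_scale//.
  have -> : (\int[P]_x (r * \1_A x)%:E = \int[m]_x (r * \1_A x * f x)%:E)%E.
    apply: (density_change fd (g := fun x => r * \1_A x)).
      exact: measurable_funM.
    by move=> x; rewrite mulr_ge0.
  apply: integral_le.
  - by do 2!apply: measurable_funM => //.
  - by apply: measurable_funD; [exact: mKL|exact: measurable_funM].
  - by move=> x; rewrite !mulr_ge0// indicE.
  move=> x; rewrite indicE; case: (x \in A); last first.
    by rewrite !(mulr0, mul0r) addr0 KL_fun_ge0.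
  rewrite !mulr1; have [+ _] := KL_fun_tangent (f0 x) (expR_gt0 r).
  by rewrite /KL_fun expRK; lra.
rewrite (integral_add m (mKL mf) (g := fun x => expR r * \1_A x)); last 3 first.
- exact: measurable_funM.
- by move=> x; exact: KL_fun_ge0.
- by move=> x; rewrite mulr_ge0 ?expR_ge0.
rewrite -(KL_density fd) leeD//.
by rewrite integral_scale ?integral_indic ?setIT ?expR_ge0// => x; rewrite indicE.
Qed.

(** If m(A) <= exp (-r), [KL_dominated] gives r P(A) <= C + 1, and r = (|C| + 1) / e turns this into
    P(A) <= e. *)
Lemma uniformly_small (I : Type) (P : I -> probability T R) m (C : R) :
  (forall i, (KL (P i) m <= C%:E)%E) ->
  forall e : R, 0 < e -> exists2 delta : R, 0 < delta &
    forall A, measurable A -> pr m A <= delta -> forall i, pr (P i) A <= e.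
Proof.
move=> KC e e0.
pose r := (`|C| + 1) / e; have r0 : 0 < r by rewrite divr_gt0// ltr_wpDl.
exists (expR (- r)); first exact: expR_gt0.
move=> A mA Ad i; have := KL_dominated (KC i) (ltW r0) mA.
have : expR r * pr m A <= 1.
  by rewrite -(expR0 R) -(subrr r) expRD ler_pM2l// expR_gt0.
have := ler_norm C => h1 h2 h3.
have re : r * e = `|C| + 1 by rewrite /r divfK ?gt_eqF.
have : r * pr (P i) A <= r * e by rewrite re; lra.
by rewrite ler_pM2l.
Qed.

(** Here [h] is only measurable, which setwise convergence permits: values are discretized instead
    of points, min (h, k) being rounded down to a multiple of 1/(k+1). *)
Lemma lsc_setwise (U : set_system nat) {UF : ProperFilter U}
    (P : nat -> probability T R) Q (h : T -> R) (L : R) :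
  (forall A, measurable A -> pr (P k) A @[k --> U] --> pr Q A) ->
  measurable_fun setT h -> (forall x, 0 <= h x) ->
  (\forall k \near U, (\int[P k]_x (h x)%:E <= L%:E)%E) ->
  (\int[Q]_x (h x)%:E <= L%:E)%E.
Proof.
move=> PQ mh h0 PL.
pose q k x : 'I_(k * k.+1).+1 := inord (Num.truncn (Num.min (h x) k%:R * k.+1%:R)).
have q0 k x : 0 <= Num.min (h x) k%:R * k.+1%:R by rewrite mulr_ge0// le_min h0 ler0n.
have qlt k x : (Num.truncn (Num.min (h x) k%:R * k.+1%:R) < (k * k.+1).+1)%N.
  rewrite ltnS -(@Num.Theory.natrK R (k * k.+1)%N); apply: le_truncn.
  by rewrite natrM ler_wpM2r// ge_min lexx orbT.
pose v k (i : 'I_(k * k.+1).+1) : R := i%:R / k.+1%:R.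
have mq k i : measurable (q k @^-1` [set i]).
  rewrite (_ : _ @^-1` _ = (fun x => Num.min (h x) k%:R * k.+1%:R) @^-1` `[i%:R, i.+1%:R[).
    rewrite -[X in measurable X]setTI.
    have mm : measurable_fun setT (fun x => Num.min (h x) k%:R * k.+1%:R).
      by apply: measurable_funM => //; exact: measurable_minr.
    exact: mm.
  apply/seteqP; split => x /=; rewrite in_itv/=.
    by move=> <-; rewrite inordK//; exact: truncn_itv.
  by move=> H; apply: val_inj; rewrite /= inordK//; exact: truncn_def.
have v0 k i : 0 <= v k i by rewrite divr_ge0.
have vq k x : v k (q k x) <= h x.
  rewrite /v /q inordK// ler_pdivrMr//.
  have /andP[+ _] := truncn_itv (q0 k x); move=> /le_trans; apply.
  by rewrite ler_wpM2r// ge_min lexx.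
have E k (Q' : probability T R) : (\int[Q']_x (v k (q k x))%:E =
    (\sum_i v k i * pr Q' (q k @^-1` [set i]))%:E)%E.
  rewrite (integral_finite_range Q' (mq k) (v0 k)) -sumEFin.
  by apply: eq_bigr => i _; rewrite [RHS]EFinM; congr (_ * _)%E; apply: prE; exact: mq.
have mvq k : measurable_fun setT (fun x => v k (q k x)).
  exact: (measurable_finite_range (v k) (mq k)).
apply: (fatou_le (g := fun k x => v k (q k x))) => //.
  move=> x; apply/cvgrPdist_lt => e e0; near=> k.
  rewrite ger0_norm ?subr_ge0// ltrBlDr -ltrBlDl.
  have hk : h x < k%:R by near: k; exact: nbhs_infty_gtr.
  have ke : k.+1%:R^-1 < e by near: k; exact: near_infty_natSinv_lt (PosNum e0).
  rewrite /v /q inordK// ltr_pdivlMr//.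
  have /andP[_] := truncn_itv (q0 k x).
  rewrite [Num.min _ _]min_l ?ltW// -natr1; set t : R := _%:R => ht.
  have : 1 < e * k.+1%:R by rewrite -ltr_pdivrMr// mul1r.
  by rewrite mulrBl; lra.
move=> k; rewrite E lee_fin.
have cv : \sum_i v k i * pr (P j) (q k @^-1` [set i]) @[j --> U] -->
    \sum_i v k i * pr Q (q k @^-1` [set i]).
  by apply: cvg_bigsum => i; apply: cvgM; [exact: cvg_cst|exact: PQ].
apply: (cvgr_to_le cv); apply: filterS PL => j; rewrite -lee_fin -E; apply: le_trans.
by apply: integral_le => // x; exact: vq.
Unshelve. all: by end_near. Qed.

End KL_properties.

(** Continuity of [KL_fun] at 0, where the logarithm is discontinuous. The rate comes from ln u <= u
    - 1 at the inverse of the square root of s. *)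
Lemma KL_fun_near0 (R : realType) (s : R) : 0 < s -> s <= 1 ->
  `|KL_fun 0 - KL_fun s| <= 2 * Num.sqrt s.
Proof.
move=> s0 s1; have r0 : 0 < Num.sqrt s by rewrite sqrtr_gt0.
have sr : s = Num.sqrt s ^+ 2 by rewrite sqr_sqrtr// ltW.
have := ln_le_sub1 (_ : 0 < (Num.sqrt s)^-1); rewrite invr_gt0 => /(_ r0).
rewrite lnV ?posrE// => lr.
have ls : ln s = 2 * ln (Num.sqrt s) by rewrite {1}sr lnXn// mulr_natl.
have ls0 : ln s <= 0 by exact: ln_le0.
have K0 : KL_fun (0 : R) = 1 by rewrite /KL_fun mul0r; lra.
rewrite K0 /KL_fun ger0_norm; last first.
  have : s * ln s <= 0 by rewrite mulr_ge0_le0// ltW.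
  lra.
have : Num.sqrt s ^+ 2 * - ln (Num.sqrt s) <= Num.sqrt s - Num.sqrt s ^+ 2.
  rewrite (_ : _ - _ = Num.sqrt s ^+ 2 * ((Num.sqrt s)^-1 - 1)).
    by rewrite ler_wpM2l// exprn_ge0// ltW.
  by rewrite mulrBr mulr1 expr2 -mulrA divff ?gt_eqF// mulr1.
have := sqr_ge0 (Num.sqrt s); rewrite -sr ls.
by move: (ln (Num.sqrt s)) (Num.sqrt s) => u v; lra.
Qed.

Section KL_lower_semicontinuity.
Context d (T : measurableType d) (R : realType).
Implicit Types (P Q m : probability T R) (f g : T -> R).

Let mKL f : measurable_fun setT f -> measurable_fun setT (fun x => KL_fun (f x)).
Proof. by move=> mf; apply: measurableT_comp => //; exact: measurable_KL_fun. Qed.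

Lemma KL_lsc (U : set_system nat) {UF : ProperFilter U}
    (P : nat -> probability T R) Q m (C : R) :
  (forall A, measurable A -> pr (P k) A @[k --> U] --> pr Q A) ->
  (\forall k \near U, (KL (P k) m <= C%:E)%E) -> (KL Q m <= C%:E)%E.
Proof.
move=> PQ PC.
have Qm : Q `<< m.
  apply/null_content_dominatesP => A mA A0; rewrite prE//; congr EFin.
  apply/eqP; rewrite eq_le pr_ge0 andbT; apply: (cvgr_to_le (PQ A mA)).
  apply: filterS PC => k kC; rewrite /pr.
  have /null_content_dominatesP -> // : P k `<< m.
  by apply: KL_fin_dominates; rewrite (le_lt_trans kC)// ltry.
have [f fd] := density_exists Qm; have [mf f0 Qf] := fd.
rewrite (KL_density fd).
(* The tangent of [KL_fun] at the density f clamped between 1/(k+1) and k+1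
   bounds KL (P j) m from below by the integral of a bounded function, for which
   the limit is immediate; then k tends to infinity. *)
pose fk k x := Num.max (k.+1%:R^-1) (Num.min (f x) k.+1%:R).
have k1 k : 0 < k.+1%:R^-1 :> R by rewrite invr_gt0.
have kk k : k.+1%:R^-1 <= 1 :> R by rewrite invf_le1// ler1n.
have kk' k : 1 <= k.+1%:R :> R by rewrite ler1n.
have fk0 k x : 0 < fk k x by rewrite lt_max k1.
have fkk k x : fk k x <= k.+1%:R.
  by rewrite ge_max ge_min lexx orbT andbT (le_trans (kk k)).
have mfk k : measurable_fun setT (fk k).
  by apply: measurable_maxr => //; exact: measurable_minr.
(* The shift by [B k] makes ln (fk) nonnegative, as [lsc_setwise] requires; it cancels at the
   end. *)
pose B k : R := ln k.+1%:R.
have B0 k : 0 <= B k by rewrite ln_ge0.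
have hB k x : - B k <= ln (fk k x).
  by rewrite /B -lnV ?posrE// ler_ln ?posrE// le_max lexx.
have hB' k x : 0 <= ln (fk k x) + B k by have := hB k x; lra.
have mh k : measurable_fun setT (fun x => ln (fk k x) + B k).
  by apply: measurable_funD => //; apply: measurableT_comp => //; exact: measurable_ln.
(* Clamping changes f only above k+1, where ln (fk) >= 0, or below 1/(k+1), where ln (fk) <= 0. *)
have slope k x : 0 <= ln (fk k x) * (f x - fk k x).
  have [fk1|fk1] := ltP (f x) (k.+1%:R^-1).
    have E : fk k x = k.+1%:R^-1 by rewrite /fk max_l// ge_min ltW.
    by rewrite E mulr_le0//; [exact: ln_le0|rewrite subr_le0 ltW].
  have [fk2|fk2] := ltP k.+1%:R (f x).
    have E : fk k x = k.+1%:R by rewrite /fk min_r ?ltW// max_r// (le_trans (kk k)).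
    by rewrite E mulr_ge0//; [exact: ln_ge0|rewrite subr_ge0 ltW].
  have E : fk k x = f x by rewrite /fk min_l// max_r.
  by rewrite E subrr mulr0.
have fin_fk k : (\int[m]_x (fk k x)%:E)%E \is a fin_num.
  rewrite ge0_fin_numE; last by apply: integral_nonneg => x; exact: ltW.
  apply: (@le_lt_trans _ _ (\int[m]_x (k.+1%:R)%:E)%E).
    by apply: integral_le => // x; exact: ltW.
  by rewrite integral_prob_cst ltry.
pose F k : R := fine (\int[m]_x (fk k x)%:E)%E.
have FE k : (\int[m]_x (fk k x)%:E)%E = (F k)%:E by rewrite fineK.
(* The tangent at fk reads g ln (fk) <= KL_fun g + fk - 1 for the density g of P j; integrate, then
   pass to the limit on the left. *)
have step k : (\int[Q]_x (ln (fk k x) + B k)%:E <= (C + F k + B k - 1)%:E)%E.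
  apply: lsc_setwise PQ (mh k) (hB' k) _.
  apply: filterS PC => j jC.
  have [|g gd] := @KL_fin_density _ _ _ (P j) m; first by rewrite (le_lt_trans jC)// ltry.
  have [mg g0 Pg] := gd; rewrite (density_change gd (mh k) (hB' k)).
  have mhg : measurable_fun setT (fun x => (ln (fk k x) + B k) * g x).
    by apply: measurable_funM => //; exact: mh.
  rewrite EFinB leeBrDr// -{1}(integral_prob_cst m 1) -integral_add//; last first.
    by move=> x; rewrite mulr_ge0.
  apply: (@le_trans _ _ (\int[m]_x (KL_fun (g x) + (fk k x + B k * g x))%:E)%E).
    apply: integral_le.
    - by apply: measurable_funD => //; apply: measurable_funM => //; exact: mh.
    - apply: measurable_funD; first exact: mKL.
      by apply: measurable_funD => //; exact: measurable_funM.
    - by move=> x; rewrite addr_ge0// mulr_ge0.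
    move=> x; have [+ _] := KL_fun_tangent (g0 x) (fk0 k x).
    rewrite {1}/KL_fun mulrDl; move: (KL_fun (g x)) (ln (fk k x)) (fk k x) => u v w.
    by lra.
  have mBg : measurable_fun setT (fun x => B k * g x) by exact: measurable_funM.
  have Bg0 x : 0 <= B k * g x by rewrite mulr_ge0.
  rewrite (integral_add m (mKL mg) (g := fun x => fk k x + B k * g x)); last 3 first.
  - exact: measurable_funD.
  - by move=> x; exact: KL_fun_ge0.
  - by move=> x; rewrite addr_ge0// ltW.
  rewrite (integral_add m (mfk k) mBg) => [|x|//]; last exact: ltW.
  rewrite integral_scale// (density_setT gd) mule1 FE -(KL_density gd) -addrA EFinD.
  by rewrite leeD// EFinD.
apply: (fatou_le (g := fun k x => KL_fun (fk k x))).
- by move=> k; exact: mKL.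
- by move=> k x; exact: KL_fun_ge0.
- move=> x; have [fx|fx] := eqVneq (f x) 0.
    apply/cvgrPdist_lt => e e0.
    have e20 : 0 < (e / 2) ^+ 2 by rewrite exprn_gt0 ?divr_gt0.
    near=> k; have E : fk k x = k.+1%:R^-1.
      by rewrite /fk max_l// ge_min fx ltW.
    have rk : Num.sqrt k.+1%:R^-1 < e / 2 :> R.
      rewrite -[ltRHS]ger0_norm ?divr_ge0 1?ltW// -sqrtr_sqr ltr_sqrt//.
      by near: k; exact: near_infty_natSinv_lt (PosNum e20).
    rewrite E fx; apply: le_lt_trans (KL_fun_near0 (k1 k) (kk k)) _.
    by rewrite -ltr_pdivlMl// mulrC.
  have fx0 : 0 < f x by rewrite lt_neqAle eq_sym fx f0.
  apply: cvg_near_cst; near=> k.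
  suff -> : fk k x = f x by [].
  rewrite /fk min_l ?max_r//; last first.
    have fk1 : f x < k%:R by near: k; exact: nbhs_infty_gtr.
    by rewrite -natr1; lra.
  by rewrite ltW//; near: k; exact: near_infty_natSinv_lt (PosNum fx0).
move=> k.
have mBf : measurable_fun setT (fun x => B k * f x) by exact: measurable_funM.
have Bf0 x : 0 <= B k * f x by rewrite mulr_ge0.
have mhf : measurable_fun setT (fun x => (ln (fk k x) + B k) * f x).
  by apply: measurable_funM => //; exact: mh.
(* Indeed KL_fun (fk) + fk = fk ln (fk) + 1 <= f ln (fk) + 1 by [slope]. Together with [step], the
   terms [F k] and [B k] cancel. *)
have : (\int[m]_x (KL_fun (fk k x) + (fk k x + B k * f x))%:E <=
        \int[m]_x ((ln (fk k x) + B k) * f x + 1)%:E)%E.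
  apply: integral_le.
  - by apply: measurable_funD; [exact: mKL|exact: measurable_funD].
  - exact: measurable_funD.
  - by move=> x; rewrite addr_ge0 ?KL_fun_ge0// addr_ge0// ltW.
  move=> x; have := slope k x; rewrite {1}/KL_fun.
  by move: (ln (fk k x)) (fk k x) => u v; lra.
rewrite (integral_add m (mKL (mfk k)) (g := fun x => fk k x + B k * f x)); last 3 first.
- exact: measurable_funD.
- by move=> x; exact: KL_fun_ge0.
- by move=> x; rewrite addr_ge0// ltW.
rewrite (integral_add m (mfk k) mBf) => [|x|//]; last exact: ltW.
rewrite integral_scale// (density_setT fd) mule1 FE.
rewrite (integral_add m mhf) => [||x|//]; [|exact: measurable_cst|by rewrite mulr_ge0].
rewrite -(density_change fd (mh k) (hB' k)) integral_prob_cst => H.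
have H2 : (\int[m]_x (KL_fun (fk k x))%:E + (F k + B k)%:E <= C%:E + (F k + B k)%:E)%E.
  apply: (le_trans H); apply: (le_trans (leeD (step k) (lexx 1%:E))).
  by rewrite -!EFinD lee_fin; lra.
by rewrite leeD2rE in H2.
Unshelve. all: by end_near. Qed.

End KL_lower_semicontinuity.

(** * Mixtures of probabilities and strict convexity of the entropy *)

Section average.
Context d (T : measurableType d) (R : realType).
Implicit Types (P Q m : probability T R) (f g : T -> R).

Section mixture.
Variables (p : R) (p0 : 0 <= p) (p1 : p <= 1) (P Q : probability T R).

Let q0 : 0 <= 1 - p. Proof. by rewrite subr_ge0. Qed.

Definition mixture : set T -> \bar R :=
  measure_add (mscale (NngNum p0) P) (mscale (NngNum q0) Q).

HB.instance Definition _ := Measure.on mixture.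

Lemma mixtureE A : mixture A = (p%:E * P A + (1 - p)%:E * Q A)%E.
Proof. exact: measure_addE. Qed.

Let mixture_setT : mixture setT = 1%E.
Proof.
rewrite mixtureE !probability_setT !mule1 -EFinD.
by congr EFin; lra.
Qed.

HB.instance Definition _ := Measure_isProbability.Build _ _ _ mixture mixture_setT.

Lemma pr_mixture A : measurable A -> pr mixture A = p * pr P A + (1 - p) * pr Q A.
Proof.
move=> mA; apply: EFin_inj; rewrite -prE//; apply: etrans (mixtureE A) _.
by rewrite !prE// -!EFinM -EFinD.
Qed.

Lemma integral_mixture f : measurable_fun setT f -> (forall x, 0 <= f x) ->
  (\int[mixture]_x (f x)%:E =
   p%:E * \int[P]_x (f x)%:E + (1 - p)%:E * \int[Q]_x (f x)%:E)%E.
Proof.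
move=> mf f0; have mf' : measurable_fun setT (EFin \o f) by exact/measurable_EFinP.
have f0' x : setT x -> (0 <= (EFin \o f) x)%E by rewrite lee_fin.
apply: etrans (ge0_integral_measure_add _ _ measurableT f0' mf') _.
by congr (_ + _)%E; exact: ge0_integral_mscale.
Qed.

End mixture.

Lemma density_mixture p (p0 : 0 <= p) (p1 : p <= 1) P Q m f g :
  density P m f -> density Q m g ->
  density (mixture p0 p1 P Q) m (fun x => p * f x + (1 - p) * g x).
Proof.
move=> [mf f0 Pf] [mg g0 Qg]; have q0 : 0 <= 1 - p by rewrite subr_ge0.
split.
- by apply: measurable_funD; exact: measurable_funM.
- by move=> x; rewrite addr_ge0// mulr_ge0.
move=> A mA; apply: etrans (mixtureE p0 p1 P Q A) _; rewrite Pf// Qg//.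
have mf' : measurable_fun A (EFin \o f).
  by apply/measurable_EFinP; exact: measurable_funTS.
have mg' : measurable_fun A (EFin \o g).
  by apply/measurable_EFinP; exact: measurable_funTS.
rewrite -!ge0_integralZl_EFin//; [|by move=> x _; rewrite lee_fin..].
rewrite -ge0_integralD//.
- by move=> x _; rewrite -EFinM lee_fin mulr_ge0.
- by apply: emeasurable_funM => //; exact: measurable_cst.
- by move=> x _; rewrite -EFinM lee_fin mulr_ge0.
- by apply: emeasurable_funM => //; exact: measurable_cst.
Qed.

Let half0 : 0 <= 2^-1 :> R. Proof. by rewrite invr_ge0. Qed.
Let half1 : 2^-1 <= 1 :> R. Proof. by rewrite invf_le1// ler1n. Qed.

Definition average P Q : probability T R := mixture half0 half1 P Q.

Lemma averageE P Q A : average P Q A = ((2^-1)%:E * (P A + Q A))%E.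
Proof.
apply: etrans (mixtureE _ _ _ _ _) _; rewrite muleDr ?ge0_adde_def ?inE//.
by have -> : 1 - 2^-1 = 2^-1 :> R by lra.
Qed.

Lemma pr_average P Q A : measurable A -> pr (average P Q) A = (pr P A + pr Q A) / 2.
Proof. by move=> mA; rewrite pr_mixture//; lra. Qed.

Lemma integral_average P Q f : measurable_fun setT f -> (forall x, 0 <= f x) ->
  (\int[average P Q]_x (f x)%:E =
   (2^-1)%:E * (\int[P]_x (f x)%:E + \int[Q]_x (f x)%:E))%E.
Proof.
move=> mf f0; rewrite integral_mixture//.
have -> : 1 - 2^-1 = 2^-1 :> R by lra.
by apply/esym/ge0_muleDr; exact: integral_nonneg.
Qed.

Lemma density_average P Q m f g : density P m f -> density Q m g ->
  density (average P Q) m (fun x => (f x + g x) / 2).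
Proof.
move=> fd gd; have := density_mixture half0 half1 fd gd.
suff -> : (fun x => 2^-1 * f x + (1 - 2^-1) * g x) = (fun x => (f x + g x) / 2) by [].
by apply/funext => x; lra.
Qed.

(** In case of equality the convexity defect, a nonnegative function, has zero integral, so the
    equality case of [KL_fun_midpoint] holds almost everywhere. *)
Lemma KL_average P Q m (a b : R) : KL P m = a%:E -> KL Q m = b%:E ->
  exists2 c, KL (average P Q) m = c%:E &
    c <= (a + b) / 2 /\ (c = (a + b) / 2 -> measure_eq P Q).
Proof.
move=> Pa Qb.
have [|f fd] := @KL_fin_density _ _ _ P m; first by rewrite Pa ltry.
have [|g gd] := @KL_fin_density _ _ _ Q m; first by rewrite Qb ltry.
have [mf f0 Pf] := fd; have [mg g0 Qg] := gd.
have hd := density_average fd gd; have [mh h0 _] := hd.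
have mK (k : T -> R) : measurable_fun setT k -> measurable_fun setT (fun x => KL_fun (k x)).
  by move=> mk; apply: measurableT_comp => //; exact: measurable_KL_fun.
pose h1 x := KL_fun ((f x + g x) / 2).
pose h2 x := (KL_fun (f x) + KL_fun (g x)) / 2.
have mh1 : measurable_fun setT h1 by exact: mK.
have mh2 : measurable_fun setT h2.
  by apply: measurable_funM => //; apply: measurable_funD; exact: mK.
have h1_0 x : 0 <= h1 x by exact: KL_fun_ge0.
have h12 x : h1 x <= h2 x by have [] := KL_fun_midpoint (f0 x) (g0 x).
have I2 : (\int[m]_x (h2 x)%:E = ((a + b) / 2)%:E)%E.
  rewrite /h2; under eq_integral do rewrite mulrC.
  rewrite integral_scale//; last 2 first.
  - by apply: measurable_funD; exact: mK.
  - by move=> x; rewrite addr_ge0// KL_fun_ge0.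
  rewrite integral_add; [|exact: mK|exact: mK|by move=> x; exact: KL_fun_ge0..].
  by rewrite -(KL_density fd) -(KL_density gd) Pa Qb -EFinD -EFinM mulrC.
have I1 : (\int[m]_x (h1 x)%:E <= ((a + b) / 2)%:E)%E.
  by rewrite -I2; exact: integral_le.
have fin1 : (\int[m]_x (h1 x)%:E)%E \is a fin_num.
  by rewrite ge0_fin_numE ?integral_nonneg// (le_lt_trans I1)// ltry.
exists (fine (\int[m]_x (h1 x)%:E)%E); first by rewrite (KL_density hd) fineK.
split; first by rewrite -lee_fin fineK.
move=> E; pose h3 x := h2 x - h1 x.
have h3_0 x : 0 <= h3 x by rewrite subr_ge0.
have mh3 : measurable_fun setT h3 by exact: measurable_funB.
have : (\int[m]_x (h1 x + h3 x)%:E = ((a + b) / 2)%:E)%E.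
  by rewrite -I2; apply: eq_integral => x _; rewrite /h3 subrKC.
rewrite integral_add// -[X in (X + _)%E = _](fineK fin1) E => I3.
have {}I3 : (\int[m]_x (h3 x)%:E = 0)%E.
  move: I3; case: (\int[m]_x _)%E => [r| |]//.
  by rewrite -EFinD => -[I3]; congr EFin; lra.
have fg : \forall x \ae m, f x = g x.
  have := integral_eq0_ae mh3 h3_0 I3; apply: filterS => x /eqP.
  rewrite subr_eq0 eq_sym; have [_] := KL_fun_midpoint (f0 x) (g0 x).
  by rewrite -/(h1 x) -/(h2 x) => -> /eqP.
move=> A mA; apply: etrans (Pf A mA) _; apply: etrans _ (esym (Qg A mA)).
apply: ge0_ae_eq_integral => //.
- by apply/measurable_EFinP; exact: measurable_funTS.
- by apply/measurable_EFinP; exact: measurable_funTS.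
- by move=> x _; rewrite lee_fin.
- by move=> x _; rewrite lee_fin.
by apply: filterS fg => x -> _.
Qed.

End average.

(** * Monotone plans *)

Section thin_sets.
Context (R : realType).

(** Fubini along the recursive definition of [lebesgue_rV]. If i is not the first coordinate,
    sections at a fixed first coordinate are thin in dimension n. If it is, the order of integration
    is exchanged and the inner sections have at most one point. *)
Lemma lebesgue_rV_thin n (i : 'I_n) (N : set 'rV[R]_n) : measurable N ->
  (forall x y, N x -> N y -> (forall j, j != i -> x ord0 j = y ord0 j) ->
    x ord0 i = y ord0 i) ->
  lebesgue_rV R n N = 0%E.
Proof.
elim: n i N => [[] //|n IH] i N mN thin.
have mN' : measurable (@rV_cons R n @^-1` N).
  by rewrite -[X in measurable X]setTI; exact: measurable_rV_cons.
rewrite /= /lebesgue_rV_step /pushforward.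
have consE (t : R) (v : 'rV[R]_n) :
    (rV_cons (t, v) ord0 ord0 = t) /\ (forall j, rV_cons (t, v) ord0 (lift ord0 j) = v ord0 j).
  by split => [|j]; rewrite mxE ?unlift_none ?liftK.
case: (unliftP ord0 i) => [j ->|->] in thin *.
  rewrite /product_measure1; apply: integral0_eq => t _ /=.
  apply: (IH j); first exact: measurable_xsection.
  move=> x y; rewrite /xsection /= !inE => Nx Ny xy.
  have := thin _ _ Nx Ny; rewrite !(consE _ _).2; apply => k.
  case: (unliftP ord0 k) => [l ->|-> _]; last by rewrite !(consE _ _).1.
  by rewrite !(consE _ _).2 => lj; apply: xy; apply: contra lj => /eqP ->.
rewrite (@product_measure_unique _ _ _ _ _ _ _
  (lebesgue_measure \x^ lebesgue_rV R n)%E)//; last first.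
  by move=> A B mA mB; exact: product_measure2E.
rewrite /product_measure2; apply: integral0_eq => v _ /=.
have thin1 s t : (ysection (rV_cons (n:=n) @^-1` N) v) s ->
    (ysection (rV_cons (n:=n) @^-1` N) v) t -> s = t.
  rewrite /ysection /= !inE => Ns Nt.
  have := thin _ _ Ns Nt; rewrite !(consE _ _).1; apply => k.
  by case: (unliftP ord0 k) => [l ->|->]; [rewrite !(consE _ _).2|rewrite eqxx].
have [->|/set0P[s Ns]] := eqVneq (ysection (rV_cons (n:=n) @^-1` N) v) set0.
  by rewrite measure0.
rewrite (_ : ysection _ _ = [set s]) ?lebesgue_measure_set1//.
by apply/seteqP; split => [t Nt|_ ->//]; exact: thin1.
Qed.

End thin_sets.

Section coordinates.
Context (R : realType) (n : nat).
Local Notation X := 'rV[R]_n.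

Lemma measurable_coord_comp d (T : measurableType d) (f : T -> X) i :
  measurable_fun setT f -> measurable_fun setT (fun t => f t ord0 i : R).
Proof.
by move=> mf; apply: (measurableT_comp (@measurable_rV_coord R n i) mf).
Qed.

Lemma sqnorm_ge0 (x : X) : 0 <= sqnorm x.
Proof. by apply: sumr_ge0 => i _; exact: sqr_ge0. Qed.

Lemma measurable_sqnormB d (T : measurableType d) (f g : T -> X) :
  measurable_fun setT f -> measurable_fun setT g ->
  measurable_fun setT (fun t => sqnorm (f t - g t)).
Proof.
move=> mf mg; rewrite /sqnorm; apply: measurable_sum => i.
under eq_fun do rewrite !mxE.
by apply: measurable_funX; apply: measurable_funB; exact: measurable_coord_comp.
Qed.

Lemma measurable_sqnorm d (T : measurableType d) (f : T -> X) :
  measurable_fun setT f -> measurable_fun setT (fun t => sqnorm (f t)).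
Proof.
move=> mf; rewrite /sqnorm; apply: measurable_sum => i.
by apply: measurable_funX; exact: measurable_coord_comp.
Qed.

(** For w = ((x, y), (x', y')), the inner product <x - x', y - y'>. *)
Definition monotony (w : (X * X) * (X * X)) : R :=
  \sum_i (w.1.1 ord0 i - w.2.1 ord0 i) * (w.1.2 ord0 i - w.2.2 ord0 i).

(** This is where the quadratic cost enters: exchanging targets changes the total cost of two draws
    by twice [monotony]. *)
Lemma monotonyE (w : (X * X) * (X * X)) :
  sqnorm (w.1.1 - w.2.2) + sqnorm (w.2.1 - w.1.2) =
  sqnorm (w.1.1 - w.1.2) + sqnorm (w.2.1 - w.2.2) + 2 * monotony w.
Proof.
rewrite /sqnorm /monotony mulr_sumr -!big_split /=; apply: eq_bigr => i _.
by rewrite !mxE; ring.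
Qed.

Lemma monotony_swap w : monotony (w.2, w.1) = monotony w.
Proof. by apply: eq_bigr => i _ /=; ring. Qed.

Let m11 : measurable_fun setT (fun w : (X * X) * (X * X) => w.1.1).
Proof. exact: (measurableT_comp measurable_fst measurable_fst). Qed.
Let m12 : measurable_fun setT (fun w : (X * X) * (X * X) => w.1.2).
Proof. exact: (measurableT_comp measurable_snd measurable_fst). Qed.
Let m21 : measurable_fun setT (fun w : (X * X) * (X * X) => w.2.1).
Proof. exact: (measurableT_comp measurable_fst measurable_snd). Qed.
Let m22 : measurable_fun setT (fun w : (X * X) * (X * X) => w.2.2).
Proof. exact: (measurableT_comp measurable_snd measurable_snd). Qed.

Lemma measurable_monotony : measurable_fun setT monotony.
Proof.
apply: measurable_sum => i.
by apply: measurable_funM; apply: measurable_funB; exact: measurable_coord_comp.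
Qed.

Definition swap_map (w : (X * X) * (X * X)) : X * X :=
  (w.1.1, if monotony w < 0 then w.2.2 else w.1.2).

Let mneg : measurable_fun setT (fun w => monotony w < 0).
Proof. by apply: measurable_fun_ltr => //; exact: measurable_monotony. Qed.

Lemma measurable_swap_map : measurable_fun setT swap_map.
Proof. by apply: measurable_fun_pair => //; exact: measurable_fun_ifT. Qed.

HB.instance Definition _ := isMeasurableFun.Build _ _ _ _ swap_map measurable_swap_map.

Lemma measurable_decreasing : measurable [set w | monotony w < 0].
Proof.
have := mneg measurableT (_ : measurable [set true]); rewrite setTI; apply.
by [].
Qed.

Variable gamma : probability (X * X)%type R.
Local Notation gg := (gamma \x gamma)%E.

Lemma product_sym A : measurable A -> gg [set w | A (w.2, w.1)] = gg A.
Proof.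
have ms : measurable_fun setT (fun w : (X * X) * (X * X) => (w.2, w.1)).
  exact: measurable_fun_pair.
pose s := mfun_Sub (mem_set ms).
move=> mA; apply/esym; apply: (@product_measure_unique _ _ _ _ _ gamma gamma
  (pushforward gg s)) => //.
move=> B C mB mC; apply: (@etrans _ _ (gg (C `*` B))).
  by congr (gg _); apply/seteqP; split => w /= [].
by rewrite product_measure1E// muleC.
Qed.

Lemma integral_product_sym (f : (X * X) * (X * X) -> R) :
  measurable_fun setT f -> (forall w, 0 <= f w) ->
  (\int[gg]_w (f (w.2, w.1))%:E = \int[gg]_w (f w)%:E)%E.
Proof.
move=> mf f0.
have ms : measurable_fun setT (fun w : (X * X) * (X * X) => (w.2, w.1)).
  exact: measurable_fun_pair.
pose s := mfun_Sub (mem_set ms).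
transitivity (\int[pushforward gg s]_w (f w)%:E)%E.
  apply/esym; apply: (@ge0_integral_pushforward _ _ _ _ R s _ gg setT (EFin \o f)) => //.
    exact/measurable_EFinP.
  by move=> w _; rewrite lee_fin.
by apply: eq_measure_integral => A mA _; exact: product_sym.
Qed.

Definition swap_plan : probability (X * X)%type R := distribution gg swap_map.

Lemma swap_plan1 : measure_eq (marginal1 swap_plan) (marginal1 gamma).
Proof.
move=> A mA; apply: (@etrans _ _ (gg ((fst @^-1` A) `*` setT))).
  by congr (gg _); apply/seteqP; split => w //= [].
rewrite product_measure1E//; last first.
  by rewrite -[X in measurable X]setTI; exact: measurable_fst.
by rewrite [X in (_ * X)%E](_ : _ = 1%E) ?mule1//; exact: probability_setT.
Qed.

(** The event [D] of a replacement is invariant under exchange of the two draws, so on [D] the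
    targets y and y' have the same law. *)
Lemma swap_plan2 : measure_eq (marginal2 swap_plan) (marginal2 gamma).
Proof.
move=> A mA; have mD := measurable_decreasing; set D := [set w | monotony w < 0] in mD.
have mA1 : measurable [set w : (X * X) * (X * X) | A w.1.2].
  by rewrite -[X in measurable X]setTI; exact: m12.
have mA2 : measurable [set w : (X * X) * (X * X) | A w.2.2].
  by rewrite -[X in measurable X]setTI; exact: m22.
apply: (@etrans _ _ (gg ((D `&` [set w | A w.2.2]) `|` ([set w | A w.1.2] `\` D)))).
  congr (gg _); apply/seteqP; split => w; rewrite /D /marginal2 /=; case: ifP => // h.
  - by left.
  - by right.
  - by case=> -[].
  - by case=> -[].
have mE1 : measurable (D `&` [set w | A w.2.2]) by exact: measurableI.
have mE2 : measurable (D `&` [set w | A w.1.2]) by exact: measurableI.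
have mE3 : measurable ([set w : (X * X) * (X * X) | A w.1.2] `\` D) by exact: measurableD.
apply: etrans (measureU gg mE1 mE3 _) _.
  by apply/seteqP; split => w //= [[Dw _] [_ nDw]].
have E : gg (D `&` [set w | A w.2.2]) = gg (D `&` [set w | A w.1.2]).
  apply: etrans (product_sym mE2).
  by congr (gg _); apply/seteqP; split => w; rewrite /D /= monotony_swap.
apply: etrans (congr1 (fun u => u + _)%E E) _.
apply: etrans (esym (measureU gg mE2 mE3 _)) _.
  by apply/seteqP; split => w //= [[Dw _] [_ nDw]].
apply: (@etrans _ _ (gg ((snd @^-1` A) `*` setT))).
  by congr (gg _); rewrite setIC setUIDK; apply/seteqP; split => w //= [].
rewrite product_measure1E//; last first.
  by rewrite -[X in measurable X]setTI; exact: measurable_snd.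
by rewrite [X in (_ * X)%E](_ : _ = 1%E) ?mule1//; exact: probability_setT.
Qed.

End coordinates.

(** Halves the symmetrized identity in [cost_swap_plan], whose terms may be infinite. *)
Lemma half_sum_eq (R : realType) (x y z : \bar R) :
  (0 <= x -> 0 <= y -> 0 <= z -> x + x + (y + y) = z + z -> x + y = z)%E.
Proof.
move: x y z => [x| |] [y| |] [z| |]// _ _ _.
by rewrite -!EFinD => -[H]; congr EFin; lra.
Qed.

Section swap_cost.
Context (R : realType) (n : nat).
Local Notation X := 'rV[R]_n.
Variable gamma : probability (X * X)%type R.
Local Notation gg := (gamma \x gamma)%E.

Let gain (w : (X * X) * (X * X)) : R := if monotony w < 0 then - monotony w else 0.

Let mneg : measurable_fun setT (fun w : (X * X) * (X * X) => monotony w < 0).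
Proof. by apply: measurable_fun_ltr => //; exact: measurable_monotony. Qed.

Let mgain : measurable_fun setT gain.
Proof.
apply: measurable_fun_ifT => //.
by under eq_fun do rewrite -sub0r; apply: measurable_funB => //; exact: measurable_monotony.
Qed.

Let gain_ge0 w : 0 <= gain w.
Proof. by rewrite /gain; case: ifP => // h; rewrite oppr_ge0 ltW. Qed.

Lemma integral_product_fst (f : X * X -> R) : measurable_fun setT f ->
  (forall z, 0 <= f z) -> (\int[gg]_w (f w.1)%:E = \int[gamma]_z (f z)%:E)%E.
Proof.
move=> mf f0; rewrite fubini_tonelli1//.
- apply: eq_integral => z _; rewrite /fubini_F /=.
  exact: integral_prob_cst.
- apply/measurable_EFinP; exact: (measurableT_comp mf measurable_fst).
- by move=> w; rewrite lee_fin.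
Qed.

Lemma cost_swap_plan :
  (cost (swap_plan gamma) + \int[gg]_w (gain w)%:E = cost gamma)%E.
Proof.
have m11 : measurable_fun setT (fun w : (X * X) * (X * X) => w.1.1).
  exact: (measurableT_comp measurable_fst measurable_fst).
have m12 : measurable_fun setT (fun w : (X * X) * (X * X) => w.1.2).
  exact: (measurableT_comp measurable_snd measurable_fst).
have m22 : measurable_fun setT (fun w : (X * X) * (X * X) => w.2.2).
  exact: (measurableT_comp measurable_snd measurable_snd).
pose u (w : (X * X) * (X * X)) : R := if monotony w < 0 then sqnorm (w.1.1 - w.2.2) else 0.
pose a (w : (X * X) * (X * X)) : R := if monotony w < 0 then sqnorm (w.1.1 - w.1.2) else 0.
pose r (w : (X * X) * (X * X)) : R := if monotony w < 0 then 0 else sqnorm (w.1.1 - w.1.2).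
have mu : measurable_fun setT u by apply: measurable_fun_ifT => //; exact: measurable_sqnormB.
have ma : measurable_fun setT a by apply: measurable_fun_ifT => //; exact: measurable_sqnormB.
have mr : measurable_fun setT r by apply: measurable_fun_ifT => //; exact: measurable_sqnormB.
have u0 w : 0 <= u w by rewrite /u; case: ifP => // _; exact: sqnorm_ge0.
have a0 w : 0 <= a w by rewrite /a; case: ifP => // _; exact: sqnorm_ge0.
have r0 w : 0 <= r w by rewrite /r; case: ifP => // _; exact: sqnorm_ge0.
have mc : measurable_fun setT (fun z : X * X => sqnorm (z.1 - z.2)).
  by apply: measurable_sqnormB; [exact: measurable_fst|exact: measurable_snd].
have c0 (z : X * X) : 0 <= sqnorm (z.1 - z.2) by exact: sqnorm_ge0.
have cgamma : cost gamma = (\int[gg]_w (a w)%:E + \int[gg]_w (r w)%:E)%E.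
  rewrite -integral_add// /cost -(integral_product_fst mc c0).
  apply: eq_integral => w _; rewrite /a /r.
  by case: ifP => _; rewrite ?addr0 ?add0r.
have cswap : cost (swap_plan gamma) = (\int[gg]_w (u w)%:E + \int[gg]_w (r w)%:E)%E.
  rewrite -integral_add// /cost /swap_plan ge0_integral_distribution//=.
    by apply: eq_integral => w _; rewrite /u /r /=; case: ifP => _; rewrite ?addr0 ?add0r.
  exact/measurable_EFinP.
(* This is half of the integral of [monotonyE], which is symmetric in the draws. *)
have E : (\int[gg]_w (u w)%:E + \int[gg]_w (gain w)%:E = \int[gg]_w (a w)%:E)%E.
  have mss (f : (X * X) * (X * X) -> R) : measurable_fun setT f ->
      measurable_fun setT (fun w => f (w.2, w.1)).
    move=> mf; apply: (measurableT_comp mf); exact: measurable_fun_pair.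
  have : (\int[gg]_w (u w + u (w.2, w.1) + (gain w + gain w))%:E =
          \int[gg]_w (a w + a (w.2, w.1))%:E)%E.
    apply: eq_integral => w _; congr EFin.
    rewrite /u /a /gain /= !monotony_swap; case: ifP => _; last by rewrite !addr0.
    by have := monotonyE w; lra.
  rewrite integral_add; [|by apply: measurable_funD => //; exact: mss|exact: measurable_funD|
    by move=> w; rewrite addr_ge0|by move=> w; rewrite addr_ge0].
  rewrite !integral_add//; [|exact: mss|exact: mss].
  rewrite !(@integral_product_sym _ _ gamma)//.
  move: (integral_nonneg gg u0) (integral_nonneg gg gain_ge0) (integral_nonneg gg a0).
  exact: half_sum_eq.
by rewrite cswap cgamma -E addeAC.
Qed.

Lemma optimal_monotone : (cost gamma < +oo)%E ->
  (cost gamma <= cost (swap_plan gamma))%E ->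
  gg [set w | monotony w < 0] = 0%E.
Proof.
move=> cfin copt; have H := @integral_eq0_ae _ _ _ gg gain mgain gain_ge0.
have cs0 : (0 <= cost (swap_plan gamma))%E.
  by apply: integral_nonneg => z; exact: sqnorm_ge0.
have cg0 : (0 <= cost gamma)%E.
  by apply: integral_nonneg => z; exact: sqnorm_ge0.
have e0 := integral_nonneg gg gain_ge0; have := cost_swap_plan.
move: (\int[gg]_w _)%E e0 H cfin copt cs0 cg0 => e.
move: (cost gamma) (cost (swap_plan gamma)) e => [b| |] [c| |] [e| |]// e0 H _ bc c0 b0.
rewrite lee_fin in bc; rewrite lee_fin in e0; rewrite -EFinD => -[E].
have {}E : e = 0 by lra.
have [|N [mN N0 subN]] := H; first by rewrite E.
have mD := @measurable_decreasing R n.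
apply/eqP; rewrite eq_le measure_ge0 andbT -N0; apply: le_measure; rewrite ?inE//.
move=> w /= wD; apply: subN => /= g0; move: g0; rewrite /gain wD => /eqP.
by rewrite oppr_eq0 => /eqP w0; move: wD; rewrite w0 ltxx.
Qed.

End swap_cost.

Section null_unions.
Context d (T : measurableType d) (R : realType) (P : probability T R).

Lemma pr_bigcup0 (F : nat -> set T) : (forall k, measurable (F k)) ->
  (forall k, pr P (F k) = 0) -> pr P (\bigcup_k F k) = 0.
Proof.
move=> mF F0; have mU : measurable (\bigcup_k F k) by exact: bigcupT_measurable.
apply/eqP; rewrite eq_le pr_ge0 andbT -lee_fin -prE//.
apply: (@le_trans _ _ (\sum_(i <oo) P (F i))%E).
  exact: measure_sigma_subadditive.
by rewrite eseries0// => i _ _; rewrite prE// F0.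
Qed.

Lemma pr_bigcup0_count (I : countType) (F : I -> set T) :
  (forall i, measurable (F i)) -> (forall i, pr P (F i) = 0) ->
  pr P (\bigcup_i F i) = 0.
Proof.
move=> mF F0; rewrite (_ : \bigcup_i F i = \bigcup_k oapp F set0 (unpickle k)).
  by apply: pr_bigcup0 => k; case: (unpickle k) => [i|] //=; rewrite pr0.
apply/seteqP; split => x [i _ Fx]; first by exists (pickle i) => //; rewrite pickleK.
by move: Fx; case: (unpickle i) => //= j Fx; exists j.
Qed.

Lemma pr_sub0 (A B : set T) : measurable A -> measurable B -> A `<=` B ->
  pr P B = 0 -> pr P A = 0.
Proof.
by move=> mA mB AB B0; apply/eqP; rewrite eq_le pr_ge0 andbT -B0 le_pr.
Qed.

Lemma pr_setU0 (A B : set T) : measurable A -> measurable B ->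
  pr P A = 0 -> pr P B = 0 -> pr P (A `|` B) = 0.
Proof.
move=> mA mB A0 B0; apply/eqP; rewrite eq_le pr_ge0 andbT.
by rewrite (le_trans (prU_le P mA mB))// A0 B0 addr0.
Qed.

End null_unions.

Lemma measurable_halfspace (R : realType) n (i : 'I_n) (a : R) :
  measurable [set y : 'rV[R]_n | a <= y ord0 i].
Proof.
rewrite (_ : [set y | _] = (fun x : 'rV[R]_n => x ord0 i) @^-1` `[a, +oo[).
  rewrite -[X in measurable X]setTI.
  have mc : measurable_fun setT (fun x : 'rV[R]_n => x ord0 i).
    exact: measurable_rV_coord.
  exact: mc.
by apply/seteqP; split => y /=; rewrite in_itv/= andbT.
Qed.

(** * Rigidity of monotone plans *)

Section monotone_plan.
Context (R : realType) (n : nat).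
Local Notation X := 'rV[R]_n.
Variable gamma : probability (X * X)%type R.
Local Notation gg := (gamma \x gamma)%E.
Hypothesis mono : gg [set w | monotony w < 0] = 0%E.
Hypothesis ac : marginal1 gamma `<< lebesgue_rV R n.

(* A measurable substitute for the support of the measure [gamma (_ `*` E)]. *)
Definition fiber_support (E : set X) : set X :=
  [set x | forall k, 0 < pr gamma ((cell k @^-1` [set cell k x]) `*` E)].

(** The complement is the union of the null cells of all scales. There are countably many, which
    yields both measurability and [fiber_support_null]. *)
Lemma fiber_supportC (E : set X) : ~` fiber_support E =
  \bigcup_(p : {k : nat & {ffun 'I_n -> 'I_(cell_size k)}})
    [set x | cell (tag p) x = tagged p /\
             pr gamma ((cell (tag p) @^-1` [set tagged p]) `*` E) = 0].
Proof.
apply/seteqP; split => x /=.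
  move=> /existsNP[k /negP]; rewrite -leNgt => px.
  exists (Tagged (fun k => {ffun 'I_n -> 'I_(cell_size k)}) (cell k x)) => //=.
  by split => //; apply/eqP; rewrite eq_le px pr_ge0.
move=> [[k t] _ /= [xt t0]] xE; have := xE k.
by rewrite xt t0 ltxx.
Qed.

Lemma measurable_fiber_support E : measurable (fiber_support E).
Proof.
rewrite -[fiber_support E]setCK fiber_supportC; apply: measurableC.
apply: countable_bigcupT_measurable => [|[k t] /=]; first exact: countableP.
have [t0|t0] := pselect (pr gamma ((cell k @^-1` [set t]) `*` E) = 0).
  by rewrite (_ : [set x | _] = cell k @^-1` [set t]); [exact: measurable_cell|
    apply/seteqP; split => x //= -[]].
by rewrite (_ : [set x | _] = set0)//; apply/seteqP; split => x //= -[].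
Qed.

Lemma fiber_support_null E : measurable E ->
  pr gamma (~` fiber_support E `*` E) = 0.
Proof.
move=> mE; rewrite fiber_supportC setX_bigcupl.
apply: pr_bigcup0_count => -[k t] /=.
  have [t0|t0] := pselect (pr gamma ((cell k @^-1` [set t]) `*` E) = 0).
    apply: measurableX => //; rewrite (_ : [set x | _] = cell k @^-1` [set t]).
      exact: measurable_cell.
    by apply/seteqP; split => x //= -[].
  rewrite (_ : [set x | _] = set0) ?set0X//.
  by apply/seteqP; split => x //= -[].
have [t0|t0] := pselect (pr gamma ((cell k @^-1` [set t]) `*` E) = 0).
  rewrite -[RHS]t0; congr pr; congr (_ `*` _).
  by apply/seteqP; split => x //= -[].
rewrite (_ : [set x | _] = set0) ?set0X ?pr0//.
by apply/seteqP; split => x //= -[].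
Qed.

Section split.
Variables (i : 'I_n) (q : R).

(** The boxes bound the terms of [monotony] in the other coordinates, and the gap 1/(K+1) in [low]
    keeps the difference of the i-th coordinates of the targets away from 0. *)
Let box K : set X := [set y : X | forall j, y ord0 j \in `[- K%:R, K%:R]].
Let up K : set X := [set y : X | q <= y ord0 i] `&` box K.
Let low K : set X := [set y : X | y ord0 i <= q - K.+1%:R^-1] `&` box K.

Let mcoord : measurable_fun setT (fun x : X => x ord0 i).
Proof. exact: measurable_rV_coord. Qed.

Let mge a : measurable [set y : X | a <= y ord0 i].
Proof. exact: measurable_halfspace. Qed.

Let mle a : measurable [set y : X | y ord0 i <= a].
Proof. exact: (measurable_le_const _ mcoord). Qed.

Let mup K : measurable (up K).
Proof. by apply: measurableI => //; exact: measurable_rV_box. Qed.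

Let mlow K : measurable (low K).
Proof. by apply: measurableI => //; exact: measurable_rV_box. Qed.

(* Otherwise gamma would charge neighbourhoods of (x, y) and (x', y') with y_i
   above y'_i, on which the i-th term of [monotony] is negative and dominates. *)
Lemma monotone_fibers K K' (x x' : X) :
  fiber_support (up K) x -> fiber_support (low K') x' ->
  (forall j, j != i -> x ord0 j = x' ord0 j) -> x' ord0 i <= x ord0 i.
Proof.
move=> Ax Bx xx'; rewrite leNgt; apply/negP => xi.
pose tau := x' ord0 i - x ord0 i; have tau0 : 0 < tau by rewrite subr_gt0.
pose theta : R := K'.+1%:R^-1; have theta0 : 0 < theta by rewrite invr_gt0.
(* With cells of side eta < tau / 4, the i-th term is at most - tau theta / 2 and the others add up
   to at most 2 eta (M - 1); eta < tau theta / (4 M) makes the sum negative. *)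
pose M : R := n%:R * (K%:R + K'%:R) + 1.
have M0 : 0 < M by rewrite ltr_wpDl// mulr_ge0// addr_ge0.
have e10 : 0 < tau / 4 by rewrite divr_gt0.
have e20 : 0 < tau * theta / (4 * M) by rewrite divr_gt0 ?mulr_gt0.
pose N : R := \sum_(j < n) (`|x ord0 j| + `|x' ord0 j|).
have [k [Nk k1 k2]] : exists k : nat, [/\ N + 1 < k%:R :> R, k.+1%:R^-1 < tau / 4 &
    k.+1%:R^-1 < tau * theta / (4 * M)].
  have : \forall k \near \oo, [/\ N + 1 < k%:R :> R, k.+1%:R^-1 < tau / 4 &
    k.+1%:R^-1 < tau * theta / (4 * M)].
    near=> k; split.
    - by near: k; exact: nbhs_infty_gtr.
    - by near: k; exact: near_infty_natSinv_lt (PosNum e10).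
    - by near: k; exact: near_infty_natSinv_lt (PosNum e20).
  exact: filter_ex.
have Nj j : `|x ord0 j| + `|x' ord0 j| <= N.
  by rewrite /N (bigD1 j)//= lerDl sumr_ge0// => l _; rewrite addr_ge0.
have xk j : `|x ord0 j| + 1 < k%:R by have := Nj j; have := normr_ge0 (x' ord0 j); lra.
have xk' j : `|x' ord0 j| + 1 < k%:R by have := Nj j; have := normr_ge0 (x ord0 j); lra.
pose E : set (X * X) := (@cell R n k @^-1` [set cell k x]) `*` up K.
pose E' : set (X * X) := (@cell R n k @^-1` [set cell k x']) `*` low K'.
have mE : measurable E by apply: measurableX => //; exact: measurable_cell.
have mE' : measurable E' by apply: measurableX => //; exact: measurable_cell.
have : (0 < gg (E `*` E'))%E.
  rewrite product_measure1E//; apply: mule_gt0.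
    have := Ax k; rewrite -lte_fin => /lt_le_trans; apply.
    by have := prE gamma mE => <-.
  have := Bx k; rewrite -lte_fin => /lt_le_trans; apply.
  by have := prE gamma mE' => <-.
apply/negP; rewrite -leNgt -mono; apply: le_measure; rewrite ?inE//.
- exact: measurableX.
- exact: measurable_decreasing.
move=> [[a b] [a' b']] [[/= ca [bq bK]] [/= ca' [bq' bK']]] /=.
rewrite /monotony/= (bigD1 i)//=; set eta := k.+1%:R^-1 in k1 k2.
have eta0 : 0 < eta by rewrite invr_gt0.
have ax := cell_close xk ca; have ax' := cell_close xk' ca'.
have h1 : a ord0 i - a' ord0 i <= - (tau / 2).
  have := ax i; have := ax' i; rewrite -/eta !ltr_norml => /andP[u1 u2] /andP[u3 u4].
  rewrite /tau in k1 *; lra.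
have h2 : theta <= b ord0 i - b' ord0 i by rewrite /= in bq bq'; rewrite -/theta in bq'; lra.
have h3 : (a ord0 i - a' ord0 i) * (b ord0 i - b' ord0 i) <= - (tau / 2) * theta.
  by nra.
have h4 : \sum_(j < n | j != i) (a ord0 j - a' ord0 j) * (b ord0 j - b' ord0 j) <=
    \sum_(j < n) 2 * eta * (K%:R + K'%:R).
  rewrite [leRHS](bigID (fun j => j != i))/= ler_wpDr//.
    by apply: sumr_ge0 => j _; rewrite !mulr_ge0 ?addr_ge0// ltW.
  apply: ler_sum => j ji; apply: le_trans (ler_norm _) _; rewrite normrM.
  apply: ler_pM => //.
    have := ax j; have := ax' j; rewrite -/eta (xx' _ ji) !ltr_norml => /andP[u1 u2] /andP[u3 u4].
    by rewrite ler_norml; apply/andP; split; lra.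
  have := bK j; have := bK' j; rewrite !in_itv/= => /andP[u1 u2] /andP[u3 u4].
  by rewrite ler_norml; apply/andP; split; lra.
rewrite sumr_const card_ord -[X in _ <= X]mulr_natl in h4.
have h5 : eta * (4 * M) < tau * theta by rewrite -ltr_pdivlMr ?mulr_gt0.
have h6 : n%:R * (2 * eta * (K%:R + K'%:R)) = 2 * eta * (M - 1) by rewrite /M; ring.
rewrite h6 in h4; have tt : 0 < tau * theta by rewrite mulr_gt0.
by nra.
Unshelve. all: by end_near. Qed.

Let A := \bigcup_K fiber_support (up K).
Let B := \bigcup_K fiber_support (low K).

(** [A] holds the x that can be sent to y_i >= q, [B] those that can be sent below q. For two points
    of both sets differing only in coordinate i, [monotone_fibers] applies in both directions, so
    the intersection is thin, hence null. *)
Lemma monotone_split_halfspace : exists S, [/\ measurable S,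
  pr gamma (~` S `*` [set y : X | q <= y ord0 i]) = 0 &
  pr gamma (S `*` ~` [set y : X | q <= y ord0 i]) = 0].
Proof.
have mA : measurable A by apply: bigcupT_measurable => K; exact: measurable_fiber_support.
have mB : measurable B by apply: bigcupT_measurable => K; exact: measurable_fiber_support.
have AB0 : pr gamma ((A `&` B) `*` setT) = 0.
  have : marginal1 gamma (A `&` B) = 0%E.
    move/null_content_dominatesP : ac; apply; first exact: measurableI.
    apply: (@lebesgue_rV_thin _ _ i); first exact: measurableI.
    move=> x y [[K _ Ax] [K' _ Bx]] [[L _ Ay] [L' _ By]] xy; apply/eqP.
    rewrite eq_le (monotone_fibers Ay Bx) ?(monotone_fibers Ax By)// => j ji.
    by rewrite xy.
  rewrite setXT; exact: (congr1 fine).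
have mge' : measurable (~` [set y : X | q <= y ord0 i]) by exact: measurableC.
exists (A `\` B); split; first exact: measurableD.
  have mU : measurable (\bigcup_K (~` fiber_support (up K) `*` up K)).
    apply: bigcupT_measurable => K; apply: measurableX => //.
    by apply: measurableC; exact: measurable_fiber_support.
  have mAB : measurable ((A `&` B) `*` [set: X]).
    by apply: measurableX => //; exact: measurableI.
  apply: (@pr_sub0 _ _ _ gamma _
    ((\bigcup_K (~` fiber_support (up K) `*` up K)) `|` ((A `&` B) `*` setT))).
  - by apply: measurableX => //; apply: measurableC; exact: measurableD.
  - exact: measurableU.
  - move=> [x y] [/= nS yq]; have [Ax|nAx] := pselect (A x).
      right; split => //; split => //; apply: contrapT => nBx; exact: nS.
    left; have [K yK] := rV_box_bigcup y; exists K => //; split => //= Ux.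
    by apply: nAx; exists K.
  apply: pr_setU0 => //; apply: pr_bigcup0 => K.
    by apply: measurableX => //; apply: measurableC; exact: measurable_fiber_support.
  exact: fiber_support_null.
have mU : measurable (\bigcup_K (~` fiber_support (low K) `*` low K)).
  apply: bigcupT_measurable => K; apply: measurableX => //.
  by apply: measurableC; exact: measurable_fiber_support.
apply: (@pr_sub0 _ _ _ gamma _ (\bigcup_K (~` fiber_support (low K) `*` low K))) => //.
- by apply: measurableX => //; exact: measurableD.
- move=> [x y] [/= [Ax nBx] /negP]; rewrite -ltNge => yq.
  have [k yk] := rV_box_bigcup y; have [l yl] := ltr_add_invr yq.
  exists (maxn k l) => //; split => /=; first by move=> Lx; apply: nBx; exists (maxn k l).
  split => [|j] /=.
    rewrite lerBrDr (le_trans _ (ltW yl))// lerD2l lef_pV2 ?posrE// ler_nat ltnS.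
    exact: leq_maxr.
  have := yk j; rewrite !in_itv/= => /andP[u1 u2].
  have kl : k%:R <= (maxn k l)%:R :> R by rewrite ler_nat leq_maxl.
  by apply/andP; split; lra.
apply: pr_bigcup0 => K; last exact: fiber_support_null.
by apply: measurableX => //; apply: measurableC; exact: measurable_fiber_support.
Qed.

End split.

(* Almost surely, y belongs to B if and only if x belongs to S. *)
Lemma monotone_split (B : set X) : measurable B -> exists S, [/\ measurable S,
  pr gamma (~` S `*` B) = 0 & pr gamma (S `*` ~` B) = 0].
Proof.
(* Measurability is carried along because the union step needs it for each [F k]. *)
move=> mB; suff [] : measurable B /\ exists S, [/\ measurable S,
  pr gamma (~` S `*` B) = 0 & pr gamma (S `*` ~` B) = 0] by [].
move: B mB; apply: (measurable_rV_ind (G := fun B => measurable B /\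
    exists S, [/\ measurable S,
  pr gamma (~` S `*` B) = 0 & pr gamma (S `*` ~` B) = 0])).
- by split => //; exists set0; split; rewrite ?setX0 ?set0X ?pr0.
- move=> B [mB [S [mS S1 S2]]]; split; first exact: measurableC.
  by exists (~` S); rewrite !setCK; split => //; exact: measurableC.
- move=> F HF; have mF k : measurable (F k) by have [] := HF k.
  have /choice[S HS] : forall k, exists S, [/\ measurable S,
    pr gamma (~` S `*` F k) = 0 & pr gamma (S `*` ~` F k) = 0] by move=> k; have [] := HF k.
  have mS k : measurable (S k) by have [] := HS k.
  have mUF : measurable (\bigcup_k F k) by exact: bigcupT_measurable.
  have mUS : measurable (\bigcup_k S k) by exact: bigcupT_measurable.
  split => //; exists (\bigcup_k S k); split => //.
    have mk k : measurable (~` S k `*` F k).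
      by apply: measurableX => //; exact: measurableC.
    apply: (@pr_sub0 _ _ _ gamma _ (\bigcup_k (~` S k `*` F k))).
    - by apply: measurableX => //; exact: measurableC.
    - exact: bigcupT_measurable.
    - by move=> [x y] [/= nS [k _ Fy]]; exists k => //; split => //= Sx; apply: nS; exists k.
    - by apply: pr_bigcup0 => // k; have [] := HS k.
  have mk k : measurable (S k `*` ~` F k).
    by apply: measurableX => //; exact: measurableC.
  apply: (@pr_sub0 _ _ _ gamma _ (\bigcup_k (S k `*` ~` F k))).
  - by apply: measurableX => //; exact: measurableC.
  - exact: bigcupT_measurable.
  - by move=> [x y] [/= [k _ Sx] nF]; exists k => //; split => //= Fy; apply: nF; exists k.
  - by apply: pr_bigcup0 => // k; have [] := HS k.
- move=> i q; split; last exact: monotone_split_halfspace.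
  exact: measurable_halfspace.
Qed.

End monotone_plan.

Lemma rectangle_measure_eq d1 d2 (T1 : measurableType d1) (T2 : measurableType d2)
    (R : realType) (P Q : probability (T1 * T2)%type R) :
  (forall A B, measurable A -> measurable B -> P (A `*` B) = Q (A `*` B)) ->
  measure_eq P Q.
Proof.
move=> PQ D mD.
apply: (measure_unique [set A `*` B | A in measurable & B in measurable] (fun=> setT)) => //.
- exact: measurable_prod_measurableType.
- move=> _ _ [A mA [B mB <-]] [C mC [E mE <-]]; exists (A `&` C); first exact: measurableI.
  by exists (B `&` E); [exact: measurableI|rewrite setXI].
- by move=> _; exists setT => //; exists setT => //; rewrite setXTT.
- by rewrite bigcup_const.
- by move=> _ [A mA [B mB <-]]; exact: PQ.
- by move=> _; apply: le_lt_trans (probability_le1 P measurableT) _; exact: ltry.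
Qed.

(** Monotonicity of each plan separately would give two unrelated sets S. A set that is null for the
    average is null for both plans, so the average gives a common S. *)
Lemma monotone_plan_unique (R : realType) (n : nat)
    (g1 g2 : probability ('rV[R]_n * 'rV[R]_n)%type R) :
  measure_eq (marginal1 g1) (marginal1 g2) ->
  marginal1 g1 `<< lebesgue_rV R n ->
  (average g1 g2 \x average g1 g2)%E [set w | monotony w < 0] = 0%E ->
  measure_eq g1 g2.
Proof.
move=> g12 ac mono.
have acm : marginal1 (average g1 g2) `<< lebesgue_rV R n.
  move/null_content_dominatesP : ac => ac; apply/null_content_dominatesP => A mA A0.
  apply: etrans (averageE g1 g2 (fst @^-1` A)) _.
  have h1 : g1 (fst @^-1` A) = 0%E by exact: (ac A mA A0).
  have h2 : g2 (fst @^-1` A) = 0%E by rewrite -[RHS]h1; apply/esym; exact: (g12 A mA).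
  by rewrite h1 h2 adde0 mule0.
apply: rectangle_measure_eq => A B mA mB.
have [S [mS S1 S2]] := monotone_split mono acm mB.
have mX (C D : set 'rV[R]_n) : measurable C -> measurable D -> measurable (C `*` D).
  by move=> *; exact: measurableX.
have mSc : measurable (~` S) by exact: measurableC.
have mBc : measurable (~` B) by exact: measurableC.
have mAS : measurable (A `&` S) by exact: measurableI.
have both (C : set ('rV[R]_n * 'rV[R]_n)) : measurable C -> pr (average g1 g2) C = 0 ->
    pr g1 C = 0 /\ pr g2 C = 0.
  move=> mC; rewrite pr_average//; have := pr_ge0 g1 C; have := pr_ge0 g2 C; lra.
have [s1 s1'] := both _ (mX _ _ mSc mB) S1; have [s2 s2'] := both _ (mX _ _ mS mBc) S2.
(* As y lies in B exactly when x lies in S, up to null sets, the mass of A x B is read off the first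
   marginal. *)
have key (g : probability ('rV[R]_n * 'rV[R]_n)%type R) : pr g (~` S `*` B) = 0 ->
    pr g (S `*` ~` B) = 0 -> pr g (A `*` B) = pr g ((A `&` S) `*` setT).
  move=> h1 h2; rewrite (@prID _ _ _ g _ (S `*` setT)); [|exact: mX|exact: mX].
  rewrite [X in _ + X](_ : _ = 0) ?addr0; last first.
    apply: (pr_sub0 _ _ _ h1); [by apply: measurableD; exact: mX|exact: mX|].
    by move=> [x y] [[/= Ax By] nS]; split => //= Sx; exact: nS.
  rewrite [RHS](@prID _ _ _ g _ (setT `*` B)); [|exact: mX|exact: mX].
  rewrite [X in _ = _ + X](_ : _ = 0) ?addr0; last first.
    apply: (pr_sub0 _ _ _ h2); [by apply: measurableD; exact: mX|exact: mX|].
    by move=> [x y] [[/= [Ax Sx] _] nB]; split => //= By; exact: nB.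
  congr pr; apply/seteqP; split => -[x y] /=; tauto.
rewrite !prE; [|exact: mX|exact: mX]; congr EFin.
rewrite (key g1)// (key g2)// setXT /pr; congr fine; exact: (g12 _ mAS).
Qed.

(** * Existence and uniqueness of minimizers *)

Section ultrafilter_lsc.
Context (R : realType) (T : Type) (U : set_system nat) {UU : UltraFilter U}.
Variables (x_ : nat -> T) (x : T).

(** Lower semicontinuity in sublevel form, with real levels only. *)
Definition lsc_along (J : T -> \bar R) := forall L : R,
  (\forall k \near U, (J (x_ k) <= L%:E)%E) -> (J x <= L%:E)%E.

Let lsc_lim (J : T -> \bar R) (a : R) : lsc_along J ->
  (forall t, (0 <= J t)%E) -> (\forall k \near U, J (x_ k) \is a fin_num) ->
  fine (J (x_ k)) @[k --> U] --> a -> (J x <= a%:E)%E.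
Proof.
move=> lscJ J0 fJ Ja; apply/lee_addgt0Pr => e e0; rewrite -EFinD; apply: lscJ.
have ae : a < a + e by rewrite ltrDl.
apply: filterS2 fJ (cvgr_lt _ Ja _ ae) => k fk ltk.
by rewrite -(fineK fk) lee_fin ltW.
Qed.

(** A bound on the sum does not bound each term sharply, but along an ultrafilter both bounded terms
    converge, and their limits are admissible levels. *)
Lemma lsc_along_add (J1 J2 : T -> \bar R) :
  (forall t, (0 <= J1 t)%E) -> (forall t, (0 <= J2 t)%E) ->
  lsc_along J1 -> lsc_along J2 -> lsc_along (fun t => J1 t + J2 t)%E.
Proof.
move=> J10 J20 lsc1 lsc2 L JL.
have f1 : \forall k \near U, J1 (x_ k) \is a fin_num /\ J2 (x_ k) \is a fin_num.
  apply: filterS JL => k kL; rewrite !ge0_fin_numE//; split.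
    by apply: le_lt_trans (ltry L); apply: le_trans kL; rewrite leeDl.
  by apply: le_lt_trans (ltry L); apply: le_trans kL; rewrite leeDr.
have fL : \forall k \near U, fine (J1 (x_ k)) + fine (J2 (x_ k)) <= L.
  apply: filterS2 f1 JL => k [k1 k2] kL.
  by rewrite -lee_fin EFinD !fineK.
have [|a ua] := @ultra_bounded_cvg R U UU (fun k => fine (J1 (x_ k))) 0 L.
  apply: filterS fL => k kL; rewrite fine_ge0//= (le_trans _ kL)// lerDl.
  by rewrite fine_ge0.
have [|b ub] := @ultra_bounded_cvg R U UU (fun k => fine (J2 (x_ k))) 0 L.
  apply: filterS fL => k kL; rewrite fine_ge0//= (le_trans _ kL)// lerDr.
  by rewrite fine_ge0.
have abL : a + b <= L by apply: (cvgr_to_le (cvgD ua ub)).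
apply: (@le_trans _ _ (a%:E + b%:E)%E); last by rewrite -EFinD lee_fin.
apply: leeD; apply: lsc_lim => //.
- by apply: filterS f1 => k [].
- by apply: filterS f1 => k [].
Qed.

Lemma lsc_along_scale (J : T -> \bar R) (c : R) : 0 < c ->
  lsc_along J -> lsc_along (fun t => c%:E * J t)%E.
Proof.
move=> c0 lscJ L JL.
have : (J x <= (L / c)%:E)%E.
  apply: lscJ; apply: filterS JL => k.
  by rewrite muleC -lee_pdivlMr// EFinM.
by rewrite muleC -lee_pdivlMr// EFinM.
Qed.

End ultrafilter_lsc.

Lemma minimizer_exists (R : realType) (T : Type) (C : set T) (J : T -> \bar R) x0 :
  C x0 -> (J x0 < +oo)%E -> (forall t, (0 <= J t)%E) ->
  (forall (U : set_system nat) (UU : UltraFilter U) (x_ : nat -> T) (B : R),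
    (forall k, C (x_ k)) -> (forall k, (J (x_ k) <= B%:E)%E) ->
    exists2 x, C x & lsc_along U x_ x J) ->
  exists2 x, C x & forall y, C y -> (J x <= J y)%E.
Proof.
move=> Cx0 Jx0 J0 lscJ; pose I := ereal_inf (J @` C).
have I0 : (0 <= I)%E by apply: le_ereal_inf_tmp => _ [x _ <-].
have Ix0 : (I <= J x0)%E by apply: ereal_inf_lbound; exists x0.
have Ifin : I \is a fin_num by rewrite ge0_fin_numE// (le_lt_trans Ix0).
have /choice[x_ Hx] : forall k : nat, exists x, C x /\ (J x <= (fine I + k.+1%:R^-1)%:E)%E.
  move=> k; have k0 : 0 < k.+1%:R^-1 :> R by rewrite invr_gt0.
  have [_ [x Cx <-] Jx] := lb_ereal_inf_adherent k0 Ifin.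
  by exists x; split => //; rewrite EFinD fineK// ltW.
have [U [UU ooU]] := @ultraFilterLemma nat \oo _.
have [||x Cx lscx] := lscJ U UU x_ (fine I + 1).
- by move=> k; have [] := Hx k.
- move=> k; have [_ /le_trans] := Hx k; apply; rewrite lee_fin lerD2l.
  by rewrite invf_le1// ler1n.
exists x => // y Cy; apply: (@le_trans _ _ I); last by apply: ereal_inf_lbound; exists y.
rewrite -(fineK Ifin); apply/lee_addgt0Pr => e e0; rewrite -EFinD; apply: lscx.
apply: ooU; near=> k; have [_ /le_trans] := Hx k; apply.
rewrite lee_fin lerD2l ltW//; near: k; exact: near_infty_natSinv_lt (PosNum e0).
Unshelve. all: by end_near. Qed.

Lemma cvg_constant (R : realType) (U : set_system nat) {UF : ProperFilter U}
    (u : nat -> R) (a b : R) :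
  (forall k, u k = a) -> u k @[k --> U] --> b -> b = a.
Proof.
move=> ua; have -> : u = cst a by apply/funext.
by move=> ub; apply: (cvg_unique (@Rhausdorff R) ub); exact: cvg_cst.
Qed.

Section plans.
Context (R : realType) (n : nat).
Local Notation X := 'rV[R]_n.
Implicit Types (mu nu : probability X R) (g gamma : probability (X * X)%type R).

Lemma pr_marginal1 gamma A : pr (marginal1 gamma) A = pr gamma (A `*` setT).
Proof. by rewrite setXT. Qed.

Lemma pr_marginal2 gamma A : pr (marginal2 gamma) A = pr gamma (setT `*` A).
Proof. by rewrite setTX. Qed.

Lemma pr_measure_eq d (T : measurableType d) (P Q : probability T R) :
  (forall A, measurable A -> pr P A = pr Q A) <-> measure_eq P Q.
Proof.
split=> PQ A mA; last by rewrite /pr; congr fine; exact: PQ.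
by apply: etrans (prE P mA) (etrans _ (esym (prE Q mA))); rewrite PQ.
Qed.

Lemma measure_eq_sym d (T : measurableType d) (P Q : probability T R) :
  measure_eq P Q -> measure_eq Q P.
Proof. by move=> PQ A mA; rewrite (PQ A mA). Qed.

Lemma measure_eq_trans d (T : measurableType d) (P Q S : probability T R) :
  measure_eq P Q -> measure_eq Q S -> measure_eq P S.
Proof. by move=> PQ QS A mA; rewrite (PQ A mA) (QS A mA). Qed.

Lemma continuous_coord1 i : continuous (fun z : X * X => z.1 ord0 i).
Proof.
move=> z; apply: (@continuous_comp _ _ _ fst (fun x : X => x ord0 i)).
  exact: cvg_fst.
exact: coord_continuous.
Qed.

Lemma continuous_coord2 i : continuous (fun z : X * X => z.2 ord0 i).
Proof.
move=> z; apply: (@continuous_comp _ _ _ snd (fun x : X => x ord0 i)).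
  exact: cvg_snd.
exact: coord_continuous.
Qed.

Lemma continuous_cost : continuous (fun z : X * X => sqnorm (z.1 - z.2)).
Proof.
move=> z; rewrite /sqnorm; apply: cvg_bigsum => i.
under eq_fun do rewrite !mxE; rewrite !mxE.
by apply: cvgM; (apply: cvgB; [exact: continuous_coord1|exact: continuous_coord2]).
Qed.

Lemma cost_ge0 gamma : (0 <= cost gamma)%E.
Proof. by apply: integral_nonneg => z; exact: sqnorm_ge0. Qed.

Lemma measurable_cost : measurable_fun setT (fun z : X * X => sqnorm (z.1 - z.2)).
Proof. by apply: measurable_sqnormB; [exact: measurable_fst|exact: measurable_snd]. Qed.

Lemma integral_marginal1 gamma mu (f : X -> R) : measure_eq (marginal1 gamma) mu ->
  measurable_fun setT f -> (forall x, 0 <= f x) ->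
  (\int[gamma]_z (f z.1)%:E = \int[mu]_x (f x)%:E)%E.
Proof.
move=> gmu mf f0; transitivity (\int[marginal1 gamma]_x (f x)%:E)%E.
  rewrite ge0_integral_distribution//; first exact/measurable_EFinP.
by apply: eq_measure_integral => A mA _; exact: gmu.
Qed.

Lemma integral_marginal2 gamma nu (f : X -> R) : measure_eq (marginal2 gamma) nu ->
  measurable_fun setT f -> (forall x, 0 <= f x) ->
  (\int[gamma]_z (f z.2)%:E = \int[nu]_x (f x)%:E)%E.
Proof.
move=> gnu mf f0; transitivity (\int[marginal2 gamma]_x (f x)%:E)%E.
  rewrite ge0_integral_distribution//; first exact/measurable_EFinP.
by apply: eq_measure_integral => A mA _; exact: gnu.
Qed.

Let msq : measurable_fun setT (@sqnorm R n).
Proof. by apply: (@measurable_sqnorm R n _ X id). Qed.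

Lemma coupling_second_moment mu nu gamma : P2 mu -> P2 nu -> couplings mu nu gamma ->
  finite_second_moment gamma.
Proof.
move=> [_ M1] [_ M2] [g1 g2]; rewrite /finite_second_moment.
have m1 : measurable_fun setT (fun z : X * X => sqnorm z.1).
  by apply: measurable_sqnorm; exact: measurable_fst.
have m2 : measurable_fun setT (fun z : X * X => sqnorm z.2).
  by apply: measurable_sqnorm; exact: measurable_snd.
rewrite integral_add//; [|by move=> z; exact: sqnorm_ge0..].
rewrite (integral_marginal1 g1)//; last by move=> z; exact: sqnorm_ge0.
rewrite (integral_marginal2 g2)//; last by move=> z; exact: sqnorm_ge0.
exact: lte_add_pinfty.
Qed.

Lemma sqnormB_le (x y : X) : sqnorm (x - y) <= 2 * (sqnorm x + sqnorm y).
Proof.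
rewrite /sqnorm -big_split mulr_sumr /=; apply: ler_sum => i _; rewrite !mxE.
by have := sqr_ge0 (x ord0 i + y ord0 i); nra.
Qed.

Lemma second_moment_cost gamma : finite_second_moment gamma -> (cost gamma < +oo)%E.
Proof.
move=> gfin; have m1 : measurable_fun setT (fun z : X * X => sqnorm z.1).
  by apply: measurable_sqnorm; exact: measurable_fst.
have m2 : measurable_fun setT (fun z : X * X => sqnorm z.2).
  by apply: measurable_sqnorm; exact: measurable_snd.
apply: (@le_lt_trans _ _ (\int[gamma]_z (2 * (sqnorm z.1 + sqnorm z.2))%:E)%E).
  apply: integral_le.
  - exact: measurable_cost.
  - by apply: measurable_funM => //; exact: measurable_funD.
  - by move=> z; exact: sqnorm_ge0.
  - by move=> z; exact: sqnormB_le.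
rewrite integral_scale//; [|exact: measurable_funD|by move=> z; rewrite addr_ge0// sqnorm_ge0].
by rewrite lte_mul_pinfty// lee_fin.
Qed.

Lemma product_coupling mu nu : couplings mu nu (mu \x nu)%E.
Proof.
split=> A mA.
  apply: (@etrans _ _ ((mu \x nu)%E (A `*` setT))).
    by rewrite setXT.
  rewrite product_measure1E//; apply: etrans (mule1 _).
  by congr (_ * _)%E; exact: probability_setT.
apply: (@etrans _ _ ((mu \x nu)%E (setT `*` A))).
  by rewrite setTX.
rewrite product_measure1E//; apply: etrans (mul1e _).
by congr (_ * _)%E; exact: probability_setT.
Qed.

Definition rectangle_cvg (U : set_system nat)
    (s_ : nat -> probability (X * X)%type R) gamma :=
  forall A B, measurable A -> measurable B ->
    pr (s_ k) (A `*` B) @[k --> U] --> pr gamma (A `*` B).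

Lemma rectangle_cvg_marginal1 U s_ gamma : rectangle_cvg U s_ gamma ->
  forall A, measurable A ->
    pr (marginal1 (s_ k)) A @[k --> U] --> pr (marginal1 gamma) A.
Proof.
move=> gg A mA; rewrite pr_marginal1; under eq_fun do rewrite pr_marginal1.
exact: gg.
Qed.

Lemma rectangle_cvg_marginal2 U s_ gamma : rectangle_cvg U s_ gamma ->
  forall A, measurable A ->
    pr (marginal2 (s_ k)) A @[k --> U] --> pr (marginal2 gamma) A.
Proof.
move=> gg A mA; rewrite pr_marginal2; under eq_fun do rewrite pr_marginal2.
exact: gg.
Qed.

Lemma plans_compact (U : set_system nat) {UU : UltraFilter U}
    (s_ : nat -> probability (X * X)%type R) mu nu (C : R) :
  (forall k, (KL (marginal1 (s_ k)) mu <= C%:E)%E) ->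
  (forall k, (KL (marginal2 (s_ k)) nu <= C%:E)%E) ->
  exists gamma, rectangle_cvg U s_ gamma.
Proof.
move=> K1 K2; apply: (@limit_plan R n U UU mu nu s_) => e e0.
  have [delta d0 H] := uniformly_small K1 e0; exists delta => // A mA Ad k.
  by rewrite -pr_marginal1; exact: H.
have [delta d0 H] := uniformly_small K2 e0; exists delta => // A mA Ad k.
by rewrite -pr_marginal2; exact: H.
Qed.

Lemma cost_lsc (U : set_system nat) {UU : ProperFilter U} s_ gamma :
  rectangle_cvg U s_ gamma -> lsc_along U s_ gamma (@cost R n).
Proof.
move=> gg L HL; apply: (@lsc_integral _ _ U UU s_) => //.
- exact: continuous_cost.
- by move=> z; exact: sqnorm_ge0.
Qed.

Lemma transport_minimizer mu nu : P2 mu -> P2 nu ->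
  exists gamma, is_solution (couplings mu nu) (@cost R n) gamma.
Proof.
move=> P2mu P2nu; have pc := product_coupling mu nu.
have [||U UU s_ B Cg _|gamma Cgamma H] :=
    @minimizer_exists R _ (couplings mu nu) (@cost R n) _ pc.
- exact/second_moment_cost/(coupling_second_moment P2mu P2nu pc).
- exact: cost_ge0.
(* Couplings have zero entropy relative to their own marginals, so the entropy bound is 0. *)
- have [||gamma gg] := @plans_compact U UU s_ mu nu 0.
  + by move=> k; have [/KL_measure_eq -> _] := Cg k; rewrite KL_self.
  + by move=> k; have [_ /KL_measure_eq ->] := Cg k; rewrite KL_self.
  exists gamma; last exact: cost_lsc.
  split; apply/pr_measure_eq => A mA.
    apply: (cvg_constant _ (rectangle_cvg_marginal1 gg mA)) => k.
    by have [c1 _] := Cg k; exact: (proj2 (pr_measure_eq _ _) c1).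
  apply: (cvg_constant _ (rectangle_cvg_marginal2 gg mA)) => k.
  by have [_ c2] := Cg k; exact: (proj2 (pr_measure_eq _ _) c2).
by exists gamma.
Qed.

Lemma marginal1_average g1 g2 :
  measure_eq (marginal1 (average g1 g2)) (average (marginal1 g1) (marginal1 g2)).
Proof.
by move=> A mA; apply: etrans (averageE g1 g2 _) _; apply/esym; exact: averageE.
Qed.

Lemma marginal2_average g1 g2 :
  measure_eq (marginal2 (average g1 g2)) (average (marginal2 g1) (marginal2 g2)).
Proof.
by move=> A mA; apply: etrans (averageE g1 g2 _) _; apply/esym; exact: averageE.
Qed.

Lemma average_idem d (T : measurableType d) (P Q S : probability T R) :
  measure_eq P S -> measure_eq Q S -> measure_eq (average P Q) S.
Proof.
move=> /pr_measure_eq PS /pr_measure_eq QS; apply/pr_measure_eq => A mA.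
by rewrite pr_average// PS// QS//; lra.
Qed.

Lemma cost_average g1 g2 :
  (cost (average g1 g2) = (2^-1)%:E * (cost g1 + cost g2))%E.
Proof.
rewrite /cost integral_average//; first exact: measurable_cost.
by move=> z; exact: sqnorm_ge0.
Qed.

Lemma transport_unique mu nu g1 g2 : mu `<< lebesgue_rV R n ->
  (cost g1 < +oo)%E ->
  is_solution (couplings mu nu) (@cost R n) g1 ->
  is_solution (couplings mu nu) (@cost R n) g2 -> measure_eq g1 g2.
Proof.
move=> ac fin1 [[m11 m12] opt1] [[m21 m22] opt2].
have c12 : cost g1 = cost g2 by apply/eqP; rewrite eq_le opt1 ?opt2.
have cav : cost (average g1 g2) = cost g1.
  rewrite cost_average -c12; have := cost_ge0 g1; move: fin1.
  by case: (cost g1) => [r| |]// _ _; rewrite -EFinD -EFinM; congr EFin; lra.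
have m1 : measure_eq (marginal1 (average g1 g2)) mu.
  exact: measure_eq_trans (marginal1_average g1 g2) (average_idem m11 m21).
have m2 : measure_eq (marginal2 (average g1 g2)) nu.
  exact: measure_eq_trans (marginal2_average g1 g2) (average_idem m12 m22).
apply: monotone_plan_unique.
- exact: measure_eq_trans m11 (measure_eq_sym m21).
- exact: measure_eq_dominates (measure_eq_sym m11) ac.
- apply: optimal_monotone; rewrite cav//; apply: opt1; split.
    exact: measure_eq_trans (swap_plan1 _) m1.
  exact: measure_eq_trans (swap_plan2 _) m2.
Qed.

End plans.

(** * Conditioning, and the entropy saved by removing mass *)

Section conditioning.
Context d (T : measurableType d) (R : realType).
Variables (P : probability T R) (D : set T) (mD : measurable D).
Hypothesis D0 : 0 < pr P D.

Let c0 : 0 <= (pr P D)^-1. Proof. by rewrite invr_ge0 ltW. Qed.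

Definition conditioned : set T -> \bar R := mscale (NngNum c0) (mrestr P mD).

HB.instance Definition _ := Measure.on conditioned.

Lemma conditionedE A : conditioned A = ((pr P D)^-1%:E * P (A `&` D))%E.
Proof. by []. Qed.

Let conditioned_setT : conditioned setT = 1%E.
Proof.
by rewrite conditionedE setTI prE// -EFinM mulVf ?gt_eqF.
Qed.

HB.instance Definition _ := Measure_isProbability.Build _ _ _ conditioned conditioned_setT.

Lemma pr_conditioned A : measurable A ->
  pr conditioned A = (pr P D)^-1 * pr P (A `&` D).
Proof.
move=> mA; apply: EFin_inj; rewrite -prE//; apply: etrans (conditionedE A) _.
by rewrite prE//; exact: measurableI.
Qed.

End conditioning.

Section truncation.
Context d (T : measurableType d) (R : realType).
Implicit Types (P Q m : probability T R) (f : T -> R).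

(** With w = (1 - a) f', f ln f = u ln f + w ln f >= u ln M + w ln w, since f >= w, and f > M
    wherever u is nonzero. Terms are placed so that every summand is nonnegative and both sides can
    be integrated before KL P' m is known to be finite. *)
Lemma truncation_pointwise (a M f f' u : R) : 0 < a -> a < 1 -> 1 <= M ->
  0 <= f' -> 0 <= u -> f = u + (1 - a) * f' -> u = 0 \/ M < f ->
  (1 - a) * KL_fun f' + (ln M * u + a) <=
  KL_fun f + (u + (- ln (1 - a) * (1 - a)) * f').
Proof.
move=> a0 a1 M1 f'0 u0 fE uM; have a10 : 0 < 1 - a by rewrite subr_gt0.
have M0 : 0 < M by rewrite (lt_le_trans _ M1).
set w := (1 - a) * f' in fE.
have w0 : 0 <= w by rewrite mulr_ge0// ltW.
have E : w * ln f' = w * ln w - ln (1 - a) * w.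
  have [f0|f0] := eqVneq f' 0; first by rewrite /w f0 !mulr0 !mul0r; lra.
  have f'p : 0 < f' by rewrite lt_neqAle eq_sym f0.
  by rewrite /w lnM ?posrE//; ring.
have wf : w * ln w <= w * ln f.
  have [->|w_neq0] := eqVneq w 0; first by rewrite !mul0r.
  have wp : 0 < w by rewrite lt_neqAle eq_sym w_neq0.
  by rewrite ler_wpM2l// ler_ln ?posrE// fE; lra.
have uf : u * ln M <= u * ln f.
  case: uM => [->|Mf]; first by rewrite !mul0r.
  by rewrite ler_wpM2l// ler_ln ?posrE// ?ltW// (lt_trans M0).
have E2 : (1 - a) * KL_fun f' = w * ln f' - w + (1 - a) by rewrite /KL_fun /w; ring.
have E3 : (- ln (1 - a) * (1 - a)) * f' = - (ln (1 - a) * w) by rewrite /w; ring.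
have E4 : KL_fun f = u * ln f + w * ln f - u - w + 1 by rewrite /KL_fun {1 3}fE; ring.
rewrite E2 E3 E4 E (mulrC (ln M)); lra.
Qed.

(* [Q'] is the part of mass a removed from P; it lives where the density of P
   exceeds M, so that the removal saves a * ln M. *)
Lemma KL_truncate P P' Q' m f (a M k : R) : density P m f ->
  0 < a -> a < 1 -> 1 <= M ->
  (forall A, measurable A -> pr P A = a * pr Q' A + (1 - a) * pr P' A) ->
  pr Q' [set x | f x <= M] = 0 -> KL P m = k%:E ->
  (KL P' m <= ((k - a * ln M + a) / (1 - a))%:E)%E.
Proof.
move=> fd a0 a1 M1 PE Q'M Pk; have a10 : 0 < 1 - a by rewrite subr_gt0.
have [mf f0 Pf] := fd; have /null_content_dominatesP Pm := density_dominates fd.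
have dom A : measurable A -> m A = 0%E -> pr Q' A = 0 /\ pr P' A = 0.
  move=> mA A0; have : pr P A = 0 by rewrite /pr Pm.
  rewrite PE//; have := pr_ge0 Q' A; have := pr_ge0 P' A => p0 q0 E.
  have q1 : 0 <= a * pr Q' A by rewrite mulr_ge0// ltW.
  have p1 : 0 <= (1 - a) * pr P' A by rewrite mulr_ge0// ltW.
  split; apply/eqP.
    have /eqP : a * pr Q' A = 0 by lra.
    by rewrite mulf_eq0 gt_eqF.
  have /eqP : (1 - a) * pr P' A = 0 by lra.
  by rewrite mulf_eq0 gt_eqF.
have [v vd] : exists v, density Q' m v.
  apply: density_exists; apply/null_content_dominatesP => A mA A0.
  by rewrite prE// (dom A mA A0).1.
have [f' fd'] : exists v, density P' m v.
  apply: density_exists; apply/null_content_dominatesP => A mA A0.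
  by rewrite prE// (dom A mA A0).2.
have [mv v0 Qv] := vd; have [mf' f'0 Pf'] := fd'.
have fE : \forall x \ae m, f x = a * v x + (1 - a) * f' x.
  apply: (@density_unique _ _ _ P) => //.
  apply: measure_eq_density (density_mixture (ltW a0) (ltW a1) vd fd') => A mA.
  apply: etrans (prE _ mA) _; apply: etrans (esym (prE P mA)).
  by congr EFin; rewrite PE// pr_mixture.
have mfM : measurable [set x | f x <= M] by exact: measurable_le_const.
have vM : \forall x \ae m, f x <= M -> v x = 0.
  have m1 : measurable_fun setT (\1_[set x | f x <= M] : T -> R).
    exact: measurable_indic.
  have : (\int[m]_x (\1_[set x | f x <= M] x * v x)%:E = 0)%E.
    rewrite -(density_change vd m1)// integral_indic// setIT.
    by apply: etrans (prE Q' mfM) _; rewrite Q'M.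
  move/integral_eq0_ae => -/(_ _ _)/wrap[]; first exact: measurable_funM.
    by move=> x; rewrite mulr_ge0.
  apply: filterS => x + fM; rewrite indicE mem_set//= mul1r; exact.
pose L := - ln (1 - a).
have L0 : 0 <= L by rewrite oppr_ge0 ln_le0//; lra.
have lM0 : 0 <= ln M by exact: ln_ge0.
have mKf : measurable_fun setT (fun x => KL_fun (f x)).
  by apply: measurableT_comp => //; exact: measurable_KL_fun.
have mKf' : measurable_fun setT (fun x => KL_fun (f' x)).
  by apply: measurableT_comp => //; exact: measurable_KL_fun.
have mu : measurable_fun setT (fun x => a * v x) by exact: measurable_funM.
have u0 x : 0 <= a * v x by rewrite mulr_ge0// ltW.
have mg1 : measurable_fun setT (fun x => ln M * (a * v x)) by exact: measurable_funM.
have g10 x : 0 <= ln M * (a * v x) by rewrite mulr_ge0.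
have mg2 : measurable_fun setT (fun x => (L * (1 - a)) * f' x) by exact: measurable_funM.
have g20 x : 0 <= (L * (1 - a)) * f' x by rewrite !mulr_ge0// ltW.
have mg3 : measurable_fun setT (fun x => (1 - a) * KL_fun (f' x)) by exact: measurable_funM.
have g30 x : 0 <= (1 - a) * KL_fun (f' x) by rewrite mulr_ge0 ?KL_fun_ge0// ltW.
have mh1 : measurable_fun setT (fun x => ln M * (a * v x) + a) by exact: measurable_funD.
have h10 x : 0 <= ln M * (a * v x) + a by rewrite addr_ge0// ltW.
have mh2 : measurable_fun setT (fun x => a * v x + (L * (1 - a)) * f' x).
  by exact: measurable_funD.
have h20 x : 0 <= a * v x + (L * (1 - a)) * f' x by rewrite addr_ge0.
have : (\int[m]_x ((1 - a) * KL_fun (f' x) + (ln M * (a * v x) + a))%:E <=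
        \int[m]_x (KL_fun (f x) + (a * v x + (L * (1 - a)) * f' x))%:E)%E.
  apply: ae_ge0_le_integral => //.
  - by move=> x _; rewrite lee_fin addr_ge0.
  - by apply/measurable_EFinP; exact: measurable_funD.
  - by move=> x _; rewrite lee_fin addr_ge0 ?KL_fun_ge0.
  - by apply/measurable_EFinP; exact: measurable_funD.
  apply: filterS2 fE vM => x fxE vx _; rewrite lee_fin.
  apply: truncation_pointwise => //.
  by have [/vx ->|fM] := leP (f x) M; [left; rewrite mulr0|right].
rewrite (integral_add m mg3 mh1)// (integral_scale m mKf' _ (ltW a10)); last first.
  by move=> x; exact: KL_fun_ge0.
rewrite (integral_add m mg1 (measurable_cst a) g10 (fun=> ltW a0)).
rewrite integral_scale// integral_scale// ?(ltW a0)// (density_setT vd).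
rewrite integral_prob_cst -(KL_density fd').
rewrite (integral_add m mKf mh2) => [|x|//]; last exact: KL_fun_ge0.
rewrite -(KL_density fd) Pk (integral_add m mu mg2)// integral_scale// ?(ltW a0)//.
rewrite (density_setT vd) integral_scale// ?(density_setT fd'); last by rewrite mulr_ge0// ltW.
(* The price of renormalizing the remaining mass, from ln t <= t - 1 at t = 1 / (1 - a). *)
have La : L * (1 - a) <= a.
  have := ln_le_sub1 (_ : 0 < (1 - a)^-1); rewrite invr_gt0 => /(_ a10).
  rewrite lnV ?posrE// -/L => LL.
  have aE : a = ((1 - a)^-1 - 1) * (1 - a).
    by rewrite mulrBl mulVf ?gt_eqF//; lra.
  by rewrite [leRHS]aE ler_wpM2r// ltW.
have := KL_ge0 P' m; case: (KL P' m) => [r| |]//= r0.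
  rewrite !mule1 -!EFinM -!EFinD !lee_fin => H.
  by rewrite ler_pdivlMr//; lra.
by rewrite gt0_muley ?lte_fin// !mule1 -!EFinM -!EFinD.
Qed.

End truncation.

(** * The relaxed problem *)

Section energy.
Context (R : realType) (n : nat).
Local Notation X := 'rV[R]_n.
Variables (mu nu : probability X R) (Lambda : R).
Hypotheses (P2mu : P2 mu) (P2nu : P2 nu) (L0 : 0 < Lambda).
Implicit Types (gamma : probability (X * X)%type R).
Local Notation E := (energy Lambda mu nu).

Let scaled_KL_ge0 (P m : probability X R) : (0 <= Lambda%:E * KL P m)%E.
Proof. by apply: mule_ge0; [rewrite lee_fin ltW|exact: KL_ge0]. Qed.

Lemma energy_ge0 gamma : (0 <= E gamma)%E.
Proof. by apply: adde_ge0 => //; apply: adde_ge0 => //; exact: cost_ge0. Qed.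

Lemma energyE gamma (c a b : R) : cost gamma = c%:E ->
  KL (marginal1 gamma) mu = a%:E -> KL (marginal2 gamma) nu = b%:E ->
  E gamma = (c + Lambda * a + Lambda * b)%:E.
Proof. by move=> gc ga gb; rewrite /energy gc ga gb -!EFinM -!EFinD. Qed.

Lemma energy_fin gamma : (E gamma < +oo)%E -> exists c a b : R,
  [/\ cost gamma = c%:E, KL (marginal1 gamma) mu = a%:E,
      KL (marginal2 gamma) nu = b%:E & [/\ 0 <= c, 0 <= a & 0 <= b]].
Proof.
rewrite /energy; have := cost_ge0 gamma; have := KL_ge0 (marginal1 gamma) mu.
have := KL_ge0 (marginal2 gamma) nu.
case: (cost gamma) => [c| |]//; case: (KL (marginal1 gamma) mu) => [a| |]//;
case: (KL (marginal2 gamma) nu) => [b| |]//; rewrite ?lee_fin => b0 a0 c0;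
  rewrite ?gt0_muley ?lte_fin// => _.
by exists c, a, b.
Qed.

Lemma energy_coupling gamma : couplings mu nu gamma -> E gamma = cost gamma.
Proof.
move=> [g1 g2]; rewrite /energy (KL_measure_eq _ g1) (KL_measure_eq _ g2).
by rewrite !KL_self !mule0 !adde0.
Qed.

(** Finite entropies cancel. Since swapping keeps the marginals, optimality for the energy thus
    yields the cost comparison that [optimal_monotone] asks for. *)
Lemma energy_measure_eq_marginals gamma gamma' :
  measure_eq (marginal1 gamma) (marginal1 gamma') ->
  measure_eq (marginal2 gamma) (marginal2 gamma') ->
  (E gamma < +oo)%E -> (E gamma <= E gamma')%E -> (cost gamma <= cost gamma')%E.
Proof.
move=> e1 e2 /energy_fin[c [a [b [gc ga gb _]]]].
rewrite (energyE gc ga gb) /energy -(KL_measure_eq _ e1) -(KL_measure_eq _ e2) ga gb gc.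
have := cost_ge0 gamma'; case: (cost gamma') => [c'| |]// _; last by move=> _; rewrite leey.
by rewrite -!EFinM -!EFinD !lee_fin; lra.
Qed.

Lemma energy_minimizer : exists gamma, is_solution setT E gamma.
Proof.
have pc := product_coupling mu nu.
have fin0 : (E (mu \x nu)%E < +oo)%E.
  by rewrite energy_coupling//; exact/second_moment_cost/(coupling_second_moment P2mu P2nu pc).
have [|U UU s_ B _ EB|gamma _ H] :=
    @minimizer_exists R _ setT E (mu \x nu)%E Logic.I fin0.
- exact: energy_ge0.
- have bound k : (KL (marginal1 (s_ k)) mu <= (B / Lambda)%:E)%E /\
      (KL (marginal2 (s_ k)) nu <= (B / Lambda)%:E)%E.
    have Ek : (E (s_ k) < +oo)%E by apply: le_lt_trans (EB k) (ltry _).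
    have [c [a [b [gc ga gb [c0 a0 b0]]]]] := energy_fin Ek.
    have := EB k; rewrite (energyE gc ga gb) ga gb !lee_fin !ler_pdivlMr// => H.
    have la : 0 <= Lambda * a by rewrite mulr_ge0// ltW.
    have lb : 0 <= Lambda * b by rewrite mulr_ge0// ltW.
    by split; rewrite mulrC; lra.
  have [||gamma gg] := @plans_compact _ _ U UU s_ mu nu (B / Lambda).
  + by move=> k; have [] := bound k.
  + by move=> k; have [] := bound k.
  exists gamma => //.
  apply: lsc_along_add => [t|t||].
  + by apply: adde_ge0 => //; exact: cost_ge0.
  + by [].
  + apply: lsc_along_add => [t|t||].
    * exact: cost_ge0.
    * by [].
    * exact: cost_lsc.
    * apply: lsc_along_scale => // L.
      exact: (KL_lsc (rectangle_cvg_marginal1 gg)).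
  + apply: lsc_along_scale => // L.
    exact: (KL_lsc (rectangle_cvg_marginal2 gg)).
by exists gamma; split => // gamma' _; exact: H.
Qed.

Lemma energy_solution_le gamma gamma' : is_solution setT E gamma ->
  couplings mu nu gamma' -> (E gamma <= cost gamma')%E.
Proof. by move=> [_ opt] C; rewrite -energy_coupling//; exact: opt. Qed.

Lemma energy_solution_fin gamma : is_solution setT E gamma -> (E gamma < +oo)%E.
Proof.
move=> sol; have pc := product_coupling mu nu.
apply: le_lt_trans (energy_solution_le sol pc) _.
exact/second_moment_cost/(coupling_second_moment P2mu P2nu pc).
Qed.

Lemma energy_unique gamma gamma' : is_solution setT E gamma ->
  is_solution setT E gamma' -> measure_eq gamma gamma'.
Proof.
move=> sol sol'; have [_ opt] := sol; have [_ opt'] := sol'.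
have fin := energy_solution_fin sol.
have [c [a [b [gc ga gb [c0 a0 b0]]]]] := energy_fin fin.
have [c' [a' [b' [gc' ga' gb' [c'0 a'0 b'0]]]]] := energy_fin (energy_solution_fin sol').
have EE : c + Lambda * a + Lambda * b = c' + Lambda * a' + Lambda * b'.
  have : E gamma = E gamma' by apply/eqP; rewrite eq_le opt ?opt'.
  by rewrite (energyE gc ga gb) (energyE gc' ga' gb') => -[].
pose av := average gamma gamma'.
have [a'' Ka [la ea]] := KL_average ga ga'.
have [b'' Kb [lb eb]] := KL_average gb gb'.
rewrite -(KL_measure_eq _ (marginal1_average gamma gamma')) in Ka.
rewrite -(KL_measure_eq _ (marginal2_average gamma gamma')) in Kb.
have Kc : cost av = ((c + c') / 2)%:E.
  by rewrite cost_average gc gc' -EFinD -EFinM; congr EFin; lra.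
have Eav := energyE Kc Ka Kb.
have lav : c + Lambda * a + Lambda * b <= (c + c') / 2 + Lambda * a'' + Lambda * b''.
  by rewrite -lee_fin -Eav -(energyE gc ga gb) opt.
have Lla : Lambda * a'' <= Lambda * ((a + a') / 2) by rewrite ler_wpM2l// ltW.
have Llb : Lambda * b'' <= Lambda * ((b + b') / 2) by rewrite ler_wpM2l// ltW.
have {}ea : measure_eq (marginal1 gamma) (marginal1 gamma').
  apply: ea; apply: (mulfI (lt0r_neq0 L0)); lra.
have {}eb : measure_eq (marginal2 gamma) (marginal2 gamma').
  apply: eb; apply: (mulfI (lt0r_neq0 L0)); lra.
have EavE : E av = E gamma by rewrite Eav (energyE gc ga gb); congr EFin; lra.
apply: monotone_plan_unique => //.
- apply: (null_dominates_trans _ P2mu.1).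
  by apply: KL_fin_dominates; rewrite ga ltry.
- apply: optimal_monotone; first by rewrite Kc ltry.
  apply: energy_measure_eq_marginals.
  + exact/measure_eq_sym/swap_plan1.
  + exact/measure_eq_sym/swap_plan2.
  + by rewrite EavE.
  + by rewrite EavE; exact: opt.
Qed.

End energy.

(** * Second moment of the relaxed minimizers *)

Section second_moment.
Context (R : realType) (n : nat).
Local Notation X := 'rV[R]_n.

Lemma density_markov d (T : measurableType d) (P m : probability T R) f M :
  density P m f -> 0 <= M -> M * pr m (~` [set x | f x <= M]) <= 1.
Proof.
move=> fd M0; have [mf f0 Pf] := fd.
have mF : measurable (~` [set x | f x <= M]).
  by apply: measurableC; exact: measurable_le_const.
rewrite -lee_fin EFinM -prE// -(density_setT fd).
have -> : m (~` [set x | f x <= M]) = (\int[m]_x (\1_(~` [set x | f x <= M]) x)%:E)%E.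
  by rewrite integral_indic// setIT.
have m1 : measurable_fun setT (\1_(~` [set x | f x <= M]) : T -> R) by exact: measurable_indic.
rewrite -integral_scale//; apply: integral_le => //.
- exact: measurable_funM.
- by move=> x; rewrite mulr_ge0.
move=> x; rewrite indicE; case: (boolP (x \in _)) => [|_]; last by rewrite mulr0.
by rewrite inE /= => /negP; rewrite -ltNge mulr1 => /ltW.
Qed.

Variables (mu nu : probability X R) (Lambda : R).
Hypotheses (P2mu : P2 mu) (P2nu : P2 nu) (L0 : 0 < Lambda).
Local Notation E := (energy Lambda mu nu).
Variable gamma : probability (X * X)%type R.
Hypothesis sol : is_solution setT E gamma.

(** Both densities have to be large, since removing mass alters both marginals and may raise the
    entropy of one whose density is small there. *)
Lemma solution_density_bound (f g : X -> R) :
  density (marginal1 gamma) mu f -> density (marginal2 gamma) nu g ->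
  exists2 M : R, 0 <= M &
    pr gamma (~` [set x | f x <= M] `*` ~` [set y | g y <= M]) = 0.
Proof.
move=> fd gd; have [_ opt] := sol.
have [c [a [b [gc ga gb [c0 a0 b0]]]]] := energy_fin L0 (energy_solution_fin P2mu P2nu sol).
pose e := c + Lambda * a + Lambda * b.
have Ee : E gamma = e%:E by exact: energyE.
have la0 : 0 <= Lambda * a by rewrite mulr_ge0// ltW.
have lb0 : 0 <= Lambda * b by rewrite mulr_ge0// ltW.
have e0 : 0 <= e by rewrite /e; lra.
have eL0 : 0 <= e / Lambda by rewrite divr_ge0// ltW.
(* Removing mass p where both densities exceed M = exp lM saves at least
   2 p Lambda lM = 2 p (e + 2 Lambda), more than the normalization costs. *)
pose lM := e / Lambda + 2; pose M := expR lM.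
have M1 : 1 <= M by rewrite -(expR0 R) ler_expR /lM; lra.
have M0 : 0 < M by exact: expR_gt0.
have lnM : ln M = lM by rewrite expRK.
exists M; first exact: ltW.
have [mf f0 _] := fd; have [mg g0 _] := gd.
set F := [set x | f x <= M]; set G := [set y | g y <= M].
have mF : measurable F by exact: measurable_le_const.
have mG : measurable G by exact: measurable_le_const.
have mFc : measurable (~` F) by exact: measurableC.
have mGc : measurable (~` G) by exact: measurableC.
set A := ~` F `*` ~` G; have mA : measurable A by exact: measurableX.
have mAc : measurable (~` A) by exact: measurableC.
apply/eqP; apply: contraT => p_neq0; exfalso.
set p := pr gamma A in p_neq0.
have p0 : 0 < p by rewrite lt_neqAle eq_sym p_neq0 pr_ge0.
(* Needed to condition on the complement. If p = 1, [KL_dominated] with r = lM and Markov's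
   inequality give lM <= a + 1, against lM = e / Lambda + 2 and a <= e / Lambda. *)
have p1 : p < 1.
  rewrite lt_neqAle pr_le1// andbT; apply/eqP => p1.
  have F1 : pr (marginal1 gamma) (~` F) = 1.
    apply/eqP; rewrite eq_le pr_le1//= -p1 pr_marginal1; apply: le_pr => //.
      exact: measurableX.
    by move=> z [].
  have lM0 : 0 <= lM by rewrite /lM; lra.
  have Ka : (KL (marginal1 gamma) mu <= a%:E)%E by rewrite ga.
  have h1 := density_markov fd (ltW M0); have h2 := KL_dominated Ka lM0 mFc.
  rewrite F1 mulr1 -/M in h2; rewrite -/F in h1.
  have : a <= e / Lambda by rewrite ler_pdivlMr// /e mulrC; lra.
  have lME : lM = e / Lambda + 2 by [].
  by lra.
have q0 : 0 < pr gamma (~` A) by rewrite prC// subr_gt0.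
pose g1 : probability (X * X)%type R := conditioned mA p0.
pose g2 : probability (X * X)%type R := conditioned mAc q0.
have mix S : measurable S -> pr gamma S = p * pr g1 S + (1 - p) * pr g2 S.
  move=> mS; rewrite !pr_conditioned//.
  rewrite -/p prC// -/p !mulrA !divff ?gt_eqF ?subr_gt0// !mul1r.
  by rewrite (@prID _ _ _ gamma S A)// setDE.
have mixE : measure_eq gamma (mixture (ltW p0) (ltW p1) g1 g2).
  by apply/pr_measure_eq => S mS; rewrite pr_mixture// mix.
have c2 : (cost g2 <= (c / (1 - p))%:E)%E.
  have : (p%:E * cost g1 + (1 - p)%:E * cost g2 = c%:E)%E.
    rewrite -gc; apply: etrans (esym (integral_mixture (ltW p0) (ltW p1) g1 g2
      (@measurable_cost R n) _)) _.
      by move=> z; exact: sqnorm_ge0.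
    by apply: eq_measure_integral => S mS _; apply/esym; exact: mixE.
  have := cost_ge0 g1; have := cost_ge0 g2; have q1 : 0 < 1 - p by rewrite subr_gt0.
  case: (cost g1) => [u| |]//; case: (cost g2) => [v| |]//;
    rewrite ?gt0_muley ?lte_fin// => v0 u0; rewrite -?EFinM -?EFinD//.
  move=> -[uv]; rewrite lee_fin ler_pdivlMr//; rewrite lee_fin in u0.
  have : 0 <= p * u by rewrite mulr_ge0// ltW.
  lra.
have k1 : (KL (marginal1 g2) mu <= ((a - p * ln M + p) / (1 - p))%:E)%E.
  apply: (KL_truncate fd p0 p1 M1 _ _ ga (Q' := marginal1 g1)).
    by move=> S mS; rewrite !pr_marginal1 mix//; exact: measurableX.
  rewrite pr_marginal1 pr_conditioned; last exact: measurableX.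
  rewrite (_ : _ `&` A = set0) ?pr0 ?mulr0//.
  by apply/seteqP; split => z //= [[Fz _] [nFz _]].
have k2 : (KL (marginal2 g2) nu <= ((b - p * ln M + p) / (1 - p))%:E)%E.
  apply: (KL_truncate gd p0 p1 M1 _ _ gb (Q' := marginal2 g1)).
    by move=> S mS; rewrite !pr_marginal2 mix//; exact: measurableX.
  rewrite pr_marginal2 pr_conditioned; last exact: measurableX.
  rewrite (_ : _ `&` A = set0) ?pr0 ?mulr0//.
  by apply/seteqP; split => z //= [[_ Gz] [_ nGz]].
have finE2 : (E g2 < +oo)%E.
  rewrite /energy; apply: lte_add_pinfty; first apply: lte_add_pinfty.
  - exact: le_lt_trans c2 (ltry _).
  - by rewrite lte_mul_pinfty ?lee_fin ?ltW//; exact: le_lt_trans k1 (ltry _).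
  - by rewrite lte_mul_pinfty ?lee_fin ?ltW//; exact: le_lt_trans k2 (ltry _).
have [c' [a' [b' [gc' ga' gb' [c'0 a'0 b'0]]]]] := energy_fin L0 finE2.
move: c2 k1 k2; rewrite gc' ga' gb' !lee_fin lnM.
rewrite !ler_pdivlMr ?subr_gt0// => h1 h2 h3.
have := opt g2 Logic.I; rewrite Ee (energyE _ gc' ga' gb') lee_fin => h4.
have h5 : (1 - p) * e <= (1 - p) * (c' + Lambda * a' + Lambda * b').
  by rewrite ler_wpM2l// subr_ge0 ltW.
have h6 : Lambda * (a' * (1 - p)) <= Lambda * (a - p * lM + p) by rewrite ler_wpM2l// ltW.
have h7 : Lambda * (b' * (1 - p)) <= Lambda * (b - p * lM + p) by rewrite ler_wpM2l// ltW.
have LlM : Lambda * lM = e + 2 * Lambda.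
  by rewrite /lM mulrDr mulrCA divff ?gt_eqF// mulr1; ring.
have h8 : Lambda * (a - p * lM + p) + Lambda * (b - p * lM + p) =
    Lambda * a + Lambda * b - 2 * p * (Lambda * lM) + 2 * p * Lambda by ring.
(* The saving 2 p (e + 2 Lambda) minus the normalization cost 2 p Lambda; it contradicts p (e + 2
   Lambda) > 0. *)
have h9 : (1 - p) * e <= e - 2 * p * (e + Lambda).
  have h10 : (1 - p) * (c' + Lambda * a' + Lambda * b') =
      c' * (1 - p) + Lambda * (a' * (1 - p)) + Lambda * (b' * (1 - p)) by ring.
  have h11 : 2 * p * (Lambda * lM) = 2 * p * (e + Lambda) + 2 * p * Lambda.
    by rewrite LlM; ring.
  have eE : e = c + Lambda * a + Lambda * b by [].
  lra.
have : 0 < p * (e + 2 * Lambda) by rewrite mulr_gt0// ltr_wpDl// mulr_gt0.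
by nra.
Qed.

Lemma solution_second_moment : finite_second_moment gamma.
Proof.
have finE := energy_solution_fin P2mu P2nu sol.
have [c [a [b [gc ga gb [c0 a0 b0]]]]] := energy_fin L0 finE.
have [|f fd] := @KL_fin_density _ _ _ (marginal1 gamma) mu; first by rewrite ga ltry.
have [|g gd] := @KL_fin_density _ _ _ (marginal2 gamma) nu; first by rewrite gb ltry.
have [M M0 null] := solution_density_bound fd gd.
have [mf f0 _] := fd; have [mg g0 _] := gd.
have msq : measurable_fun setT (@sqnorm R n).
  by apply: (@measurable_sqnorm R n _ X id).
have sq0 x : 0 <= @sqnorm R n x by exact: sqnorm_ge0.
pose u (h : X -> R) (x : X) : R := \1_[set x | h x <= M] x * sqnorm x.
have mu_ h : measurable_fun setT h -> measurable_fun setT (u h).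
  move=> mh; apply: measurable_funM => //; apply: measurable_indic.
  exact: measurable_le_const.
have u0 h x : 0 <= u h x by rewrite mulr_ge0.
have uM h x : 0 <= h x -> u h x * h x <= M * sqnorm x.
  move=> h0; rewrite /u indicE; case: (boolP (x \in _)) => [|_].
    2: by rewrite !mul0r mulr_ge0.
  by rewrite inE /= => hM; rewrite mul1r mulrC ler_wpM2r.
have bound (P m : probability X R) h : P2 m -> density P m h ->
    (\int[P]_x (u h x)%:E < +oo)%E.
  move=> [_ m2] hd; have [mh h0 _] := hd.
  rewrite (density_change hd (mu_ h mh) (u0 h)).
  apply: (@le_lt_trans _ _ (\int[m]_x (M * sqnorm x)%:E)%E).
    apply: integral_le.
    - by apply: measurable_funM => //; exact: mu_.
    - exact: measurable_funM.
    - by move=> x; rewrite mulr_ge0.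
    - by move=> x; exact: uM.
  by rewrite integral_scale// lte_mul_pinfty// lee_fin.
have m1 : measurable_fun setT (fun z : X * X => u f z.1).
  exact: (measurableT_comp (mu_ f mf) measurable_fst).
have m2 : measurable_fun setT (fun z : X * X => u g z.2).
  exact: (measurableT_comp (mu_ g mg) measurable_snd).
have b1 : (\int[gamma]_z (u f z.1)%:E < +oo)%E.
  rewrite (@integral_marginal1 _ _ gamma (marginal1 gamma))//; last exact: mu_.
  exact: bound P2mu fd.
have b2 : (\int[gamma]_z (u g z.2)%:E < +oo)%E.
  rewrite (@integral_marginal2 _ _ gamma (marginal2 gamma))//; last exact: mu_.
  exact: bound P2nu gd.
have mc := @measurable_cost R n.
have ms : measurable_fun setT (fun z : X * X => u f z.1 + u g z.2) by exact: measurable_funD.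
(* If f x <= M, then |x|^2 + |y|^2 <= 3 |x|^2 + 2 |x - y|^2, and symmetrically if g y <= M; one of
   the two holds outside the null set. *)
apply: (@le_lt_trans _ _ (\int[gamma]_z
  (3 * (u f z.1 + u g z.2) + 2 * sqnorm (z.1 - z.2))%:E)%E).
  apply: ae_ge0_le_integral => //.
  - by move=> z _; rewrite lee_fin addr_ge0.
  - apply/measurable_EFinP; apply: measurable_funD.
      exact: (measurableT_comp msq measurable_fst).
    exact: (measurableT_comp msq measurable_snd).
  - by move=> z _; rewrite lee_fin addr_ge0// mulr_ge0// addr_ge0.
  - by apply/measurable_EFinP; apply: measurable_funD; exact: measurable_funM.
  have mN : measurable (~` [set x | f x <= M] `*` ~` [set y | g y <= M]).
    by apply: measurableX; apply: measurableC; exact: measurable_le_const.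
  exists (~` [set x | f x <= M] `*` ~` [set y | g y <= M]); split => //.
    by apply: etrans (prE gamma mN) _; rewrite null.
  move=> [x y] /= nH; split => /= hM; apply: nH => _; rewrite lee_fin /u !indicE.
    rewrite (mem_set (hM : [set x | f x <= M] x)) mul1r.
    have : sqnorm y <= 2 * (sqnorm x + sqnorm (x - y)).
      by have := sqnormB_le x (x - y); rewrite opprB addrC subrK.
    have := mulr_ge0 (_ : 0 <= (y \in [set x0 | g x0 <= M])%:R :> R) (sq0 y).
    by move=> /(_ (ler0n _ _)); have := sq0 x; lra.
  rewrite (mem_set (hM : [set x | g x <= M] y)) mul1r.
  have : sqnorm x <= 2 * (sqnorm y + sqnorm (x - y)).
    have -> : sqnorm (x - y) = sqnorm (y - x).
      by apply: eq_bigr => i _; rewrite !mxE; ring.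
    have := sqnormB_le y (y - x).
    by rewrite opprB addrC subrK.
  have := mulr_ge0 (_ : 0 <= (x \in [set x0 | f x0 <= M])%:R :> R) (sq0 x).
  by move=> /(_ (ler0n _ _)); have := sq0 y; lra.
rewrite integral_add; [|exact: measurable_funM|exact: measurable_funM|
  by move=> z; rewrite mulr_ge0// addr_ge0|by move=> z; rewrite mulr_ge0].
rewrite !integral_scale//; last by move=> z; rewrite addr_ge0.
rewrite integral_add//; apply: lte_add_pinfty.
  by rewrite lte_mul_pinfty ?lee_fin//; exact: lte_add_pinfty.
by rewrite lte_mul_pinfty ?lee_fin//; have := gc; rewrite /cost => ->; exact: ltry.
Qed.

End second_moment.

(** * Convergence of the relaxed minimizers *)

(** If the preimage of some A in G is not in F, its complement can be added to F, and an ultrafilter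
    finer than the result contradicts the hypothesis. This stands in for the argument by
    subsequences of subsequences. *)
Lemma cvg_ultra (T V : Type) (F : set_system T) {FF : ProperFilter F} (u : T -> V)
    (G : set_system V) :
  (forall U : set_system T, UltraFilter U -> F `<=` U -> u @ U --> G) -> u @ F --> G.
Proof.
move=> H A GA; apply: contrapT => nFA.
have FW : ProperFilter (within (~` (u @^-1` A)) F).
  split; last exact: within_filter.
  rewrite /within => FA; apply: nFA; change (F (u @^-1` A)).
  by apply: (@filterS T F _ _ _ _ FA) => x; exact: contrapT.
have [U [UU WU]] := ultraFilterLemma FW.
have UA : U (u @^-1` A).
  by apply: (H U UU _ A GA) => B FB; apply: WU; apply: filterS FB.
have UnA : U (~` (u @^-1` A)) by apply: WU; exact: withinT.
have : U set0 by rewrite -(setICr (u @^-1` A)); exact: filterI.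
by move/filter_ex => [].
Qed.

Section weak_limits.
Context (R : realType) (n : nat).
Local Notation X := 'rV[R]_n.
Implicit Types (P gamma : probability (X * X)%type R) (f : X * X -> R).

Lemma bounded_integral_bounds f B P : continuous f -> (forall z, 0 <= f z <= B) ->
  exists2 I : R, (\int[P]_z (f z)%:E = I%:E)%E & 0 <= I <= B.
Proof.
move=> cf fB; have f0 z : 0 <= f z by have /andP[] := fB z.
have mf := continuous_nonneg_measurable cf f0.
have : (\int[P]_z (f z)%:E <= B%:E)%E.
  rewrite -(integral_prob_cst P); apply: integral_le => // z.
  by have /andP[] := fB z.
have : (0 <= \int[P]_z (f z)%:E)%E by exact: integral_nonneg.
case: (\int[P]_z (f z)%:E)%E => [I| |]//; rewrite !lee_fin => I0 IB.
by exists I => //; apply/andP.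
Qed.

(** [lsc_integral] handles nonnegative functions; a bounded [f] is reached through both B + f and B
    - f, whose integrals add up to 2 B. *)
Lemma integral_shift f B P : continuous f -> (forall z, `|f z| <= B) ->
  exists I : R, [/\ (\int[P]_z (B + f z)%:E = I%:E)%E, 0 <= I <= 2 * B,
    (\int[P]_z (B - f z)%:E = (2 * B - I)%:E)%E & (\int[P]_z (f z)%:E = (I - B)%:E)%E].
Proof.
move=> cf fB; have fb z : - B <= f z /\ f z <= B.
  by have := fB z; rewrite ler_norml => /andP[].
have cp : continuous (fun z => B + f z) by move=> z; apply: cvgD; [exact: cvg_cst|exact: cf].
have cm : continuous (fun z => B - f z) by move=> z; apply: cvgB; [exact: cvg_cst|exact: cf].
have p0 z : 0 <= B + f z <= 2 * B by have [] := fb z; lra.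
have m0 z : 0 <= B - f z <= 2 * B by have [] := fb z; lra.
have p0' z : 0 <= B + f z by have [] := fb z; lra.
have m0' z : 0 <= B - f z by have [] := fb z; lra.
have mp := continuous_nonneg_measurable cp p0'.
have mm := continuous_nonneg_measurable cm m0'.
have [I IE I0] := bounded_integral_bounds P cp p0.
have [J JE J0] := bounded_integral_bounds P cm m0.
have IJ : I + J = 2 * B.
  apply: EFin_inj; rewrite EFinD -IE -JE -integral_add// -[RHS](integral_prob_cst P).
  by apply: eq_integral => z _; congr EFin; lra.
exists I; split => //; first by rewrite JE; congr EFin; lra.
transitivity (\int[P]_z ((B + f z)%:E - B%:E))%E.
  by apply: eq_integral => z _; rewrite -EFinB; congr EFin; lra.
rewrite integralB_EFin//.
- by rewrite IE integral_prob_cst.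
- apply/integrableP; split; first exact/measurable_EFinP.
  by under eq_integral do rewrite /= ger0_norm//; rewrite IE ltry.
- exact: finite_measure_integrable_cst.
Qed.

(** Lower semicontinuity for B + f and for B - f gives the two opposite inequalities on the limit of
    the integrals. *)
Lemma rectangle_cvg_weak (U : set_system nat) {UU : UltraFilter U} s_ gamma f B :
  rectangle_cvg U s_ gamma -> continuous f -> (forall z, `|f z| <= B) ->
  (\int[s_ k]_z (f z)%:E)%E @[k --> U] --> (\int[gamma]_z (f z)%:E)%E.
Proof.
move=> gg cf fB; have fb z : - B <= f z /\ f z <= B.
  by have := fB z; rewrite ler_norml => /andP[].
have [I [IE _ JE fE]] := integral_shift gamma cf fB.
have /choice[I_ H] : forall k, exists I : R, [/\ (\int[s_ k]_z (B + f z)%:E = I%:E)%E,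
    0 <= I <= 2 * B, (\int[s_ k]_z (B - f z)%:E = (2 * B - I)%:E)%E &
    (\int[s_ k]_z (f z)%:E = (I - B)%:E)%E].
  by move=> k; exact: integral_shift.
have [|l Il] := @ultra_bounded_cvg R U UU I_ 0 (2 * B).
  by apply: nearW => k; have [] := H k.
have lE : l = I.
  apply/eqP; rewrite eq_le; apply/andP; split; apply/ler_addgt0Pr => e e0.
    have le : l - e < l by rewrite ltrBlDr ltrDl.
    suff : ((2 * B - I)%:E <= (2 * B - l + e)%:E)%E by rewrite lee_fin; lra.
    rewrite -JE; apply: (lsc_integral gg).
    - by move=> z; apply: cvgB; [exact: cvg_cst|exact: cf].
    - by move=> z; have [] := fb z; lra.
    apply: filterS (cvgr_gt _ Il _ le) => k lk.
    by have [_ _ -> _] := H k; rewrite lee_fin; lra.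
  have le : l < l + e by rewrite ltrDl.
  rewrite -lee_fin -IE; apply: (lsc_integral gg).
  - by move=> z; apply: cvgD; [exact: cvg_cst|exact: cf].
  - by move=> z; have [] := fb z; lra.
  apply: filterS (cvgr_lt _ Il _ le) => k lk.
  by have [-> _ _ _] := H k; rewrite lee_fin ltW.
rewrite fE; under eq_fun => k do (have [_ _ _ ->] := H k).
by apply: cvg_EFin; [exact: nearW|apply: cvgB; [rewrite -lE|exact: cvg_cst]].
Qed.

End weak_limits.

Section relaxation.
Context (R : realType) (n : nat).
Local Notation X := 'rV[R]_n.
Variables (mu nu : probability X R).
Hypotheses (P2mu : P2 mu) (P2nu : P2 nu).

(** The energy of a coupling is its cost c, so each of the three nonnegative terms of the minimal
    energy is at most c. *)
Lemma energy_solution_bounds (Lambda c : R) (gamma gamma' : probability (X * X)%type R) :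
  0 < Lambda -> is_solution setT (energy Lambda mu nu) gamma ->
  couplings mu nu gamma' -> cost gamma' = c%:E ->
  [/\ (cost gamma <= c%:E)%E, (KL (marginal1 gamma) mu <= (c / Lambda)%:E)%E &
      (KL (marginal2 gamma) nu <= (c / Lambda)%:E)%E].
Proof.
move=> L0 sol Cg cE; have := energy_solution_le sol Cg.
have [c' [a [b [gc ga gb [c0 a0 b0]]]]] := energy_fin L0 (energy_solution_fin P2mu P2nu sol).
rewrite (energyE _ gc ga gb) gc ga gb cE !lee_fin !ler_pdivlMr// !(mulrC _ Lambda) => H.
have la : 0 <= Lambda * a by rewrite mulr_ge0// ltW.
have lb : 0 <= Lambda * b by rewrite mulr_ge0// ltW.
by split; lra.
Qed.

Variables (Lambda : nat -> R) (s_ : nat -> probability (X * X)%type R).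
Variable gamma_OT : probability (X * X)%type R.
Hypotheses (Lambda_gt0 : forall k, 0 < Lambda k) (Lambda0 : forall k, Lambda 0%N <= Lambda k).
Hypothesis Lambda_oo : Lambda @ \oo --> +oo.
Hypothesis sol : forall k, is_solution setT (energy (Lambda k) mu nu) (s_ k).
Hypothesis sol_OT : is_solution (couplings mu nu) (@cost R n) gamma_OT.

Lemma relaxed_solutions_cvg (U : set_system nat) {UU : UltraFilter U} : \oo `<=` U ->
  exists2 gamma, rectangle_cvg U s_ gamma & measure_eq gamma gamma_OT.
Proof.
move=> ooU; have [C_OT opt_OT] := sol_OT.
have fin_OT := second_moment_cost (coupling_second_moment P2mu P2nu C_OT).
have [c cE] : exists c, cost gamma_OT = c%:E.
  move: fin_OT; have := cost_ge0 gamma_OT.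
  by case: (cost gamma_OT) => [c| |]// _ _; exists c.
have c0 : 0 <= c by rewrite -lee_fin -cE cost_ge0.
have bounds k := energy_solution_bounds (Lambda_gt0 k) (sol k) C_OT cE.
(* Compactness needs a bound valid for every index; [small] below then forces both entropies of the
   limit to vanish, which makes it a coupling. *)
have decay k : c / Lambda k <= c / Lambda 0 by rewrite ler_wpM2l// lef_pV2 ?posrE.
have [||gamma gg] := @plans_compact _ _ U UU s_ mu nu (c / Lambda 0).
- by move=> k; have [_ /le_trans + _] := bounds k; apply; rewrite lee_fin.
- by move=> k; have [_ _ /le_trans] := bounds k; apply; rewrite lee_fin.
exists gamma => //.
have small (e : R) : 0 < e -> \forall k \near U, c / Lambda k <= e.
  move=> e0; apply: ooU; have /cvgryPge/(_ (c / e)) := Lambda_oo.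
  apply: filterS => k; rewrite ler_pdivrMr// => ck.
  by rewrite ler_pdivrMr// mulrC.
have cost_le : (cost gamma <= cost gamma_OT)%E.
  rewrite cE; apply: (cost_lsc gg); apply: nearW => k.
  by have [] := bounds k.
have KL1 : KL (marginal1 gamma) mu = 0%E.
  apply/eqP; rewrite eq_le KL_ge0 andbT; apply/lee_addgt0Pr => e e0; rewrite add0e.
  apply: (KL_lsc (rectangle_cvg_marginal1 gg)); apply: filterS (small e e0) => k ke.
  by have [_ /le_trans + _] := bounds k; apply; rewrite lee_fin.
have KL2 : KL (marginal2 gamma) nu = 0%E.
  apply/eqP; rewrite eq_le KL_ge0 andbT; apply/lee_addgt0Pr => e e0; rewrite add0e.
  apply: (KL_lsc (rectangle_cvg_marginal2 gg)); apply: filterS (small e e0) => k ke.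
  by have [_ _ /le_trans] := bounds k; apply; rewrite lee_fin.
apply: (transport_unique P2mu.1 _ _ sol_OT); first exact: le_lt_trans cost_le _.
split; first by split; exact: KL_eq0.
by move=> g' Cg'; apply: le_trans cost_le _; exact: opt_OT.
Qed.

Lemma relaxed_solutions_weak_cvg : weakly_converges s_ gamma_OT.
Proof.
move=> f cf bf; have [B fB] : exists B, forall z, `|f z| <= B.
  have [M [_ HM]] := bf; exists (M + 1) => z.
  by apply: (HM (M + 1)) => //; rewrite ltrDl.
apply: cvg_ultra => U UU ooU; have [gamma gg gOT] := relaxed_solutions_cvg ooU.
have <- : (\int[gamma]_z (f z)%:E = \int[gamma_OT]_z (f z)%:E)%E.
  by apply: eq_measure_integral => A mA _; exact: gOT.
exact: rectangle_cvg_weak gg cf fB.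
Qed.

End relaxation.

Theorem theorem8 (R : realType) (d : nat)
    (mu nu : probability 'rV[R]_d R) (Kmu Knu : R) (Lambda : nat -> R) :
  P2 mu -> P2 nu ->
  0 < Kmu -> 0 < Knu ->
  log_sobolev Kmu mu -> log_sobolev Knu nu ->
  (forall n, 0 < Lambda n) ->
  nondecreasing_seq Lambda ->
  Lambda @ \oo --> +oo ->
  exists (gamma_ : nat -> probability ('rV[R]_d * 'rV[R]_d)%type R)
         (gamma_OT : probability ('rV[R]_d * 'rV[R]_d)%type R),
    [/\ forall n, is_unique_solution setT (energy (Lambda n) mu nu) (gamma_ n),
        is_unique_solution (couplings mu nu) (@cost R d) gamma_OT,
        forall n, finite_second_moment (gamma_ n),
        finite_second_moment gamma_OT &
        weakly_converges gamma_ gamma_OT].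
Proof.
move=> P2mu P2nu _ _ _ _ L0 Lmono Loo.
have /choice[gamma_ sol] : forall k, exists gamma,
    is_solution setT (energy (Lambda k) mu nu) gamma.
  by move=> k; exact: energy_minimizer.
have [gamma_OT sol_OT] := transport_minimizer P2mu P2nu.
have fin_OT := coupling_second_moment P2mu P2nu sol_OT.1.
exists gamma_, gamma_OT; split => //.
- by move=> k; split => // g solg; exact: (energy_unique P2mu P2nu (L0 k) solg (sol k)).
- split => // g solg; apply: (transport_unique P2mu.1 _ solg sol_OT).
  exact/second_moment_cost/(coupling_second_moment P2mu P2nu solg.1).
- by move=> k; exact: (solution_second_moment P2mu P2nu (L0 k) (sol k)).
- by apply: (relaxed_solutions_weak_cvg P2mu P2nu L0 _ Loo sol sol_OT) => k; exact: Lmono.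
Qed.
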